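(* Let $h,n$ be non-negative integers with $n\ge h$ and let $A(x,y)$ be a hidden formal power series. Let $k_1<k_2<\dots<k_n$ be integers. Then the number $\mathrm{MT}_h(k_1,\ldots,k_n)$ of $(h,n)$-monotone trapezoids with bottom row $(k_1,\ldots,k_n)$ is $$ \mathrm{MT}_h(k_1,\ldots,k_n)=\prod_{1\le i<j\le n}\mathrm{Strict}_{k_i,k_j}^{-1}\,A_{k_i,k_j}\;\mathrm{GT}_h(k_1,\ldots,k_n), $$ where the operators on the right-hand side are applied to $\mathrm{GT}_h$ as a polynomial in the variables $k_1,\ldots,k_n$, and only afterwards $k_1,\ldots,k_n$ are specialized to the given integers.
   Context: Trapezoids. For integers $n\ge h\ge 0$, an $(h,n)$-Gelfand--Tsetlin trapezoid is an array of integers $(a_{s,t})$ with $0\le s\le h$, $1\le t\le n-h+s$ (row $s$ has $n-h+s$ entries; row $0$ is empty if $h=n$) such that $a_{s,t}\le a_{s-1,t}\le a_{s,t+1}$ for all $1\le s\le h$, $1\le t\le n-h+s-1$. Its bottom row is $(a_{h,1},\ldots,a_{h,n})$. An $(h,n)$-monotone trapezoid is an $(h,n)$-Gelfand--Tsetlin trapezoid all of whose rows are strictly increasing. $\mathrm{GT}_h(k_1,\ldots,k_n)$ denotes the polynomial in $k_1,\ldots,k_n$ whose value at all integers $k_1\le\dots\le k_n$ is the number of $(h,n)$-Gelfand--Tsetlin trapezoids with bottom row $(k_1,\ldots,k_n)$ (so $\mathrm{GT}_0=1$). Operators. $\mathrm{E}_x f(x)=f(x+1)$ is the shift operator and $\Delta_x=\mathrm{E}_x-\mathrm{id}$.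 Set $\mathrm{Strict}_{x,y}=\mathrm{E}_x^{-1}+\mathrm{E}_y-\mathrm{E}_x^{-1}\mathrm{E}_y=\mathrm{E}_x^{-1}(\mathrm{id}+\mathrm{E}_y\Delta_x)$; on polynomials it is invertible with $\mathrm{Strict}_{x,y}^{-1}=\mathrm{E}_x\sum_{i\ge0}(-1)^i\mathrm{E}_y^i\Delta_x^i$ (a finite sum on each polynomial). For a formal power series $A(x,y)$, $A_{x,y}=A(\Delta_x,\Delta_y)$ as an operator on polynomials. Hidden formal power series. Let $\iota(x)=-\frac{x}{1+x}$, as a formal power series. A formal power series $A(x,y)$ over $\mathbb{C}$ is called hidden if there is a formal power series $P(x,y)$ over $\mathbb{C}$ with non-vanishing constant term satisfying $$\frac{P(x,\iota(x))P(\iota(x),x)}{P(x,x)P(\iota(x),\iota(x))}=\frac{1+x}{1+x+x^2}$$ such that $$A(x,y)=(1+x+y)\frac{P(x,y)P(y,x)}{P(\iota(x),y)P(\iota(y),x)}\quad\text{or}\quad A(x,y)=(1-xy)\frac{P(x,y)P(y,x)}{P(\iota(x),y)P(\iota(y),x)}.$$ *)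

(* Defs.v *)
From HB Require Import structures.
From mathcomp Require Import all_boot all_order all_algebra.
From mathcomp Require Import finmap.
From mathcomp Require Import boolp classical_sets cardinality reals.
From mathcomp Require Import complex.
From mathcomp Require Import mpoly.

Set Implicit Arguments.
Unset Strict Implicit.
Unset Printing Implicit Defensive.

Import Order.TTheory GRing.Theory Num.Theory.

Local Open Scope ring_scope.

(** * Formal power series *)

(* [f n] is the coefficient of the n-th power of the variable. *)
Definition fps (R : Type) := nat -> R.

HB.instance Definition _ (R : Type) := gen_eqMixin (fps R).
HB.instance Definition _ (R : Type) := gen_choiceMixin (fps R).

Section FpsZmod.
Variable R : zmodType.
Implicit Types f g : fps R.

Definition fps_zero : fps R := fun _ => 0.
Definition fps_add f g : fps R := fun n => f n + g n.
Definition fps_opp f : fps R := fun n => - f n.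

Fact fps_addA : associative fps_add.
Proof. by move=> f g h; apply: functional_extensionality_dep => n; rewrite /fps_add addrA. Qed.
Fact fps_addC : commutative fps_add.
Proof. by move=> f g; apply: functional_extensionality_dep => n; rewrite /fps_add addrC. Qed.
Fact fps_add0 : left_id fps_zero fps_add.
Proof. by move=> f; apply: functional_extensionality_dep => n; rewrite /fps_add add0r. Qed.
Fact fps_addN : left_inverse fps_zero fps_opp fps_add.
Proof. by move=> f; apply: functional_extensionality_dep => n; rewrite /fps_add addNr. Qed.

HB.instance Definition _ := GRing.isZmodule.Build (fps R)
  fps_addA fps_addC fps_add0 fps_addN.
End FpsZmod.

Section FpsRing.
Variable R : comNzRingType.
Implicit Types f g : fps R.

Definition fps_one : fps R := fun n => (n == 0)%N%:R.
Definition fps_mul f g : fps R := fun n => \sum_(i < n.+1) f i * g (n - i)%N.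

Fact fps_mulC : commutative fps_mul.
Proof.
move=> f g; apply: functional_extensionality_dep => n; rewrite /fps_mul.
rewrite (reindex_inj rev_ord_inj) /=; apply: eq_bigr => i _.
by rewrite subSS mulrC subKn // -ltnS.
Qed.

Fact fps_mulA : associative fps_mul.
Proof.
move=> f g h; apply: functional_extensionality_dep => n; rewrite [fps_mul (fps_mul f g) h]fps_mulC.
pose F j k := f j * (h k * g (n - j - k)%N).
transitivity (\sum_(j < n.+1) \sum_(k < n.+1 | (k <= n - j)%N) F j k).
  apply: eq_bigr => /= j _; rewrite -[fps_mul g h]/(fps_mul g h) fps_mulC mulr_sumr.
  rewrite (big_ord_narrow_leq (leq_subr j n)).
  by apply: eq_bigr => k _.
rewrite (exchange_big_dep predT) //=; apply: eq_bigr => k _.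
transitivity (\sum_(j < n.+1 | (j <= n - k)%N) F j k).
  apply: eq_bigl => j; rewrite -ltnS -(ltnS j) -!subSn ?leq_ord //.
  by rewrite -subn_gt0 -(subn_gt0 j) -!subnDA addnC.
rewrite (big_ord_narrow_leq (leq_subr k n)) mulr_sumr.
by apply: eq_bigr => j _; rewrite /F mulrCA -!subnDA addnC.
Qed.

Fact fps_mul1 : left_id fps_one fps_mul.
Proof.
move=> f; apply: functional_extensionality_dep => n; rewrite /fps_mul big_ord_recl /=.
rewrite /fps_one eqxx mul1r subn0 big1 ?addr0 // => i _.
by rewrite mul0r.
Qed.

Fact fps_mulDl : left_distributive fps_mul (@fps_add R).
Proof.
move=> f g h; apply: functional_extensionality_dep => n.
rewrite /fps_mul /fps_add -big_split /=; apply: eq_bigr => i _.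
by rewrite mulrDl.
Qed.

Fact fps_one_neq0 : fps_one != fps_zero R.
Proof.
apply/eqP => /(congr1 (fun f => f 0%N)); rewrite /fps_one /fps_zero eqxx.
exact/eqP/oner_neq0.
Qed.

HB.instance Definition _ := GRing.Zmodule_isComNzRing.Build (fps R)
  fps_mulA fps_mulC fps_mul1 fps_mulDl fps_one_neq0.
End FpsRing.

Section FpsUnitRing.
Variable R : comUnitRingType.
Implicit Types f g : fps R.

(* The first [n] coefficients of the inverse of [f]. *)
Fixpoint fps_inv_seq f n : seq R :=
  if n is m.+1 then
    let s := fps_inv_seq f m in
    rcons s ((f 0)^-1 * ((m == 0)%:R - \sum_(i < m) s`_i * f (m - i)%N))
  else [::].

Definition fps_unit : pred (fps R) := fun f => f 0 \is a GRing.unit.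

(* As for every [unitRingType], a non-unit is its own "inverse". *)
Definition fps_inv f : fps R :=
  if fps_unit f then fun n => (fps_inv_seq f n.+1)`_n else f.

Fact size_fps_inv_seq f n : size (fps_inv_seq f n) = n.
Proof. by elim: n => //= n IHn; rewrite size_rcons IHn. Qed.

Fact fps_inv_seqE f n i : (i < n)%N ->
  (fps_inv_seq f n)`_i = (fps_inv_seq f i.+1)`_i.
Proof.
elim: n => // n IHn; rewrite ltnS leq_eqVlt => /predU1P[->//|lt_in].
by rewrite [LHS]/= nth_rcons size_fps_inv_seq lt_in IHn.
Qed.

Fact fps_mulV : {in fps_unit, left_inverse (1 : fps R) fps_inv *%R}.
Proof.
move=> f Uf; have Uf0 : f 0 \is a GRing.unit by [].
apply: functional_extensionality_dep => n.
have -> : fps_inv f = fun n => (fps_inv_seq f n.+1)`_n.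
  by rewrite /fps_inv ifT.
rewrite -[LHS]/(\sum_(i < n.+1) (fps_inv_seq f i.+1)`_i * f (n - i)%N).
rewrite big_ord_recr /= nth_rcons size_fps_inv_seq ltnn eqxx subnn.
rewrite mulrC mulVKr //.
under eq_bigr => i _.
  rewrite -[rcons _ _]/(fps_inv_seq f i.+1) -(@fps_inv_seqE f n) //.
  over.
by rewrite addrC subrK.
Qed.

Fact fps_unitP f g : g * f = 1 -> fps_unit f.
Proof.
move/(congr1 (fun f => f 0%N)).
rewrite -[LHS]/(\sum_(i < 1) g i * f (0 - i)%N) big_ord1 subn0 => gf1.
by apply/unitrPr; exists (g 0%N); rewrite mulrC gf1.
Qed.

Fact fps_inv_out : {in [predC fps_unit], fps_inv =1 id}.
Proof. by move=> f; rewrite inE /= /fps_inv => nUf; rewrite ifN. Qed.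

HB.instance Definition _ := GRing.ComNzRing_hasMulInverse.Build (fps R)
  fps_mulV fps_unitP fps_inv_out.
End FpsUnitRing.

(* Series in x and y, as series in x over series in y: [A i j] is the
   coefficient of x^i y^j.  A series in x alone is one whose coefficients
   [A i j] with [0 < j] vanish. *)
Definition fps2 (R : Type) := fps (fps R).

Section Fps2.
Variable C : fieldType.
Implicit Types A P f g : fps2 C.

HB.instance Definition _ := GRing.ComUnitRing.on (fps2 C).

Definition fpsX : fps2 C := fun i j => ((i == 1) && (j == 0))%N%:R.
Definition fpsY : fps2 C := fun i j => ((i == 0) && (j == 1))%N%:R.

(* P(f,g), for f and g without constant term: then f^i g^j has order at least
   i + j, so that only the terms with i, j <= a + b contribute to the
   coefficient of x^a y^b. *)
Definition fps_comp P f g : fps2 C := fun a b =>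
  \sum_(i < (a + b).+1) \sum_(j < (a + b).+1) P i j * (f ^+ i * g ^+ j) a b.

Definition fps_iota f : fps2 C := - (f / (1 + f)).

Lemma fps2_unitE A : (A \is a GRing.unit) = (A 0 0 != 0).
Proof. exact: unitfE. Qed.

Lemma fps_comp00 P f g : fps_comp P f g 0 0 = P 0 0.
Proof.
rewrite /fps_comp !big_ord1 !expr0 mulr1.
by rewrite -[X in _ * X]/(1 : C) mulr1.
Qed.

(* By [fps2_unitE] and [fps_comp00] all the denominators below are units. *)
Definition hidden_kernel P : Prop :=
  P 0 0 != 0 /\
  (fps_comp P fpsX (fps_iota fpsX) * fps_comp P (fps_iota fpsX) fpsX)
    / (fps_comp P fpsX fpsX * fps_comp P (fps_iota fpsX) (fps_iota fpsX))
  = (1 + fpsX) / (1 + fpsX + fpsX ^+ 2).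

Definition hidden_ratio P : fps2 C :=
  (fps_comp P fpsX fpsY * fps_comp P fpsY fpsX)
    / (fps_comp P (fps_iota fpsX) fpsY * fps_comp P (fps_iota fpsY) fpsX).

Definition hidden A : Prop :=
  exists2 P : fps2 C, hidden_kernel P &
    A = (1 + fpsX + fpsY) * hidden_ratio P \/
    A = (1 - fpsX * fpsY) * hidden_ratio P.

End Fps2.

(** * Operators on polynomials *)

Section Operators.
Variables (C : fieldType) (n : nat).
Implicit Types (f : {mpoly C[n]}) (i j : 'I_n).

Definition shift (c : C) i f : {mpoly C[n]} :=
  f \mPo [tuple 'X_j + (c *+ (j == i))%:MP | j < n].

Definition Eop i := shift 1 i.
Definition Einv i := shift (- 1) i.
Definition Delta i f := Eop i f - f.

Definition Strict i j f := Einv i f + Eop j f - Einv i (Eop j f).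

(* Delta lowers the total degree (see [iter_Delta_eq0]), so that the terms of
   order at least [msize f] of the series in the difference operators vanish
   on [f]; [StrictK] and [StrictInvK] show that this is the inverse. *)
Definition StrictInv i j f : {mpoly C[n]} :=
  Eop i (\sum_(m < msize f) (-1) ^+ m *: iter m (Eop j) (iter m (Delta i) f)).

Definition fps_op (A : fps2 C) i j f : {mpoly C[n]} :=
  \sum_(a < msize f) \sum_(b < msize f)
    A a b *: iter a (Delta i) (iter b (Delta j) f).

(* The factors commute, so that the order of composition is irrelevant. *)
Definition hidden_operator (A : fps2 C) : {mpoly C[n]} -> {mpoly C[n]} :=
  \big[comp/idfun]_(p : 'I_n * 'I_n | (p.1 < p.2)%N)
    (StrictInv p.1 p.2 \o fps_op A p.1 p.2).

Definition eval_int f (k : n.-tuple int) : C := f.@[fun i => (tnth k i)%:~R].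

Fact shift_is_linear c i : linear (shift c i).
Proof. by move=> a f g; rewrite /shift linearP. Qed.

HB.instance Definition _ c i :=
  GRing.isLinear.Build C {mpoly C[n]} {mpoly C[n]} _ (shift c i)
    (shift_is_linear c i).

Fact Delta_is_linear i : linear (Delta i).
Proof.
by move=> a f g; rewrite /Delta /Eop (shift_is_linear 1 i) scalerBr opprD addrACA.
Qed.

HB.instance Definition _ i :=
  GRing.isLinear.Build C {mpoly C[n]} {mpoly C[n]} _ (Delta i)
    (Delta_is_linear i).

Lemma shiftM c i : {morph shift c i : f g / f * g}.
Proof. by move=> f g; rewrite /shift rmorphM. Qed.

Lemma shift1 c i : shift c i 1 = 1.
Proof. by rewrite /shift rmorph1. Qed.

Lemma shiftX c i j : shift c i 'X_j = 'X_j + (c *+ (j == i))%:MP.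
Proof. by rewrite /shift comp_mpolyXU -tnth_nth tnth_mktuple. Qed.

Lemma shiftC c i a : shift c i a%:MP = a%:MP.
Proof. by rewrite /shift comp_mpolyC. Qed.

Lemma mnm_ind (Q : 'X_{1..n} -> Prop) :
  Q 0%MM -> (forall j m, Q m -> Q (U_(j) + m)%MM) -> forall m, Q m.
Proof.
move=> Q0 QU m; move: {2}(mdeg m) (erefl (mdeg m)) => d.
elim: d m => [|d IHd] m; first by move/eqP; rewrite mdeg_eq0 => /eqP->.
move=> dm; have /existsP[j mj]: [exists j, (0 < m j)%N].
  rewrite -[[exists _, _]]negbK negb_exists; apply/negP => /forallP m0.
  suff: mdeg m = 0%N by rewrite dm.
  rewrite mdegE big1 // => j _; apply/eqP; rewrite -leqn0 leqNgt; exact: m0.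
have Um : (U_(j) <= m)%MM.
  by apply/mnm_lepP => l; rewrite mnm1E; case: eqP => // <-.
rewrite -(submK Um) addmC; apply: (QU); apply: IHd; apply/eqP.
by rewrite -eqSS -dm -{2}(submK Um) mdegD mdeg1 addn1.
Qed.

Lemma shift_comm c d i j f : shift c i (shift d j f) = shift d j (shift c i f).
Proof.
elim/mpolyind: f => [|a m p _ _ IHp]; first by rewrite !linear0.
rewrite !shift_is_linear IHp; congr (_ *: _ + _).
elim/mnm_ind: m => [|l m IHm]; first by rewrite mpolyX0 !shift1.
rewrite mpolyXD !shiftM IHm; congr (_ * _).
by rewrite !shiftX !raddfD /= !shiftX !shiftC -!addrA [X in _ + X]addrC.
Qed.

Lemma shiftD c d i f : shift c i (shift d i f) = shift (c + d) i f.
Proof.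
elim/mpolyind: f => [|a m p _ _ IHp]; first by rewrite !linear0.
rewrite !shift_is_linear IHp; congr (_ *: _ + _).
elim/mnm_ind: m => [|l m IHm]; first by rewrite mpolyX0 !shift1.
rewrite mpolyXD !shiftM IHm; congr (_ * _).
by rewrite !shiftX !raddfD /= !shiftX !shiftC mulrnDl mpolyCD addrA.
Qed.

Lemma shift0 i f : shift 0 i f = f.
Proof.
elim/mpolyind: f => [|a m p _ _ IHp]; first by rewrite !linear0.
rewrite !shift_is_linear IHp; congr (_ *: _ + _).
elim/mnm_ind: m => [|l m IHm]; first by rewrite mpolyX0 !shift1.
by rewrite mpolyXD !shiftM IHm shiftX mul0rn mpolyC0 addr0.
Qed.

Lemma EopK i f : Einv i (Eop i f) = f.
Proof. by rewrite /Einv /Eop shiftD addNr shift0. Qed.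

Lemma EinvK i f : Eop i (Einv i f) = f.
Proof. by rewrite /Einv /Eop shiftD subrr shift0. Qed.

Lemma Delta_shift c i j f : Delta i (shift c j f) = shift c j (Delta i f).
Proof. by rewrite /Delta /Eop raddfB shift_comm. Qed.

Lemma msize_Delta i f : (msize (Delta i f) <= (msize f).-1)%N.
Proof.
have DX m : (msize (Delta i 'X_[m]) <= mdeg m)%N.
  elim/mnm_ind: m => [|l m IHm].
    by rewrite mpolyX0 /Delta /Eop shift1 subrr msize0.
  rewrite mdegD mdeg1 add1n mpolyXD /Delta /Eop shiftM shiftX.
  have -> : ('X_l + (1 *+ (l == i))%:MP) * shift 1 i 'X_[m] - 'X_l * 'X_[m]
          = 'X_l * Delta i 'X_[m] + (1 *+ (l == i))%:MP * shift 1 i 'X_[m].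
    by rewrite /Delta /Eop mulrDl mulrBr addrAC.
  apply: leq_trans (mmeasureD_le _ _ _) _; rewrite geq_max; apply/andP; split.
    have [->|Dn0] := eqVneq (Delta i 'X_[m]) 0; first by rewrite mulr0 msize0.
    have X0: (@mpolyX n C U_(l)) != 0 by rewrite -(mmeasure_poly_eq0 mdeg) (msizeX C).
    by rewrite (msizeM X0 Dn0) (msizeX C) mdeg1.
  rewrite mul_mpolyC; apply: leq_trans (msizeZ_le _ _) _.
  rewrite -[shift 1 i _](subrK 'X_[m]).
  apply: leq_trans (mmeasureD_le _ _ _) _.
  by rewrite geq_max msizeX leqnn andbT; apply: leq_trans IHm _.
rewrite {1}[f]mpolyE raddf_sum /= big_seq.
apply: leq_trans (mmeasure_sum _ _ _ _) _.
apply/bigmax_leqP_seq => m mf _; rewrite linearZ /=.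
apply: leq_trans (msizeZ_le _ _) _; apply: leq_trans (DX m) _.
by have := msize_mdeg_lt mf; case: (msize f).
Qed.

Lemma iter_Delta_eq0 i f m : (msize f <= m)%N -> iter m (Delta i) f = 0.
Proof.
elim: m f => [|m IHm] f; first by rewrite leqn0 mmeasure_poly_eq0 => /eqP.
move=> fm; rewrite iterSr IHm //; apply: leq_trans (msize_Delta i f) _.
by case: (msize f) fm.
Qed.


Definition EDelta i j f := Eop j (Delta i f).

Lemma iter_EDelta i j f m :
  iter m (Eop j) (iter m (Delta i) f) = iter m (EDelta i j) f.
Proof.
elim: m f => //= m IHm f; rewrite -IHm /EDelta; congr Eop.
move: (iter m (Delta i) f) => g.
by elim: m {IHm} => //= l ->; rewrite /Eop Delta_shift.
Qed.

Lemma iter_EDelta_eq0 i j f m : (msize f <= m)%N -> iter m (EDelta i j) f = 0.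
Proof.
move=> fm; rewrite -iter_EDelta iter_Delta_eq0 //.
by elim: m {fm} => //= m ->; rewrite /Eop linear0.
Qed.

Lemma StrictE i j f : Strict i j f = Einv i (f + EDelta i j f).
Proof.
rewrite /Strict /EDelta /Delta /Einv /Eop raddfB raddfD /= raddfB /=.
by rewrite (shift_comm 1 1 j i) shiftD addNr shift0 addrA.
Qed.

(* Any large enough number of terms gives the same operator. *)
Lemma StrictInvE i j f N : (msize f <= N)%N ->
  StrictInv i j f = Eop i (\sum_(m < N) (-1) ^+ m *: iter m (EDelta i j) f).
Proof.
move=> fN; rewrite /StrictInv; congr Eop.
under eq_bigr => m _ do rewrite iter_EDelta.
rewrite (big_ord_widen N (fun m => (-1) ^+ m *: iter m (EDelta i j) f) fN).
rewrite [RHS](bigID (fun m : 'I_N => (m < msize f)%N)) /= [X in _ + X]big1 ?addr0 //.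
by move=> m; rewrite -leqNgt => fm; rewrite iter_EDelta_eq0 ?scaler0.
Qed.

Fact EDelta_is_linear i j : linear (EDelta i j).
Proof. by move=> a f g; rewrite /EDelta /Eop Delta_is_linear shift_is_linear. Qed.

HB.instance Definition _ i j :=
  GRing.isLinear.Build C {mpoly C[n]} {mpoly C[n]} _ (EDelta i j)
    (EDelta_is_linear i j).

Lemma EDelta_geom i j f N : (msize f <= N)%N ->
  \sum_(m < N) (-1) ^+ m *: iter m (EDelta i j) (f + EDelta i j f) = f.
Proof.
move=> fN.
pose F m := (-1) ^+ m *: iter m (EDelta i j) f.
transitivity (\sum_(m < N) (F m - F m.+1)).
  apply: eq_bigr => m _; rewrite /F exprS mulN1r scaleNr opprK -scalerDr.
  congr (_ *: _); rewrite iterSr.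
  by elim: (nat_of_ord m) => //= k ->; rewrite raddfD.
rewrite -(big_mkord xpredT (fun m => F m - F m.+1)) /=.
under eq_bigr => m _ do rewrite -opprB.
rewrite sumrN telescope_sumr // opprB /F (@iter_EDelta_eq0 i j f N fN).
by rewrite scaler0 subr0 expr0 scale1r.
Qed.

Lemma StrictK i j : cancel (Strict i j) (StrictInv i j).
Proof.
move=> f; pose N := maxn (msize (Strict i j f)) (msize f).
rewrite (@StrictInvE i j _ N) ?leq_maxl // StrictE.
rewrite -[RHS](@EDelta_geom i j f N) ?leq_maxr // /Eop raddf_sum /=.
apply: eq_bigr => m _; rewrite linearZ /=; congr (_ *: _).
have stE c g : EDelta i j (shift c i g) = shift c i (EDelta i j g).
  by rewrite /EDelta Delta_shift /Eop shift_comm.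
have -> : iter m (EDelta i j) (Einv i (f + EDelta i j f))
        = Einv i (iter m (EDelta i j) (f + EDelta i j f)).
  by elim: (nat_of_ord m) => //= k ->; rewrite stE.
by rewrite -/(Eop i _) EinvK.
Qed.

Lemma StrictInvK i j : cancel (StrictInv i j) (Strict i j).
Proof.
move=> f; rewrite (@StrictInvE i j f _ (leqnn _)) StrictE.
set g := \sum_(m < _) _.
have stE c h : EDelta i j (shift c i h) = shift c i (EDelta i j h).
  by rewrite /EDelta Delta_shift /Eop shift_comm.
rewrite /Eop stE -raddfD /= -/(Eop i _) EopK -[RHS](@EDelta_geom i j f _ (leqnn _)).
rewrite raddf_sum -big_split /=; apply: eq_bigr => m _.
rewrite linearZ /= -scalerDr; congr (_ *: _); rewrite -iterS iterSr.
by elim: (nat_of_ord m) => //= k <-; rewrite raddfD.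
Qed.

End Operators.

(** * Trapezoids *)

(* The list of the rows, from row 0 to row h; columns are numbered from 0. *)
Definition array := seq (seq int).
Definition trow (a : array) s : seq int := nth [::] a s.
Definition entry (a : array) s t : int := nth 0 (trow a s) t.

Definition GT_trapezoid (h n : nat) (a : array) : Prop :=
  [/\ size a = h.+1,
      forall s, (s <= h)%N -> size (trow a s) = (n - h + s)%N &
      forall s t, (1 <= s <= h)%N -> (t.+1 < n - h + s)%N ->
        entry a s t <= entry a s.-1 t <= entry a s t.+1].

Definition monotone_trapezoid (h n : nat) (a : array) : Prop :=
  GT_trapezoid h n a /\
  forall s, (s <= h)%N -> sorted (fun x y => x < y) (trow a s).

Definition bottom_row (h : nat) (a : array) : seq int := trow a h.

Local Open Scope classical_set_scope.

(* There are finitely many trapezoids with a given bottom row, so that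
   [fset_set] does not default to the empty set. *)
Definition num_GT (h n : nat) (k : n.-tuple int) : nat :=
  #|` fset_set [set a | GT_trapezoid h n a /\ bottom_row h a = k]|.

Definition MT (h n : nat) (k : n.-tuple int) : nat :=
  #|` fset_set [set a | monotone_trapezoid h n a /\ bottom_row h a = k]|.

Definition counts_GT (C : fieldType) (h n : nat) (p : {mpoly C[n]}) : Prop :=
  forall k : n.-tuple int, sorted (fun x y => x <= y) k ->
    eval_int p k = (num_GT h k)%:R.

(* The polynomial with this property: it exists for [h <= n], and over a field
   of characteristic 0 it is unique. *)
Definition GT_poly (C : fieldType) (h n : nat) : {mpoly C[n]} :=
  xget 0 [set p | counts_GT h p].

(* Main.v *)
(* Let lam_i = k_i + i, and let x_i be the difference operator in lam_i.  In
   these coordinates GT_h is a Pfaffian G_h(lam), with entries f_h(lam_j - lam_i)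
   for an even polynomial f_h, bordered by binomial columns.  Differencing all
   the variables but the last one gives G_{h-1} of the remaining variables, and
   G_h(.. a c ..) + G_h(.. c a ..) = 2 f_h(c - a) G_h(.. ..).

   Put B = A / s, where s is the series of Strict, and let Phi be the product of
   the B(x_i, x_j), i < j.  Summing over the rows that interlace with a strictly
   increasing row telescopes, and the recursion on h for the number of monotone
   trapezoids holds for Phi G_h as soon as
   - differencing all the variables but the last one takes Phi G_{h+1} to
     Phi G_h of the remaining variables;
   - for neighbouring variables p, p', after differencing the variables to their
     left, s(x_p, x_p') Phi G_h vanishes for lam_p = lam_p', h > 0.

   The first point follows from B(y, 0) B(iota y, 0) = 1: a product over all the
   variables of G_h of operators e(x_l) with e(0) = 1 and e(y) e(iota y) = 1 acts
   trivially on G_h.  For the second, s B = A is symmetric, so that only the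
   symmetric part of G_h counts on the diagonal, and it is f_h(lam_p' - lam_p)
   times G_h without p and p'.  On functions of lam_p' - lam_p, the operator x_p'
   acts as iota(x_p), and A(x, iota x) = 1.  The other factors then form a family
   e(x_l) as above, which acts trivially, times a correction, for the variables
   to the left of p, depending only on the series s; an induction on h shows
   that what remains still vanishes on the diagonal. *)
From HB Require Import structures.
Require Import Defs.
From mathcomp Require Import all_boot all_order all_algebra all_fingroup finmap.
From mathcomp Require Import boolp classical_sets cardinality.
From mathcomp Require Import ring_quotient generic_quotient.
From mathcomp Require Import reals complex ssrcomplements mpoly.
From mathcomp Require Import ring zify.

Set Implicit Arguments.
Unset Strict Implicit.
Unset Printing Implicit Defensive.

Import Order.TTheory GRing.Theory Num.Theory.

Local Open Scope ring_scope.

(** * Pfaffians *)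

(** All operators live in one commutative ring: polynomials in the shifts modulo those that kill
    every function of bounded degree. There the $x_i$ are nilpotent, so any power series can be
    evaluated at them, and $1+\iota(x_i)$ is the inverse shift. Equality of operators on functions
    of $\lambda_{p'}-\lambda_p$ follows from congruence modulo $(1+x_p)(1+x_{p'})-1$, which kills
    such functions. The obstacle is that $B$ is not symmetric. Put $u=x_p$. Once $x_{p'}$ has become
    $\iota(u)$, a variable $y$ to the right contributes $B(u,y)B(\iota u,y)$, one to the left
    $B(y,u)B(y,\iota u)$. Their quotient [odd_defect] is a function of $y$ and $t=u+\iota(u)$ alone,
    and $t$ sends the even kernel $f_{m+1}$ to $-f_m$. Removing a defect therefore lowers the index
    of the kernel but not that of GT, and the induction must treat $f_m$ and $GT_h$ with independent
    indices. [GT_poly] is given only by its values. The same telescoping with weak inequalities and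
    trivial operators shows that the Pfaffian has these values, so both counts share one proof with
    a boolean [strict]. *)

Section Pfaffian.
Variables (K : comNzRingType) (T : Type).
Implicit Types (a : T -> K) (Psi : seq T -> K) (s : seq T) (w : T -> T -> K).

(** This is the interior product with the linear form [a]; iterating it expands a Pfaffian along its
    first row. *)
Fixpoint contr a Psi s : K :=
  if s is z :: s' then a z * Psi s' - contr a (fun t => Psi (z :: t)) s' else 0.

Lemma contr_ext a a' Psi Psi' s : a =1 a' ->
  (forall t, (size t).+1 = size s -> Psi t = Psi' t) ->
  contr a Psi s = contr a' Psi' s.
Proof.
move=> eqa; elim: s Psi Psi' => //= z s IHs Psi Psi' eqP.
rewrite eqa eqP // (IHs _ (fun t => Psi' (z :: t))) // => t szt.
by apply: eqP; rewrite /= szt.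
Qed.

Lemma contr_linear a c d Psi Psi' s :
  contr a (fun t => c * Psi t + d * Psi' t) s =
  c * contr a Psi s + d * contr a Psi' s.
Proof.
elim: s Psi Psi' => /= [|z s IHs] Psi Psi'; first by rewrite !mulr0 addr0.
by rewrite IHs; ring.
Qed.

Lemma contr_linearl a b c d Psi s :
  contr (fun t => c * a t + d * b t) Psi s =
  c * contr a Psi s + d * contr b Psi s.
Proof.
elim: s Psi => /= [|z s IHs] Psi; first by rewrite !mulr0 addr0.
by rewrite IHs; ring.
Qed.

(** Deleting two elements in either order leaves the same list, with opposite signs. *)
Lemma contr_anti a b Psi s :
  contr a (contr b Psi) s + contr b (contr a Psi) s = 0.
Proof.
elim: s Psi => /= [|z s IHs] Psi; first by rewrite addr0.
have E c d : contr c (fun t => contr d Psi (z :: t)) s =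
   d z * contr c Psi s - contr c (contr d (fun t => Psi (z :: t))) s.
  have := contr_linear c (d z) (-1) Psi (contr d (fun t => Psi (z :: t))) s.
  rewrite mulN1r => <-; apply: contr_ext => // t _ /=.
  by rewrite mulN1r.
rewrite !E; have := IHs (fun t => Psi (z :: t)); move/eqP; rewrite addr_eq0.
by move/eqP->; ring.
Qed.

(** The terms that delete [x] or [y] cancel between the two orders, because the position of the
    deleted element moves by one. Every other term keeps the adjacent pair, and the hypothesis on
    [Psi] applies to it. *)
Lemma contr_swap a kappa Psi Psi' (x y : T) m :
  (forall s1 s2, (size s1 + size s2)%N = m ->
     Psi (s1 ++ x :: y :: s2) + Psi (s1 ++ y :: x :: s2) = kappa * Psi' (s1 ++ s2)) ->
  forall s1 s2, (size s1 + size s2)%N = m.+1 ->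
    contr a Psi (s1 ++ x :: y :: s2) + contr a Psi (s1 ++ y :: x :: s2) =
    kappa * contr a Psi' (s1 ++ s2).
Proof.
move=> swP s1; elim: s1 m Psi Psi' swP => [|z s1 IHs] m Psi Psi' swP s2 szs /=.
  transitivity (contr a (fun t => Psi (x :: y :: t) + Psi (y :: x :: t)) s2).
    have := contr_linear a 1 1 (fun t => Psi (x :: y :: t)) (fun t => Psi (y :: x :: t)) s2.
    rewrite !mul1r => E; transitivity (contr a (fun t => Psi [:: x, y & t]) s2 +
      contr a (fun t => Psi [:: y, x & t]) s2); first by ring.
    by rewrite -E; apply: contr_ext => // t _; rewrite !mul1r.
  have := contr_linear a kappa 0 Psi' Psi' s2; rewrite mul0r addr0 => <-.
  apply: contr_ext => // t szt; rewrite mul0r addr0.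
  by apply: (swP [::] t); apply/eqP; rewrite -eqSS szt -szs.
have swz : contr a (fun t => Psi (z :: t)) (s1 ++ [:: x, y & s2]) +
           contr a (fun t => Psi (z :: t)) (s1 ++ [:: y, x & s2]) =
           kappa * contr a (fun t => Psi' (z :: t)) (s1 ++ s2).
  case: m swP szs => [|m] swP szs.
    by case: s1 s2 {IHs} szs => [|? ?] [|? ?] //= _; ring.
  apply: (IHs m); last by case: szs.
  by move=> t1 t2 szt; apply: (swP (z :: t1) t2); rewrite -szt.
have swz0 := swP s1 s2; rewrite mulrBr -swz.
have /swz0 : (size s1 + size s2)%N = m by case: szs.
set P1 := Psi _; set P2 := Psi _ => E.
by transitivity (a z * (P1 + P2) - (contr a (fun t => Psi (z :: t)) (s1 ++ [:: x, y & s2]) +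
           contr a (fun t => Psi (z :: t)) (s1 ++ [:: y, x & s2]))); [ring|rewrite E; ring].
Qed.

(* The recursion removes two elements per step, so [size s] is enough fuel. *)
Fixpoint pf_rec w n s : K :=
  match n, s with
  | _, [::] => 1
  | n'.+1, x :: s' => contr (w x) (pf_rec w n') s'
  | 0%N, _ => 0
  end.

(* The Pfaffian of the upper triangular array [w s_i s_j], i < j; no
   antisymmetry of [w] is assumed. *)
Definition pf w s := pf_rec w (size s) s.

Lemma pf_recE w n s : (size s <= n)%N -> pf_rec w n s = pf w s.
Proof.
rewrite /pf; elim/ltn_ind: n s => -[|n] IHn [|x s] //= sn.
apply: contr_ext => // t szt.
have tn : (size t <= n)%N by rewrite -ltnS; apply: leq_trans sn; rewrite -szt.
by rewrite (IHn n) // (IHn (size s)) // -szt.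
Qed.

Lemma pf_cons w x s : pf w (x :: s) = contr (w x) (pf w) s.
Proof.
by rewrite {1}/pf /=; apply: contr_ext => // t szt; rewrite pf_recE // -szt.
Qed.

(** With the pair in front, expanding twice leaves the terms that match [x] with [y], and double
    contractions that cancel by [contr_anti]. The right-hand side is zero for antisymmetric [w]; for
    the even kernel below it is what yields the symmetric part of the Pfaffian. *)
Lemma pf_swap w s1 s2 x y :
  pf w (s1 ++ x :: y :: s2) + pf w (s1 ++ y :: x :: s2) =
  (w x y + w y x) * pf w (s1 ++ s2).
Proof.
have [m] := ubnP (size s1 + size s2)%N.
elim: m s1 s2 => // m IHm [|z s1] s2 /= szm.
  rewrite !pf_cons /=.
  have E u v : contr (w u) (fun t => pf w (v :: t)) s2 =
      contr (w u) (contr (w v) (pf w)) s2.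
    by apply: contr_ext => // t _; rewrite pf_cons.
  rewrite !E; have /eqP := contr_anti (w x) (w y) (pf w) s2.
  by rewrite addr_eq0 => /eqP ->; ring.
rewrite !pf_cons.
case E : (size s1 + size s2)%N => [|k].
  case: s1 s2 E {szm} => [|//] [|//] _ /=; rewrite -/(pf w _) !pf_cons /=; ring.
apply: (@contr_swap _ _ _ _ _ _ k) => // t1 t2 szt; apply: IHm.
by rewrite szt; move: szm; rewrite addSn E !ltnS; exact: leq_trans.
Qed.

(** Both arguments are constrained, since no antisymmetry ties the column of [x] to its row. *)
Definition pf_comb w c d x y z :=
  (forall t, w x t = c * w y t + d * w z t) /\
  (forall t, w t x = c * w t y + d * w t z).

Lemma pf_multilinear w c d x y z s1 s2 : pf_comb w c d x y z ->
  pf w (s1 ++ x :: s2) = c * pf w (s1 ++ y :: s2) + d * pf w (s1 ++ z :: s2).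
Proof.
case=> wl wr; have contr_comb a s3 : forall s0 Psi,
    a x = c * a y + d * a z ->
    (forall t1 t2, (size t1 + size t2).+1 = (size s0 + size s3)%N ->
      Psi (t1 ++ x :: t2) = c * Psi (t1 ++ y :: t2) + d * Psi (t1 ++ z :: t2)) ->
    contr a Psi (s0 ++ x :: s3) =
    c * contr a Psi (s0 ++ y :: s3) + d * contr a Psi (s0 ++ z :: s3).
  elim=> [|u s0 IHs] Psi ax PsiE /=.
    rewrite ax; transitivity ((c * a y + d * a z) * Psi s3 -
        contr a (fun t => c * Psi (y :: t) + d * Psi (z :: t)) s3).
      congr (_ - _); apply: contr_ext => // t szt.
      by apply: (PsiE [::] t).
    by rewrite contr_linear; ring.
  rewrite IHs //; last first.
    by move=> t1 t2 szt; apply: (PsiE (u :: t1) t2) => /=; rewrite addSn szt.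
  by rewrite PsiE //; ring.
have [m] := ubnP (size s1 + size s2)%N.
elim: m s1 s2 => // m IHm [|u s1] s2 /= szm.
  by rewrite !pf_cons -contr_linearl; apply: contr_ext.
rewrite !pf_cons; apply: contr_comb => // t1 t2 szt; apply: IHm.
by move: szm; rewrite addSn ltnS; apply: leq_trans; rewrite -szt ltnS.
Qed.

Lemma contr_eq0 a Psi s : (forall t, a t = 0) -> contr a Psi s = 0.
Proof. by move=> a0; elim: s Psi => //= z s IHs Psi; rewrite a0 IHs; ring. Qed.

Lemma contr0 a s : contr a (fun=> 0) s = 0.
Proof. by elim: s => //= z s ->; rewrite mulr0 subr0. Qed.

Lemma pf_ext w w' s : w =2 w' -> pf w s = pf w' s.
Proof.
move=> eqw; have [m] := ubnP (size s).
elim: m s => // m IHm [|x s] //; rewrite ltnS => /= szm.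
rewrite !pf_cons; apply: contr_ext => [t|t szt]; first exact: eqw.
by apply: IHm; rewrite szt ltnW.
Qed.

End Pfaffian.

Lemma pf_map (K : comNzRingType) (T U : Type) (g : T -> U) (w : U -> U -> K) s :
  pf w (map g s) = pf (fun x y => w (g x) (g y)) s.
Proof.
have contr_map a s0 : forall Psi,
    contr a Psi (map g s0) = contr (a \o g) (Psi \o map g) s0.
  by elim: s0 => //= z s0 IHs Psi; rewrite IHs.
have [m] := ubnP (size s); elim: m s => // m IHm [|x s] szm //.
rewrite map_cons !pf_cons contr_map; apply: contr_ext => // t szt; apply: IHm.
by rewrite szt ltnW.
Qed.

Section PfaffianSparse.
Variables (K : comNzRingType) (T : Type).
Implicit Types (a : T -> K) (Psi : seq T -> K) (s : seq T) (w : T -> T -> K).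

Lemma contr_ext_rem a a' Psi Psi' s :
  (forall t1 z t2, s = t1 ++ z :: t2 ->
     a z * Psi (t1 ++ t2) = a' z * Psi' (t1 ++ t2)) ->
  contr a Psi s = contr a' Psi' s.
Proof.
elim: s Psi Psi' => //= z s IHs Psi Psi' eqP.
rewrite (eqP [::] z s) // (IHs _ (fun t => Psi' (z :: t))) // => t1 y t2 Es.
by apply: (eqP (z :: t1)); rewrite Es.
Qed.

Lemma contr_const c s : contr (fun=> 1) (fun=> c) s = (odd (size s))%:R * c :> K.
Proof.
elim: s => /= [|z s ->]; first by rewrite mul0r.
by case: (odd _) => /=; ring.
Qed.

(** All terms of the expansion have the same absolute value, and their alternating sum depends only
    on the parity of their number. *)
Lemma pf_ones w s : pairwise (fun x y => w x y == 1) s ->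
  pf w s = (~~ odd (size s))%:R.
Proof.
have [m] := ubnP (size s); elim: m s => // m IHm [|x s] szm //.
rewrite pairwise_cons => /andP[x1 s1].
rewrite pf_cons [LHS](_ : _ = contr (fun=> 1) (fun=> (odd (size s))%:R) s).
  by rewrite contr_const /=; case: (odd _) => /=; rewrite ?mul0r ?mulr1.
apply: contr_ext_rem => t1 z t2; rewrite -cat1s => Es.
move: x1 s1 szm; rewrite Es !all_cat !pairwise_cat allrel_catr /= !size_cat andbT.
move=> /and3P[_ /eqP wxz _] /and4P[/andP[_ a12] p1 _ p2] szm; rewrite wxz.
rewrite IHm; first by rewrite size_cat /= addnS.
  by move: szm; rewrite size_cat /= addnS !ltnS; apply: ltnW.
by rewrite pairwise_cat a12 p1.
Qed.

Variables (w : T -> T -> K) (y : T).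
Hypothesis wy : forall t, w y t = 0.
Let loose : pred T := fun t => w t y == 0.

Lemma pf_isolated s1 s2 : all loose s1 -> pf w (s1 ++ y :: s2) = 0.
Proof.
have contr_loose a s3 : a y = 0 -> forall s0 Psi, all loose s0 ->
    (forall t1 t2, all loose t1 -> (size t1 + size t2).+1 = (size s0 + size s3)%N ->
      Psi (t1 ++ y :: t2) = 0) -> contr a Psi (s0 ++ y :: s3) = 0.
  move=> ay; elim=> [|u s0 IHs] Psi /=.
    move=> _ Psi0; rewrite ay mul0r sub0r -[RHS]oppr0 -(contr0 a s3); congr (- _).
    by apply: contr_ext => // t szt; apply: (Psi0 [::] t).
  case/andP=> u0 s00 Psi0; rewrite Psi0 // mulr0 IHs ?subr0 //.
  by move=> t1 t2 t10 szt; apply: (Psi0 (u :: t1)); rewrite /= ?u0 // addSn szt.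
have [m] := ubnP (size s1 + size s2)%N.
elim: m s1 s2 => // m IHm [|z s1] s2 /= szm; first by rewrite pf_cons contr_eq0.
case/andP => /eqP z0 s10; rewrite pf_cons; apply: contr_loose => // t1 t2 t10 szt.
by apply: IHm => //; move: szm szt; rewrite addSn; lia.
Qed.

(** Only [x] can be matched with [y] without producing a zero factor, and since the two are adjacent
    the sign is positive. *)
Lemma pf_pair s1 x s2 : all loose s1 ->
  pf w (s1 ++ x :: y :: s2) = w x y * pf w (s1 ++ s2).
Proof.
have contrE a s3 : a y = 0 -> forall s0 Psi Psi', all loose s0 ->
    (forall t1 t2, all loose t1 -> Psi (t1 ++ y :: t2) = 0) ->
    (forall t1 t2, all loose t1 -> (size t1 + size t2).+1 = (size s0 + size s3)%N ->
      Psi (t1 ++ x :: y :: t2) = w x y * Psi' (t1 ++ t2)) ->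
    contr a Psi (s0 ++ x :: y :: s3) = w x y * contr a Psi' (s0 ++ s3).
  move=> ay; elim=> [|u s0 IHs] Psi Psi' /=.
    move=> _ Psi0 PsiE; rewrite ay (Psi0 [::]) // mulr0 mul0r !sub0r opprK.
    have := contr_linear a (w x y) 0 Psi' Psi' s3; rewrite !mul0r addr0 => <-.
    apply: contr_ext => // t szt; rewrite mul0r addr0.
    by apply: (PsiE [::] t).
  case/andP=> u0 s00 Psi0 PsiE; rewrite PsiE // (IHs _ (fun t => Psi' (u :: t))) //.
  - by ring.
  - by move=> t1 t2 t10; apply: (Psi0 (u :: t1)); rewrite /= ?u0.
  - by move=> t1 t2 t10 szt; apply: (PsiE (u :: t1)); rewrite /= ?u0 // addSn szt.
have [m] := ubnP (size s1 + size s2)%N.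
elim: m s1 s2 => // m IHm [|z s1] s2 /= szm.
  move=> _; rewrite pf_cons /= [X in _ - X](_ : _ = contr (w x) (fun=> 0) s2).
    by rewrite contr0 subr0.
  by apply: contr_ext => // t _; rewrite pf_cons contr_eq0.
case/andP => /eqP z0 s10; rewrite !pf_cons; apply: contrE => // t1 t2 t10.
  exact: pf_isolated.
by move=> szt; apply: IHm => //; move: szm szt; rewrite addSn; lia.
Qed.

End PfaffianSparse.

(** * The Gelfand-Tsetlin Pfaffian *)

Section Kernels.
Variable C : numFieldType.
Implicit Types (d a : C) (h r : nat).

(* The even polynomial solution of [evenker_diff2] that vanishes at 0 for
   [h > 0]. *)
Definition evenker h d : C := (\prod_(j < h) (j%:R ^+ 2 - d ^+ 2)) / (h.*2)`!%:R.

(** This is $(-1)^r\binom{a}{r}$; the sign suits differences taken as the value at [a] minus the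
    value at [a + 1]. *)
Definition rowker r a : C := (\prod_(i < r) (i%:R - a)) / r`!%:R.

Lemma fact_neq0 m : m`!%:R != 0 :> C.
Proof. by rewrite pnatr_eq0 -lt0n fact_gt0. Qed.

Lemma evenker0 d : evenker 0 d = 1.
Proof. by rewrite /evenker big_ord0 fact0 divr1. Qed.

Lemma evenkerN h d : evenker h (- d) = evenker h d.
Proof. by rewrite /evenker sqrrN. Qed.

Lemma evenkerS0 h : evenker h.+1 0 = 0.
Proof. by rewrite /evenker big_ord_recl expr0n /= subrr !mul0r. Qed.

Lemma evenker_diff2 h d :
  evenker h.+1 d - evenker h.+1 (d + 1) - (evenker h.+1 (d - 1) - evenker h.+1 d) =
  evenker h d.
Proof.
(* Up to sign, [Q m x] is the product of the consecutive numbers $x-m,\ldots,x+m$. Hence a shift of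
   [x] by one in [Q m.+1] gives [Q m x] times two linear factors. *)
pose Q m x : C := x * \prod_(j < m) (j.+1%:R ^+ 2 - x ^+ 2).
have QS m x : Q m.+1 x = Q m x * (m.+1%:R ^+ 2 - x ^+ 2).
  by rewrite /Q big_ord_recr mulrA.
have QD m x : Q m.+1 (x + 1) = - (x + m.+1%:R + 1) * (x + m.+1%:R) * Q m x.
  elim: m x => [|m IHm] x; first by rewrite QS /Q !big_ord0; ring.
  by rewrite QS IHm QS -(natr1 m.+1); ring.
have QB m x : Q m.+1 (x - 1) = - (x - m.+1%:R - 1) * (x - m.+1%:R) * Q m x.
  elim: m x => [|m IHm] x; first by rewrite QS /Q !big_ord0; ring.
  by rewrite QS IHm QS -(natr1 m.+1); ring.
have EQ m x : evenker m.+1 x = - x * Q m x / (m.+1.*2)`!%:R.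
  rewrite /evenker big_ord_recl /Q; congr (_ / _).
  under eq_bigr => i _ do rewrite lift0.
  by rewrite /= mulr0n; ring.
case: h => [|h].
  rewrite evenker0 !EQ /Q !big_ord0 (_ : (1.*2)`!%:R = 2 :> C) //.
  by field.
rewrite !EQ QD QB QS.
have -> : (h.+2.*2)`!%:R = (h.*2 + 4)%:R * (h.*2 + 3)%:R * (h.+1.*2)`!%:R :> C.
  rewrite -!natrM doubleS (factS (h.+1.*2).+1) (factS (h.+1.*2)) mulnA.
  by congr ((_ * _ * _)%:R); lia.
move: (h.+1.*2)`!%:R (fact_neq0 (h.+1.*2)) => F n0.
have h3 : h%:R * 2 + 3 != 0 :> C.
  by rewrite -natrM -natrD pnatr_eq0 addnS.
have h4 : h%:R * 2 + 4 != 0 :> C.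
  by rewrite -natrM -natrD pnatr_eq0 addnS.
rewrite -(natr1 h) -muln2 !natrD natrM.
by field; rewrite n0 h3 h4.
Qed.

Lemma rowker0 a : rowker 0 a = 1.
Proof. by rewrite /rowker big_ord0 fact0 divr1. Qed.

Lemma rowker_diff r a : rowker r.+1 a - rowker r.+1 (a + 1) = rowker r a.
Proof.
rewrite /rowker [in X in X / _ - _]big_ord_recr [in X in _ - X / _]big_ord_recl.
under [in X in _ - X / _]eq_bigr => i _.
  rewrite lift0 -natr1 (_ : i%:R + 1 - (a + 1) = i%:R - a); last by ring.
  over.
rewrite /= mulr0n factS natrM -natr1.
move: r`!%:R (fact_neq0 r) => F n0.
have r1 : r%:R + 1 != 0 :> C by rewrite natr1 pnatr_eq0.
by field; rewrite n0 r1.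
Qed.

End Kernels.

(** Labels of the rows and columns of the Pfaffian. A differenced variable is again a single label,
    so multilinearity can replace the labels one by one. *)
Variant point := Pt of int | Dp of int | Row of nat.

Section GT.
Variable C : numFieldType.
Implicit Types (l : seq int) (h r : nat).

Let f h (d : int) : C := evenker h d%:~R.
Let b r (a : int) : C := rowker r a%:~R.

(* [Dp a] stands for the formal difference [Pt a - Pt (a + 1)]. *)
Definition pairing h (x y : point) : C :=
  match x, y with
  | Pt a, Pt c => f h (c - a)
  | Pt a, Dp c => f h (c - a) - f h (c + 1 - a)
  | Dp a, Pt c => f h (c - a) - f h (c - (a + 1))
  | Dp a, Dp c => f h (c - a) - f h (c + 1 - a) - (f h (c - (a + 1)) - f h (c + 1 - (a + 1)))
  | Pt a, Row r => b r a
  | Dp a, Row r => b r a - b r (a + 1)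
  | Row _, _ => 0
  end.

Lemma pairing_Dp h a : pf_comb (pairing h) 1 (-1) (Dp a) (Pt a) (Pt (a + 1)).
Proof. by split=> -[c|c|r] /=; ring. Qed.

(* Of [h] and [h + 1], the number that makes the size of the Pfaffian even. *)
Definition num_rows h n := (h + odd (h + n))%N.

Definition rows h n := [seq Row r | r <- iota 0 (num_rows h n)].

(* In the coordinates [k i + i], this Pfaffian is GT_h(k): see [GT_polyE]. *)
Definition GTfun h l : C := pf (pairing h) (map Pt l ++ rows h (size l)).

Lemma GTfun0 l : GTfun 0 l = 1.
Proof.
rewrite /GTfun pf_ones; last first.
  rewrite /rows /num_rows !add0n.
  move: (odd _) => e; elim: l => [|a l IHl]; first by case: e.
  rewrite [map _ _ ++ _]/= pairwise_cons {}IHl andbT all_cat all_map.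
  apply/andP; split; first by apply/allP => c _ /=; rewrite /f evenker0.
  by case: e => //=; rewrite /b rowker0 eqxx.
by rewrite size_cat !size_map size_iota /num_rows !add0n oddD oddb addbb.
Qed.

Lemma GTfun_nil h : GTfun h.+1 [::] = 0.
Proof. by rewrite /GTfun /rows /num_rows /= pf_cons contr_eq0. Qed.

(** Differencing both arguments lowers the even kernel, and differencing one lowers each binomial
    column. The columns on the left start at 1 because column 0 is constant and has zero
    difference. *)
Lemma pf_pairing_diff h l n :
  pf (pairing h.+1) (map Dp l ++ [seq Row r | r <- iota 1 n]) =
  pf (pairing h) (map Pt l ++ [seq Row r | r <- iota 0 n]).
Proof.
(* Both lists are images of this one, so that [pf_ext] can compare the two kernels label by
   label. *)
pose s := [seq inl a | a <- l] ++ [seq inr r | r <- iota 0 n] : seq (int + nat).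
pose g1 (x : int + nat) := match x with inl a => Dp a | inr r => Row r.+1 end.
pose g2 (x : int + nat) := match x with inl a => Pt a | inr r => Row r end.
have -> : map Dp l ++ [seq Row r | r <- iota 1 n] = map g1 s.
  rewrite map_cat -!map_comp; congr (_ ++ _).
  by rewrite (iotaDl 1 0) -map_comp; apply: eq_map.
have -> : map Pt l ++ [seq Row r | r <- iota 0 n] = map g2 s.
  by rewrite map_cat -!map_comp.
rewrite !pf_map; apply: pf_ext => -[a|r] [c|q] //=.
  rewrite /f -[RHS]evenker_diff2 !(intrB, intrD).
  set u := a%:~R; set v := c%:~R.
  have -> : v + 1 - u = v - u + 1 by ring.
  have -> : v - (u + 1) = v - u - 1 by ring.
  by have -> : v + 1 - (u + 1) = v - u by ring.
by rewrite /b intrD -[RHS]rowker_diff.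
Qed.

Lemma GTfun_swap h l1 a c l2 :
  GTfun h (l1 ++ a :: c :: l2) + GTfun h (l1 ++ c :: a :: l2) =
  2 * f h (c - a) * GTfun h (l1 ++ l2).
Proof.
(* Removing two variables preserves the parity, hence the number of columns. *)
rewrite /GTfun !map_cat /= -!catA /= !size_cat /= !addnS /rows /num_rows !addnS /= negbK.
rewrite pf_swap /= (_ : f h (a - c) = f h (c - a)); last first.
  by rewrite /f -opprB intrN evenkerN.
by congr (_ * _); ring.
Qed.

(* Differencing all the variables but the last one leaves [Pt a] as the only
   point pairing with [Row 0]. *)
Lemma GTfun_diff h l a :
  pf (pairing h.+1) (map Dp l ++ Pt a :: rows h.+1 (size l).+1) = GTfun h l.
Proof.
have -> : rows h.+1 (size l).+1 = Row 0 :: [seq Row r | r <- iota 1 (num_rows h (size l))].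
  by rewrite /rows /num_rows !addnS !addSn /= negbK.
rewrite pf_pair //; last first.
  rewrite all_map; apply/allP => c _ /=.
  by rewrite /b !rowker0 subrr.
by rewrite /= /b rowker0 mul1r pf_pairing_diff.
Qed.

End GT.

(** * Power series at nilpotent arguments *)

Section SeriesEvaluation.
Variables (C : fieldType) (R : comNzRingType) (phi : {rmorphism C -> R}) (M : nat).
Implicit Types (u v : R) (P Q : fps2 C).

Lemma fps_coefD (K : comNzRingType) (f g : fps K) a : (f + g) a = f a + g a.
Proof. by []. Qed.

Lemma fps_coefN (K : comNzRingType) (f : fps K) a : (- f) a = - f a.
Proof. by []. Qed.

Lemma fps_coefM (K : comNzRingType) (f g : fps K) a :
  (f * g) a = \sum_(i < a.+1) f i * g (a - i)%N.
Proof. by []. Qed.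

Lemma fps_coef1 (K : comNzRingType) a : (1 : fps K) a = (a == 0)%N%:R.
Proof. by []. Qed.

Lemma fps_coef_sum (K : comNzRingType) (I : Type) (r : seq I) (F : I -> fps K) a :
  (\sum_(i <- r) F i) a = \sum_(i <- r) F i a.
Proof. by elim/big_rec2: _ => // i x y _ <-. Qed.

(** [psi] is a bare function: in [ev] it is itself an evaluation, whose multiplicativity rests on
    the nilpotency of [v]. *)
Definition ev1 (K : comNzRingType) (psi : K -> R) u (f : fps K) : R :=
  \sum_(a < M) psi (f a) * u ^+ a.

(** Truncation is harmless: the terms of the product of degree at least [M] contain the factor
    [u ^+ M]. *)
Lemma ev1M (K : comNzRingType) (psi : K -> R) u (f g : fps K) :
  {morph psi : x y / x * y >-> x * y} ->
  {morph psi : x y / x + y >-> x + y} -> psi 0 = 0 -> u ^+ M = 0 ->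
  ev1 psi u (f * g) = ev1 psi u f * ev1 psi u g.
Proof.
move=> psiM psiD psi0 uM.
have psi_sum m (F : nat -> K) : psi (\sum_(i < m) F i) = \sum_(i < m) psi (F i).
  by elim: m => [|m IHm]; rewrite ?big_ord0 // !big_ord_recr psiD IHm.
rewrite /ev1 big_distrlr /=.
transitivity (\sum_(a < M) \sum_(i < M | (i <= a)%N)
    psi (f i) * psi (g (a - i)%N) * u ^+ a).
  apply: eq_bigr => a _.
  rewrite fps_coefM (psi_sum _ (fun i => f i * g (a - i)%N)) mulr_suml.
  under eq_bigr do rewrite psiM.
  rewrite (big_ord_widen_cond M xpredT
    (fun i => psi (f i) * psi (g (a - i)%N) * u ^+ a)) //.
rewrite (exchange_big_dep predT) //=; apply: eq_bigr => i _.
pose H j := psi (f i) * u ^+ i * (psi (g j) * u ^+ j).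
have iM : (i <= M)%N by apply: ltnW.
transitivity (\sum_(0 <= j < M - i) H j); last first.
  rewrite -(big_mkord xpredT H) [RHS](big_cat_nat (leq0n _) (leq_subr i M)) /=.
  rewrite [X in _ = _ + X]big_nat_cond [X in _ = _ + X]big1 ?addr0 // => j.
  rewrite andbT => /andP[Mj jM]; rewrite /H.
  have -> : psi (f i) * u ^+ i * (psi (g j) * u ^+ j) =
          psi (f i) * psi (g j) * (u ^+ (i + j - M) * u ^+ M).
    by rewrite -exprD subnK; [rewrite exprD; ring | lia].
  by rewrite uM !mulr0.
transitivity (\sum_(i <= a < M) psi (f i) * psi (g (a - i)%N) * u ^+ a).
  rewrite big_mkcond -(big_mkord xpredT (fun a => if (i <= a)%N then
    psi (f i) * psi (g (a - i)%N) * u ^+ a else 0)) /=.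
  rewrite (big_cat_nat (leq0n _) iM) //= big1_seq ?add0r.
    by rewrite big_nat_cond [RHS]big_nat_cond; apply: eq_bigr => a /andP[/andP[-> _]].
  by move=> a; rewrite mem_index_iota /= => ai; rewrite leqNgt ai.
rewrite -{1}[nat_of_ord i]add0n big_addn; apply: eq_bigr => j _.
by rewrite addnK /H exprD; ring.
Qed.

Definition ev u v P : R := ev1 (ev1 phi v) u P.

Lemma ev1D (K : comNzRingType) (psi : K -> R) u (f g : fps K) :
  {morph psi : x y / x + y >-> x + y} ->
  ev1 psi u (f + g) = ev1 psi u f + ev1 psi u g.
Proof.
move=> psiD; rewrite /ev1 -big_split /=; apply: eq_bigr => a _.
by rewrite fps_coefD psiD mulrDl.
Qed.

Lemma ev1_0 (K : comNzRingType) (psi : K -> R) u : psi 0 = 0 -> ev1 psi u 0 = 0.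
Proof. by move=> psi0; rewrite /ev1 big1 // => a _; rewrite psi0 mul0r. Qed.

Lemma ev1_1 (K : comNzRingType) (psi : K -> R) u : psi 1 = 1 -> psi 0 = 0 ->
  u ^+ M = 0 -> ev1 psi u 1 = 1.
Proof.
move=> psi1 psi0 uM; rewrite /ev1; case: M uM => [/eqP|m _]; first by rewrite expr0 oner_eq0.
rewrite big_ord_recl big1 /= ?fps_coef1 /= ?psi1 ?mul1r ?addr0 //.
by move=> i _; rewrite fps_coef1 /= psi0 mul0r.
Qed.

Section Nilpotent.
Variables u v : R.
Hypotheses (uM : u ^+ M = 0) (vM : v ^+ M = 0).

Let psiM : {morph ev1 (phi : C -> R) v : f g / f * g >-> f * g}.
Proof. by move=> f g; apply: ev1M => //; [exact: rmorphM|exact: rmorphD|exact: rmorph0]. Qed.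

Let psiD : {morph ev1 (phi : C -> R) v : f g / f + g >-> f + g}.
Proof. by move=> f g; apply: ev1D; exact: rmorphD. Qed.

Let psi0 : ev1 (phi : C -> R) v 0 = 0.
Proof. by apply: ev1_0; exact: rmorph0. Qed.

Lemma evM P Q : ev u v (P * Q) = ev u v P * ev u v Q.
Proof. exact: ev1M psiM psiD psi0 uM. Qed.

Lemma evD P Q : ev u v (P + Q) = ev u v P + ev u v Q.
Proof. exact: ev1D psiD. Qed.

Lemma ev1E : ev u v 1 = 1.
Proof. by apply: ev1_1 => //; apply: ev1_1 => //; [exact: rmorph1|exact: rmorph0]. Qed.

Lemma ev0 : ev u v 0 = 0.
Proof. exact: ev1_0 psi0. Qed.

Lemma evN P : ev u v (- P) = - ev u v P.
Proof. by apply/eqP; rewrite -addr_eq0 -evD addNr ev0. Qed.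

Lemma evX k P : ev u v (P ^+ k) = ev u v P ^+ k.
Proof. by elim: k => [|k IHk]; rewrite ?expr0 ?ev1E // !exprS evM IHk. Qed.

Lemma evE P : ev u v P = \sum_(a < M) \sum_(b < M) phi (P a b) * (u ^+ a * v ^+ b).
Proof.
rewrite /ev /ev1; apply: eq_bigr => a _; rewrite mulr_suml.
by apply: eq_bigr => b _; rewrite -mulrA [u ^+ a * _]mulrC.
Qed.

Lemma ev_unit P : P 0%N 0%N != 0 -> ev u v P * ev u v P^-1 = 1.
Proof. by move=> P0; rewrite -evM divrr ?ev1E // fps2_unitE. Qed.

End Nilpotent.
End SeriesEvaluation.

Section Order.
Variable C : fieldType.
Implicit Types P Q f g : fps2 C.

Definition order_ge k P := forall a b, (a + b < k)%N -> P a b = 0.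

Lemma fps2_coefM P Q a b : (P * Q) a b =
  \sum_(i < a.+1) \sum_(j < b.+1) P i j * Q (a - i)%N (b - j)%N.
Proof.
by rewrite fps_coefM fps_coef_sum; apply: eq_bigr => i _; rewrite fps_coefM.
Qed.

Lemma order_geM k l P Q : order_ge k P -> order_ge l Q -> order_ge (k + l) (P * Q).
Proof.
move=> Pk Ql a b abkl; rewrite fps2_coefM big1 // => i _; rewrite big1 // => j _.
have [ijk|kij] := ltnP (i + j) k; first by rewrite Pk ?mul0r.
rewrite Ql ?mulr0 //; have := ltn_ord i; have := ltn_ord j; lia.
Qed.

Lemma order_geX k P m : order_ge k P -> order_ge (m * k) (P ^+ m).
Proof.
move=> Pk; elim: m => [|m IHm]; first by move=> a b; rewrite mul0n.
by rewrite exprS mulSn; apply: order_geM.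
Qed.

Lemma order_ge1 P : P 0%N 0%N = 0 -> order_ge 1 P.
Proof. by move=> P0 [|a] [|b] //; rewrite ltnS. Qed.

End Order.

Section Composition.
Variables (C : fieldType) (R : comNzRingType) (phi : {rmorphism C -> R}) (M : nat).
Implicit Types (u v : R) (P Q f g : fps2 C).

(** Nilpotency by total degree is stronger than that of [u] and [v] separately. It matches the
    truncation in [fps_comp] and makes series of order at least [M] evaluate to zero. *)
Definition nilpair u v := forall a b, (M <= a + b)%N -> u ^+ a * v ^+ b = 0.

Local Notation ev := (ev phi M).

Lemma nilpairl u v : nilpair u v -> u ^+ M = 0.
Proof. by move=> uv; rewrite -(uv M 0%N) ?expr0 ?mulr1 // addn0. Qed.

Lemma nilpairr u v : nilpair u v -> v ^+ M = 0.
Proof. by move=> uv; rewrite -(uv 0%N M) ?expr0 ?mul1r. Qed.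

Section Pair.
Variables u v : R.
Hypothesis uv : nilpair u v.
Let uM := nilpairl uv.
Let vM := nilpairr uv.

Lemma ev_fpsX : ev u v (fpsX C) = u.
Proof.
rewrite evE /fpsX; case: M uM => [/eqP|m um]; first by rewrite expr0 oner_eq0.
under eq_bigr => a _.
  rewrite big_ord_recl [X in _ + X]big1; last first.
    by move=> b _ /=; rewrite andbF rmorph0 mul0r.
  rewrite expr0 mulr1 addr0 andbT.
  over.
case: m um => [|m] um; rewrite big_ord_recl /= rmorph0 mul0r add0r.
  by rewrite big_ord0 -[u]expr1 um.
rewrite big_ord_recl /= rmorph1 mul1r expr1 big1 ?addr0 // => i _.
by rewrite /= rmorph0 mul0r.
Qed.

Lemma ev_fpsY : ev u v (fpsY C) = v.
Proof.
rewrite evE /fpsY; case: M vM => [/eqP|m um]; first by rewrite expr0 oner_eq0.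
rewrite big_ord_recl [X in _ + X]big1 ?addr0; last first.
  by move=> i _; rewrite big1 // => b _ /=; rewrite rmorph0 mul0r.
rewrite /=; under eq_bigr => b _ do rewrite expr0 mul1r.
case: m um => [|m] um; rewrite big_ord_recl /= rmorph0 mul0r add0r.
  by rewrite big_ord0 -[v]expr1 um.
rewrite big_ord_recl /= rmorph1 mul1r expr1 big1 ?addr0 // => i _.
by rewrite /= rmorph0 mul0r.
Qed.

Lemma ev_order P : order_ge M P -> ev u v P = 0.
Proof.
move=> P0; rewrite evE big1 // => a _; rewrite big1 // => b _.
have [abM|Mab] := ltnP (a + b) M; first by rewrite P0 // rmorph0 mul0r.
by rewrite uv // mulr0.
Qed.

Lemma ev_nilpair f g : f 0%N 0%N = 0 -> g 0%N 0%N = 0 -> nilpair (ev u v f) (ev u v g).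
Proof.
move=> f0 g0 a b Mab; rewrite -!evX // -evM // ev_order // => i j ijM.
have := order_geM (order_geX (m := a) (order_ge1 f0)) (order_geX (m := b) (order_ge1 g0)).
by apply; rewrite !muln1; apply: leq_trans Mab.
Qed.

(** Both sides are sums of the same terms over different ranges of [i] and [j]: up to [a + b] on the
    left, below [M] on the right. The ranges can be matched because [f ^+ i * g ^+ j] has order at
    least [i + j]. *)
Lemma ev_comp P f g : f 0%N 0%N = 0 -> g 0%N 0%N = 0 ->
  ev u v (fps_comp P f g) = ev (ev u v f) (ev u v g) P.
Proof.
move=> f0 g0; rewrite [RHS]evE.
transitivity (\sum_(i < M) \sum_(j < M) \sum_(a < M) \sum_(b < M)
   phi (P i j) * (phi ((f ^+ i * g ^+ j) a b) * (u ^+ a * v ^+ b))); last first.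
  apply: eq_bigr => i _; apply: eq_bigr => j _.
  rewrite -!evX // -evM // evE mulr_sumr; apply: eq_bigr => a _.
  by rewrite mulr_sumr.
under [RHS]eq_bigr => i _ do rewrite exchange_big /=.
rewrite exchange_big evE; apply: eq_bigr => a _ /=.
under [RHS]eq_bigr => i _ do rewrite exchange_big /=.
rewrite exchange_big; apply: eq_bigr => b _ /=.
have [abM|Mab] := ltnP (a + b) M; last first.
  rewrite uv // mulr0 big1 // => i _; rewrite big1 // => j _.
  by rewrite !mulr0.
rewrite /fps_comp rmorph_sum mulr_suml /=.
pose G i j := phi (P i j) * (phi ((f ^+ i * g ^+ j) a b) * (u ^+ a * v ^+ b)).
have G0 i j : (a + b < i + j)%N -> G i j = 0.
  move=> abij; rewrite /G (order_geM (order_geX (m := i) (order_ge1 f0)) (order_geX (m := j)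
      (order_ge1 g0))) ?muln1 //.
  by rewrite rmorph0 mul0r mulr0.
transitivity (\sum_(i < (a + b).+1) \sum_(j < (a + b).+1) G i j).
  apply: eq_bigr => i _; rewrite rmorph_sum mulr_suml; apply: eq_bigr => j _.
  by rewrite rmorphM /G -mulrA.
have wid (H : nat -> R) : (forall i, (a + b < i)%N -> H i = 0) ->
    \sum_(i < (a + b).+1) H i = \sum_(i < M) H i.
  move=> H0; rewrite (big_ord_widen _ H abM) [RHS](bigID (fun i : 'I_M => (i < (a + b).+1)%N)) /=.
  rewrite [X in _ = _ + X]big1 ?addr0 // => i; rewrite -leqNgt; exact: H0.
transitivity (\sum_(i < (a + b).+1) \sum_(j < M) G i j).
  apply: eq_bigr => i _; apply: wid => j abj; apply: G0.
  by apply: leq_trans abj _; apply: leq_addl.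
apply: (wid (fun i => \sum_(j < M) G i j)) => i abi.
by rewrite big1 // => j _; rewrite G0 //; apply: leq_trans abi _; apply: leq_addr.
Qed.

End Pair.
End Composition.

(** * Hidden power series *)

Section Identities.
Variables (C : fieldType) (R : comNzRingType) (phi : {rmorphism C -> R}) (M : nat).
Implicit Types (u v x y : R) (P Q A : fps2 C).

Local Notation ev := (ev phi M).
Local Notation nilpair := (nilpair M).

Lemma cancel_inv d e x y : d * e = 1 -> x * d = y * d -> x = y.
Proof. by move=> de xy; rewrite -[x]mulr1 -[y]mulr1 -de !mulrA xy. Qed.

Lemma nilpair_diag u : u ^+ M = 0 -> nilpair u u.
Proof. by move=> uM a b Mab; rewrite -exprD -(subnK Mab) exprD uM mulr0. Qed.

Lemma nilpairC u v : nilpair u v -> nilpair v u.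
Proof. by move=> uv a b Mab; rewrite mulrC uv // addnC. Qed.

#[local] Opaque fps_comp hidden_ratio fps_mul fps_add fps_opp fps_inv fps_one fps_zero.

Definition ev_iota u := ev u u (fps_iota (fpsX C)).

Lemma fps_iotaE (f : fps2 C) : f 0%N 0%N = 0 -> (1 + f) * (1 + fps_iota f) = 1.
Proof.
move=> f0; have Uf : 1 + f \is a GRing.unit.
  by rewrite fps2_unitE !fps_coefD f0 addr0; exact: oner_neq0.
by rewrite /fps_iota mulrDr mulr1 mulrN mulrCA divrr // mulr1 addrK.
Qed.

Lemma fps_iota0 (f : fps2 C) : f 0%N 0%N = 0 -> fps_iota f 0%N 0%N = 0.
Proof.
move=> f0; rewrite /fps_iota !fps_coefN fps2_coefM !big_ord1 /= f0 mul0r.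
exact: oppr0.
Qed.

(** Characterises $\iota(u)$ by a product equation; the facts about $\iota$ below rest on it,
    without unfolding the series. *)
Lemma ev_iota_uniq u x y : (1 + u) * (1 + x) = 1 -> (1 + u) * (1 + y) = 1 -> x = y.
Proof.
move=> ux uy; apply: (addrI 1); apply: (@cancel_inv (1 + u) (1 + x)) => //.
by rewrite mulrC ux mulrC uy.
Qed.

Lemma ev_iotaX_spec u v : nilpair u v -> (1 + u) * (1 + ev u v (fps_iota (fpsX C))) = 1.
Proof.
move=> uv; have uM := nilpairl uv; have vM := nilpairr uv.
have := @fps_iotaE (fpsX C) erefl.
by move/(congr1 (ev u v)); rewrite evM // !evD // ev_fpsX // ev1E.
Qed.

Lemma ev_iotaE u : u ^+ M = 0 -> (1 + u) * (1 + ev_iota u) = 1.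
Proof. by move=> uM; apply: ev_iotaX_spec; exact: nilpair_diag. Qed.

Section Pair.
Variables u v : R.
Hypothesis uv : nilpair u v.
Let uM := nilpairl uv.
Let vM := nilpairr uv.
Let iu := ev_iotaE uM.
Let iv := ev_iotaE vM.

Lemma ev_iotaX : ev u v (fps_iota (fpsX C)) = ev_iota u.
Proof. exact: ev_iota_uniq (ev_iotaX_spec uv) iu. Qed.

Lemma ev_iotaY : ev u v (fps_iota (fpsY C)) = ev_iota v.
Proof.
apply: (@ev_iota_uniq v) => //.
have := @fps_iotaE (fpsY C) erefl.
by move/(congr1 (ev u v)); rewrite evM // !evD // ev_fpsY // ev1E.
Qed.

Lemma nilpair_iotal : nilpair (ev_iota u) v.
Proof.
by rewrite -ev_iotaX -{2}(ev_fpsY phi uv); apply: ev_nilpair => //; apply: fps_iota0.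
Qed.

Lemma nilpair_iotar : nilpair u (ev_iota v).
Proof.
by rewrite -ev_iotaY -{1}(ev_fpsX phi uv); apply: ev_nilpair => //; apply: fps_iota0.
Qed.

End Pair.

Lemma ev_iotaM u : u ^+ M = 0 -> ev_iota u ^+ M = 0.
Proof. by move=> uM; apply: nilpairl (nilpair_iotal (nilpair_diag uM)). Qed.

Lemma ev_iotaK u : u ^+ M = 0 -> ev_iota (ev_iota u) = u.
Proof.
move=> uM; apply: (@ev_iota_uniq (ev_iota u)); first by apply/ev_iotaE/ev_iotaM.
by rewrite mulrC ev_iotaE.
Qed.

Lemma ev_iota0 : (0 < M)%N -> ev_iota 0 = 0.
Proof.
move=> M0; have z : 0 ^+ M = 0 :> R by rewrite expr0n gtn_eqF.
by apply: (@ev_iota_uniq 0); [exact: ev_iotaE | rewrite addr0 mulr1].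
Qed.

Lemma nilpair0r u : (0 < M)%N -> u ^+ M = 0 -> nilpair u 0.
Proof.
move=> M0 uM a [|b] Mab; last by rewrite expr0n mulr0.
by rewrite addn0 in Mab; rewrite -(subnK Mab) exprD uM mulr0 mul0r.
Qed.

Lemma nilpair_lower u : nilpair u (ev_iota u) <-> u ^+ M = 0.
Proof.
split=> [|uM]; first exact: nilpairl.
exact: nilpair_iotar (nilpair_diag uM).
Qed.

Variable A : fps2 C.
Hypothesis hA : hidden A.

(** The symbol of [Strict]: $E_x^{-1}(1+E_y\Delta_x)$ with $E=1+\Delta$. *)
Definition strict_series : fps2 C := (1 + fpsX C + fpsX C * fpsY C) / (1 + fpsX C).

Lemma strict_series00 : strict_series 0%N 0%N != 0.
Proof.
rewrite -fps2_unitE unitrM unitrV !fps2_unitE !fps_coefD fps2_coefM !big_ord1 /=.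
rewrite !mul0r !addr0 andbb; exact: oner_neq0.
Qed.

Lemma ev_strict u v : nilpair u v ->
  ev u v strict_series = (1 + u + u * v) * (1 + ev_iota u).
Proof.
move=> uv; have uM := nilpairl uv; have vM := nilpairr uv.
apply: (@cancel_inv (1 + u) (1 + ev_iota u)); first exact: ev_iotaE.
rewrite -[RHS]mulrA [(1 + ev_iota u) * _]mulrC ev_iotaE // mulr1.
have U : 1 + fpsX C \is a GRing.unit.
  by rewrite fps2_unitE !fps_coefD addr0; exact: oner_neq0.
have /(congr1 (ev u v)) := divrK U (1 + fpsX C + fpsX C * fpsY C).
by rewrite evM // !evD // evM // ev_fpsX // ev_fpsY // ev1E.
Qed.

Lemma ev_strictV u v : nilpair u v -> ev u v strict_series * ev u v strict_series^-1 = 1.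
Proof.
by move=> uv; apply: ev_unit strict_series00; [exact: nilpairl uv | exact: nilpairr uv].
Qed.

#[local] Opaque fpsX fpsY fps_iota.

(* [rho] is the quotient of the values of P and [c] one of the two prefactors
   of a hidden series; nothing else about P is used. *)
Lemma hidden_values : exists rho : R -> R -> R, exists c : R -> R -> R,
  [/\ forall u v, nilpair u v -> ev u v A = c u v * rho u v,
      forall u v, nilpair u v -> rho u v = rho v u,
      forall u, u ^+ M = 0 -> (1 + u + u ^+ 2) * rho u (ev_iota u) = 1 + u &
      [/\ forall u v, nilpair u v ->
        rho u v * rho (ev_iota u) v * (rho u (ev_iota v) * rho (ev_iota u) (ev_iota v)) = 1,
      (0 < M)%N -> forall u, u ^+ M = 0 -> rho u 0 * rho (ev_iota u) 0 = 1 &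
      (forall x y, c x y = 1 + x + y) \/ (forall x y, c x y = 1 - x * y)]].
Proof.
have [P [P00 Pker] AE] := hA.
have compU f g : fps_comp P f g \is a GRing.unit by rewrite fps2_unitE fps_comp00.
(* The quotient is kept only through its product equation; after evaluation the units are removed
   with [cancel_inv]. *)
have [ratio ratioE {}AE] : exists2 ratio : fps2 C,
    ratio * (fps_comp P (fps_iota (fpsX C)) (fpsY C) *
             fps_comp P (fps_iota (fpsY C)) (fpsX C)) =
    fps_comp P (fpsX C) (fpsY C) * fps_comp P (fpsY C) (fpsX C) &
    A = (1 + fpsX C + fpsY C) * ratio \/ A = (1 - fpsX C * fpsY C) * ratio.
  exists (hidden_ratio P); last exact: AE.
  by apply: divrK; rewrite unitrM; apply/andP; split; apply: compU.
have [p pE] : exists p, forall x y, ev x y P = p x y by exists (fun x y => ev x y P).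
have [rho rhoE0] : exists rho, forall x y, ev x y ratio = rho x y.
  by exists (fun x y => ev x y ratio).
have pU x y : nilpair x y -> exists e, p x y * e = 1.
  move=> xy; exists (ev x y P^-1); rewrite -pE.
  apply: ev_unit P00; [exact: nilpairl xy | exact: nilpairr xy].
have invM x y d e : x * d = 1 -> y * e = 1 -> (x * y) * (d * e) = 1.
  by move=> xd ye; rewrite mulrACA xd ye mulr1.
have ev_comp2 u v (f g f' g' : fps2 C) x y x' y' :
    nilpair u v -> f 0%N 0%N = 0 -> g 0%N 0%N = 0 -> f' 0%N 0%N = 0 -> g' 0%N 0%N = 0 ->
    ev u v f = x -> ev u v g = y -> ev u v f' = x' -> ev u v g' = y' ->
    ev u v (fps_comp P f g * fps_comp P f' g') = p x y * p x' y'.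
  move=> uv f0 g0 f0' g0' <- <- <- <-.
  rewrite (evM phi (nilpairl uv) (nilpairr uv) (fps_comp P f g) (fps_comp P f' g')).
  by rewrite -!pE; congr (_ * _); apply: ev_comp.
have X0 : fpsX C 0%N 0%N = 0 by exact: erefl.
have Y0 : fpsY C 0%N 0%N = 0 by exact: erefl.
have iX0 := fps_iota0 X0; have iY0 := fps_iota0 Y0.
have rhoE u v : nilpair u v ->
    rho u v * (p (ev_iota u) v * p (ev_iota v) u) = p u v * p v u.
  move=> uv; have uM := nilpairl uv; have vM := nilpairr uv.
  have [eX eY] := (ev_fpsX phi uv, ev_fpsY phi uv).
  have [eiX eiY] := (ev_iotaX uv, ev_iotaY uv).
  rewrite -(ev_comp2 _ _ _ _ _ _ _ _ _ _ uv iX0 Y0 iY0 X0 eiX eY eiY eX).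
  rewrite -(ev_comp2 _ _ _ _ _ _ _ _ _ _ uv X0 Y0 Y0 X0 eX eY eY eX).
  rewrite -rhoE0.
  exact: etrans (esym (evM phi uM vM ratio _)) (congr1 (ev u v) ratioE).
have U2 : 1 + fpsX C + fpsX C ^+ 2 \is a GRing.unit.
  rewrite fps2_unitE !fps_coefD expr2 fps2_coefM !big_ord1 X0 mul0r !addr0.
  exact: oner_neq0.
have kerE u : u ^+ M = 0 ->
    p u (ev_iota u) * p (ev_iota u) u * (1 + u + u ^+ 2) = (1 + u) * (p u u * p (ev_iota u)
        (ev_iota u)).
  move=> uM; have uu := nilpair_diag uM.
  have frac (a b c d : fps2 C) : b \is a GRing.unit -> d \is a GRing.unit ->
      a / b = c / d -> a * d = c * b.
    by move=> Ub Ud ab; rewrite -(divrK Ub a) ab mulrAC divrK.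
  have U1 : fps_comp P (fpsX C) (fpsX C) *
      fps_comp P (fps_iota (fpsX C)) (fps_iota (fpsX C)) \is a GRing.unit.
    by rewrite unitrM; apply/andP; split; apply: compU.
  have kE := frac _ _ _ _ U1 U2 Pker.
  have [eX eiX] := (ev_fpsX phi uu, ev_iotaX uu).
  rewrite -(ev_comp2 _ _ _ _ _ _ _ _ _ _ uu X0 iX0 iX0 X0 eX eiX eiX eX).
  rewrite -(ev_comp2 _ _ _ _ _ _ _ _ _ _ uu X0 X0 iX0 iX0 eX eX eiX eiX).
  have e1X : ev u u (1 + fpsX C) = 1 + u.
    exact: etrans (evD phi _ _ _ _ _) (congr2 _ (ev1E phi uM uM) eX).
  have e1XX : ev u u (1 + fpsX C + fpsX C ^+ 2) = 1 + u + u ^+ 2.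
    apply: etrans (evD phi _ _ _ _ _) _; congr (_ + _); first exact: e1X.
    by apply: etrans (evX phi uM uM 2 _) _; congr (_ ^+ 2).
  rewrite -e1XX -e1X.
  apply: etrans (esym (evM phi uM uM _ _)) _.
  exact: etrans (congr1 (ev u u) kE) (evM phi uM uM _ _).
exists rho; exists (if `[< A = (1 + fpsX C + fpsY C) * ratio >]
  then fun x y => 1 + x + y else fun x y => 1 - x * y).
split=> [u v uv|u v uv|u uM|].
- have uM := nilpairl uv; have vM := nilpairr uv.
  have [eX eY] := (ev_fpsX phi uv, ev_fpsY phi uv).
  rewrite -rhoE0; case: asboolP AE => [-> _|nA [//|->]].
    apply: etrans (evM phi uM vM _ ratio) _; congr (_ * _).
    apply: etrans (evD phi _ _ _ _ _) _; congr (_ + _); last exact: eY.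
    exact: etrans (evD phi _ _ _ _ _) (congr2 _ (ev1E phi uM vM) eX).
  apply: etrans (evM phi uM vM _ ratio) _; congr (_ * _).
  apply: etrans (evD phi _ _ _ _ _) _; congr (_ + _); first exact: ev1E.
  apply: etrans (evN phi _ _ _ _) _; congr (- _).
  exact: etrans (evM phi uM vM _ _) (congr2 _ eX eY).
- have [e1 e1E] := pU _ _ (nilpair_iotal uv).
  have [e2 e2E] := pU _ _ (nilpairC (nilpair_iotar uv)).
  apply: (cancel_inv (invM _ _ _ _ e1E e2E)).
  have E1 := rhoE _ _ uv; have E2 := rhoE _ _ (nilpairC uv).
  by rewrite E1 [p (ev_iota u) v * _]mulrC E2 mulrC.
- have uu := nilpair_diag uM; have [e1 e1E] := pU _ _ uu.
  have [e2 e2E] := pU _ _ (nilpair_diag (ev_iotaM uM)).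
  apply: (cancel_inv (invM _ _ _ _ e1E e2E)).
  rewrite -kerE // -mulrA [p u u * _]mulrC.
  have := rhoE _ _ (nilpair_iotar uu); rewrite ev_iotaK // => ->.
  by rewrite mulrC.
split.
- move=> u v uv; have uM := nilpairl uv; have vM := nilpairr uv.
  have uv1 := nilpair_iotal uv; have uv2 := nilpair_iotar uv.
  have uv3 := nilpair_iotar uv1.
  have [e1 e1E] := pU _ _ uv1; have [e2 e2E] := pU _ _ (nilpairC uv2).
  have [e3 e3E] := pU _ _ uv; have [e4 e4E] := pU _ _ (nilpairC uv3).
  have [e5 e5E] := pU _ _ uv3; have [e6 e6E] := pU _ _ (nilpairC uv).
  have [e7 e7E] := pU _ _ uv2; have [e8 e8E] := pU _ _ (nilpairC uv1).
  have I1 := invM _ _ _ _ (invM _ _ _ _ e1E e2E) (invM _ _ _ _ e3E e4E).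
  have I2 := invM _ _ _ _ (invM _ _ _ _ e5E e6E) (invM _ _ _ _ e7E e8E).
  apply: (cancel_inv (invM _ _ _ _ I1 I2)); rewrite mul1r mulrACA.
  rewrite [X in X * _]mulrACA [X in _ * X]mulrACA rhoE //.
  have := rhoE _ _ uv1; rewrite ev_iotaK // => ->.
  have := rhoE _ _ uv2; rewrite ev_iotaK // => ->.
  have := rhoE _ _ uv3; rewrite !ev_iotaK // => ->.
  by ring.
- move=> M0 u uM; have u0 := nilpair0r M0 uM.
  have [e1 e1E] := pU _ _ (nilpair_iotal u0); have [e2 e2E] := pU _ _ (nilpairC u0).
  have [e3 e3E] := pU _ _ u0.
  have I0 := invM _ _ _ _ (invM _ _ _ _ e1E e2E) (invM _ _ _ _ e3E e2E).
  apply: (cancel_inv I0); rewrite mul1r mulrACA.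
  have := rhoE _ _ u0; have := rhoE _ _ (nilpair_iotal u0).
  have [e4 e4E] := pU _ _ (nilpairC (nilpair_iotal u0)).
  rewrite ev_iotaK // ev_iota0 // => E1 E2.
  have -> : rho u 0 * (p (ev_iota u) 0 * p 0 u) = p u 0 * p 0 u by [].
  have -> : rho (ev_iota u) 0 * (p u 0 * p 0 u) = p (ev_iota u) 0 * p 0 u.
    apply: (cancel_inv e4E).
    by transitivity (rho (ev_iota u) 0 * (p u 0 * p 0 (ev_iota u)) * p 0 u);
      [ring | rewrite E1; ring].
  by ring.
- by case: asboolP => _; [left|right].
Qed.


Definition ratio_series : fps2 C := A / strict_series.

Local Notation st u v := (ev u v strict_series).
Local Notation sti u v := (ev u v strict_series^-1).
Local Notation B u v := (ev u v ratio_series).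

(** Expansion of $(1+u)(1+\iota(u))=1$. Consequently every symmetric polynomial in $u$ and
    $\iota(u)$ is a polynomial in $u+\iota(u)$. *)
Lemma ev_iota_add u : u ^+ M = 0 -> u * ev_iota u = - (u + ev_iota u).
Proof.
move=> uM; apply/eqP; rewrite -addr_eq0 -(subr_eq0 _ 0) subr0.
have -> : u * ev_iota u + (u + ev_iota u) = (1 + u) * (1 + ev_iota u) - 1 by ring.
by rewrite ev_iotaE // subrr.
Qed.

Lemma ev_strict_iota u v : nilpair u v -> st u v = 1 - ev_iota u * v.
Proof.
move=> uv; rewrite ev_strict //.
have -> : (1 + u + u * v) * (1 + ev_iota u) =
    1 - ev_iota u * v + ((1 + u) * (1 + ev_iota u) - 1) * (1 + v) by ring.
by rewrite ev_iotaE ?subrr ?mul0r ?addr0 //; exact: nilpairl uv.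
Qed.

Lemma ev_ratio u v : nilpair u v -> B u v = ev u v A * sti u v.
Proof. by move=> uv; apply: evM; [exact: nilpairl uv|exact: nilpairr uv]. Qed.

Lemma ev_hidden_sym u v : nilpair u v -> ev u v A = ev v u A.
Proof.
move=> uv; have [rho [c [AE rhoC _ [_ _ cE]]]] := hidden_values.
rewrite AE // AE; last exact: nilpairC.
by rewrite rhoC //; case: cE => cE; rewrite !cE; ring.
Qed.

(** By [ev_iota_add] both prefactors take the value $1+u+\iota(u)=(1+u+u^2)/(1+u)$, the inverse of
    what the condition on $P$ prescribes for [rho]. *)
Lemma ev_hidden_iota u : u ^+ M = 0 -> ev u (ev_iota u) A = 1.
Proof.
move=> uM; have [rho [c [AE _ rhoE [_ _ cE]]]] := hidden_values.
rewrite AE; last by apply/nilpair_lower.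
have -> : c u (ev_iota u) = 1 + u + ev_iota u.
  by case: cE => ->; rewrite ?ev_iota_add //; ring.
have iu := ev_iotaE uM; rewrite mulrC in iu.
have iu' : (1 + u) * (1 + ev_iota u) = 1 by rewrite mulrC.
apply: (cancel_inv iu'); rewrite mul1r -[RHS]rhoE //.
have -> : (1 + u + ev_iota u) * rho u (ev_iota u) * (1 + u) =
  ((1 + u) * (1 + ev_iota u) + u + u ^+ 2) * rho u (ev_iota u) by ring.
by rewrite iu'; ring.
Qed.

(** The four values of [rho] multiply to 1, which leaves the prefactors. For $1-xy$ they are, in
    another order, the four values of [strict_series], which is $1-\iota(x)y$. For $1+x+y$, [key]
    gives $1-\iota(x)\iota(y)$ up to units, and these units multiply to 1. *)
Lemma ev_hidden4 u v : nilpair u v ->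
  ev u v A * ev (ev_iota u) v A * (ev u (ev_iota v) A * ev (ev_iota u) (ev_iota v) A) =
  st u v * st (ev_iota u) v * (st u (ev_iota v) * st (ev_iota u) (ev_iota v)).
Proof.
move=> uv; have uM := nilpairl uv; have vM := nilpairr uv.
have uv1 := nilpair_iotal uv; have uv2 := nilpair_iotar uv.
have uv3 := nilpair_iotar uv1.
have [rho [c [AE _ _ [rho4 _ cE]]]] := hidden_values.
rewrite !AE // !ev_strict_iota // !ev_iotaK //.
move: (rho4 _ _ uv); move: (rho u v) (rho (ev_iota u) v) (rho u (ev_iota v)) (rho (ev_iota u)
    (ev_iota v)).
move=> r1 r2 r3 r4 r1234.
have -> : c u v * r1 * (c (ev_iota u) v * r2) *
  (c u (ev_iota v) * r3 * (c (ev_iota u) (ev_iota v) * r4)) =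
  c u v * c (ev_iota u) v * (c u (ev_iota v) * c (ev_iota u) (ev_iota v)) * (r1 * r2 * (r3 *
      r4)) by ring.
rewrite r1234 mulr1; case: cE => cE; rewrite !cE; last by ring.
have key x y : x ^+ M = 0 -> y ^+ M = 0 ->
    1 + x + y = (1 + x) * (1 + y) * (1 - ev_iota x * ev_iota y).
  move=> xM yM; have -> : (1 + x) * (1 + y) * (1 - ev_iota x * ev_iota y) =
     (1 + x) * (1 + y) - ((1 + x) * (1 + ev_iota x) - (1 + x)) * ((1 + y) * (1 + ev_iota y) - (1
         + y)) by ring.
  by rewrite !ev_iotaE //; ring.
rewrite !key ?ev_iotaM // !ev_iotaK //.
set U := 1 - _; set V := 1 - _; set W := 1 - _; set Z := 1 - _.
have iu := ev_iotaE uM; have iv := ev_iotaE vM.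
transitivity (((1 + u) * (1 + ev_iota u)) ^+ 2 * ((1 + v) * (1 + ev_iota v)) ^+ 2 * (U * V * (W
    * Z))).
  by ring.
by rewrite iu iv; ring.
Qed.

(* With [t = u + ev_iota u] and [a y = y (1 + y)], this is the value at [y] of
   (1 - t a(y)) / (1 - t a(ev_iota y)). *)
Definition odd_defect u y : R := st u y * st (ev_iota u) y * (sti y u * sti y (ev_iota u)).

(** The factor of a variable [y] to the right of a pair whose operators have become $u$ and
    $\iota(u)$. *)
Definition odd_part u y : R := B u y * B (ev_iota u) y.

(** Since [A] is symmetric, exchanging the arguments of [B] only changes the values of
    [strict_series]; the quotient is free of [A]. *)
Lemma odd_partE u y : nilpair u y ->
  B y u * B y (ev_iota u) = odd_part u y * odd_defect u y.
Proof.
move=> uy; have yu := nilpairC uy.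
have uy1 := nilpair_iotal uy; have yu1 := nilpair_iotar yu.
rewrite /odd_part /odd_defect !ev_ratio // (ev_hidden_sym yu) (ev_hidden_sym yu1).
have := ev_strictV uy; have := ev_strictV uy1.
move: (st u y) (st (ev_iota u) y) (sti u y) (sti (ev_iota u) y) (sti y u) (sti y (ev_iota u)).
move=> s1 s2 i1 i2 i3 i4 E2 E1.
set a := ev u y A; set b := ev _ y A.
transitivity (a * b * (i3 * i4) * ((s1 * i1) * (s2 * i2))); last by ring.
by rewrite E1 E2; ring.
Qed.

(** By [ev_hidden4] the four numerators have the same product as the four denominators. *)
Lemma odd_part_iota u y : nilpair u y -> odd_part u y * odd_part u (ev_iota y) = 1.
Proof.
move=> uy; have uy1 := nilpair_iotal uy; have uy2 := nilpair_iotar uy.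
have uy3 := nilpair_iotar uy1.
rewrite /odd_part !ev_ratio //.
move: (ev_hidden4 uy) (ev_strictV uy) (ev_strictV uy1) (ev_strictV uy2) (ev_strictV uy3).
move: (st u y) (st (ev_iota u) y) (st u (ev_iota y)) (st (ev_iota u) (ev_iota y)).
move: (sti u y) (sti (ev_iota u) y) (sti u (ev_iota y)) (sti (ev_iota u) (ev_iota y)).
move: (ev u y A) (ev (ev_iota u) y A) (ev u (ev_iota y) A) (ev (ev_iota u) (ev_iota y) A).
move=> a b c d i1 i2 i3 i4 s1 s2 s3 s4 abcd e1 e2 e3 e4.
transitivity (a * b * (c * d) * (i1 * i2 * i3 * i4)); first by ring.
rewrite abcd; transitivity ((s1 * i1) * (s2 * i2) * ((s3 * i3) * (s4 * i4))); first by ring.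
by rewrite e1 e2 e3 e4; ring.
Qed.

Lemma ev_strict_pair u y : nilpair u y ->
  st u y * st (ev_iota u) y = 1 - (u + ev_iota u) * (y * (1 + y)).
Proof.
move=> uy; have uM := nilpairl uy.
rewrite !ev_strict_iota ?ev_iotaK //; last exact: nilpair_iotal.
transitivity (1 - (u + ev_iota u) * y + (u * ev_iota u) * y ^+ 2); first by ring.
by rewrite ev_iota_add //; ring.
Qed.

Lemma ev_strict_pair_iota u y : nilpair u y ->
  st y u * st y (ev_iota u) = 1 - (u + ev_iota u) * (ev_iota y * (1 + ev_iota y)).
Proof.
move=> uy; have uM := nilpairl uy.
rewrite !ev_strict_iota; try exact: nilpairC; last exact/nilpairC/nilpair_iotal.
transitivity (1 - (u + ev_iota u) * ev_iota y + (u * ev_iota u) * ev_iota y ^+ 2); first by ring.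
by rewrite ev_iota_add //; ring.
Qed.

(** Multiplied out, this writes the defect as 1 plus a multiple of $u+\iota(u)$, the operator that
    lowers the even kernel. *)
Lemma odd_defect_rec u y : nilpair u y ->
  odd_defect u y * (1 - (u + ev_iota u) * (ev_iota y * (1 + ev_iota y))) =
  1 - (u + ev_iota u) * (y * (1 + y)).
Proof.
move=> uy; have yu := nilpairC uy; have yu1 := nilpair_iotar yu.
rewrite -(ev_strict_pair uy) -(ev_strict_pair_iota uy) /odd_defect.
move: (ev_strictV yu) (ev_strictV yu1) => e1 e2.
set s1 := st u y; set s2 := st _ y; move: e1 e2.
move: (st y u) (st y (ev_iota u)) (sti y u) (sti y (ev_iota u)) => s3 s4 i3 i4 e1 e2.
by transitivity (s1 * s2 * ((s3 * i3) * (s4 * i4))); [ring | rewrite e1 e2; ring].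
Qed.

Lemma odd_defect_iota u y : nilpair u y -> odd_defect u y * odd_defect u (ev_iota y) = 1.
Proof.
move=> uy; have yu := nilpairC uy; have yu1 := nilpair_iotar yu.
have uy2 := nilpair_iotar uy; have yu2 := nilpairC uy2; have yu3 := nilpair_iotar yu2.
have E1 := ev_strict_pair_iota uy; have E2 := ev_strict_pair_iota uy2.
rewrite ev_iotaK in E2; last exact: nilpairr uy.
rewrite /odd_defect (ev_strict_pair uy) (ev_strict_pair uy2) -E1 -E2.
move: (ev_strictV yu) (ev_strictV yu1) (ev_strictV yu2) (ev_strictV yu3).
move: (st y u) (st y (ev_iota u)) (sti y u) (sti y (ev_iota u)).
move: (st (ev_iota y) u) (st (ev_iota y) (ev_iota u)) (sti (ev_iota y) u) (sti (ev_iota y)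
    (ev_iota u)).
move=> s1 s2 i1 i2 s3 s4 i3 i4 e3 e4 e1 e2.
by transitivity ((s1 * i1) * (s2 * i2) * ((s3 * i3) * (s4 * i4)));
  [ring | rewrite e1 e2 e3 e4; ring].
Qed.

Section Zero.
Hypothesis M0 : (0 < M)%N.

Lemma ev_strict0r u : u ^+ M = 0 -> st u 0 = 1.
Proof. by move=> uM; rewrite ev_strict_iota ?mulr0 ?subr0 //; exact: nilpair0r. Qed.

Lemma ev_ratio0 u : u ^+ M = 0 -> B u 0 = ev u 0 A.
Proof.
move=> uM; have u0 := nilpair0r M0 uM.
by have := ev_strictV u0; rewrite ev_ratio // ev_strict0r // mul1r => ->; rewrite mulr1.
Qed.

Lemma odd_part0 u : u ^+ M = 0 -> odd_part u 0 = 1.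
Proof.
move=> uM; have u0 := nilpair0r M0 uM.
have [rho [c [AE _ _ [_ rho0 cE]]]] := hidden_values.
rewrite /odd_part !ev_ratio0 ?ev_iotaM // !AE //; last exact: nilpair_iotal.
rewrite mulrACA rho0 // mulr1; case: cE => cE; rewrite !cE.
  by rewrite !addr0 ev_iotaE.
by rewrite !mulr0 !subr0 mulr1.
Qed.

Lemma ev_ratio0_iota u : u ^+ M = 0 -> B u 0 * B (ev_iota u) 0 = 1.
Proof. exact: odd_part0. Qed.

Lemma ev_ratio00 : B 0 0 = 1.
Proof.
have z : 0 ^+ M = 0 :> R by rewrite expr0n gtn_eqF.
by rewrite ev_ratio0 // -{2}(ev_iota0 M0) ev_hidden_iota.
Qed.

Lemma odd_defect0 u : u ^+ M = 0 -> odd_defect u 0 = 1.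
Proof.
move=> uM; have z : 0 ^+ M = 0 :> R by rewrite expr0n gtn_eqF.
have u0 := nilpair0r M0 uM; have := odd_defect_rec u0.
by rewrite ev_iota0 // mul0r mulr0 subr0 mulr1.
Qed.

End Zero.

End Identities.

(** * The ring of difference operators *)

Section ShiftAction.
Variables (C : fieldType) (n : nat).

Definition lattice_fun := ('I_n -> int) -> C.
Implicit Types (F G : lattice_fun) (P Q : {mpoly C[n]}) (lam : 'I_n -> int) (m : 'X_{1..n}).

Definition translate m lam : 'I_n -> int := fun i => lam i + (m i)%:Z.

Definition shiftact P F : lattice_fun := fun lam =>
  \sum_(m <- msupp P) P@_m * F (translate m lam).

Definition diff i F : lattice_fun := fun lam => F (translate U_(i) lam) - F lam.

(** For polynomial functions this is the bound [k] on one plus the total degree, expressed by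
    iterated differences. *)
Fixpoint deg_lt k F : Prop :=
  if k is k'.+1 then forall i, deg_lt k' (diff i F) else forall lam, F lam = 0.

Lemma translate0 lam : translate 0%MM lam = lam.
Proof. by apply: functional_extensionality_dep => i; rewrite /translate mnm0E addr0. Qed.

Lemma translateD m1 m2 lam : translate m1 (translate m2 lam) = translate (m1 + m2)%MM lam.
Proof.
apply: functional_extensionality_dep => i.
by rewrite /translate mnmDE PoszD addrAC addrA.
Qed.

Lemma shiftactE P k F lam : (msize P <= k)%N ->
  shiftact P F lam = \sum_(m : 'X_{1..n < k}) P@_m * F (translate m lam).
Proof.
move=> le_pk; set I : subFinType _ := 'X_{1..n < k}.
rewrite /shiftact (big_mksub I) ?msupp_uniq //=; first last.
  by move=> x /msize_mdeg_lt /leq_trans; apply.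
rewrite big_rmcond //= => j /memN_msupp_eq0 ->.
by rewrite mul0r.
Qed.

Lemma shiftact_linear c P Q F lam :
  shiftact (c *: P + Q) F lam = c * shiftact P F lam + shiftact Q F lam.
Proof.
pose k := maxn (msize (c *: P + Q)) (maxn (msize P) (msize Q)).
rewrite !(@shiftactE _ k) /k ?leq_max ?leqnn ?orbT // mulr_sumr -big_split /=.
by apply: eq_bigr => m _; rewrite mcoeffD mcoeffZ mulrDl mulrA.
Qed.

Lemma shiftact0 F lam : shiftact 0 F lam = 0.
Proof. by rewrite /shiftact msupp0 big_nil. Qed.

Lemma shiftactX m F lam : shiftact 'X_[m] F lam = F (translate m lam).
Proof. by rewrite /shiftact msuppX big_seq1 mcoeffX eqxx mul1r. Qed.

Lemma shiftactD P Q F lam : shiftact (P + Q) F lam = shiftact P F lam + shiftact Q F lam.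
Proof. by rewrite -{1}[P]scale1r shiftact_linear mul1r. Qed.

Lemma shiftactZ c P F lam : shiftact (c *: P) F lam = c * shiftact P F lam.
Proof. by rewrite -{1}[c *: P]addr0 shiftact_linear shiftact0 addr0. Qed.

Lemma shiftact1 F lam : shiftact 1 F lam = F lam.
Proof. by rewrite -mpolyX0 shiftactX translate0. Qed.

Lemma shiftactN P F lam : shiftact (- P) F lam = - shiftact P F lam.
Proof. by rewrite -scaleN1r shiftactZ mulN1r. Qed.

Lemma shiftactM P Q F lam : shiftact (P * Q) F lam = shiftact P (shiftact Q F) lam.
Proof.
elim/mpolyind: P lam => [|c m P _ _ IHP] lam; first by rewrite mul0r !shiftact0.
rewrite mulrDl shiftactD IHP [RHS]shiftactD -scalerAl !shiftactZ; congr (_ * _ + _).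
rewrite shiftactX; elim/mpolyind: Q {P IHP} => [|d q Q _ _ IHQ].
  by rewrite mulr0 !shiftact0.
rewrite mulrDr !shiftactD IHQ -scalerAr !shiftactZ -mpolyXD !shiftactX.
by rewrite translateD addmC.
Qed.

Lemma shiftact_lin P F G c lam :
  shiftact P (fun l => c * F l + G l) lam = c * shiftact P F lam + shiftact P G lam.
Proof.
rewrite /shiftact mulr_sumr -big_split /=; apply: eq_bigr => m _.
by rewrite mulrDr mulrCA.
Qed.

Definition diffX (i : 'I_n) : {mpoly C[n]} := 'X_i - 1.

Lemma shiftact_diffX i F : shiftact (diffX i) F = diff i F.
Proof.
apply: functional_extensionality_dep => lam.
by rewrite shiftactD shiftactN shiftactX shiftact1.
Qed.

Lemma deg_lt0E F : deg_lt 0 F -> F = fun=> 0.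
Proof. by move=> F0; apply: functional_extensionality_dep. Qed.

Lemma deg_lt_zero k : deg_lt k (fun=> 0).
Proof.
elim: k => //= k IHk i; rewrite (_ : diff i _ = fun=> 0) //.
by apply: functional_extensionality_dep => lam; rewrite /diff subrr.
Qed.

Lemma deg_ltS k F : deg_lt k F -> deg_lt k.+1 F.
Proof.
elim: k F => [|k IHk] F Fk i; last exact/IHk/Fk.
by rewrite (deg_lt0E Fk); move=> lam; rewrite /diff subrr.
Qed.

Lemma deg_lt_le k l F : (k <= l)%N -> deg_lt k F -> deg_lt l F.
Proof. by move=> /subnK <-; elim: (_ - _)%N => // j IHj /IHj /deg_ltS. Qed.

Lemma deg_lt_lin k c F G : deg_lt k F -> deg_lt k G -> deg_lt k (fun l => c * F l + G l).
Proof.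
elim: k F G => /= [|k IHk] F G Fk Gk; first by move=> l; rewrite Fk Gk mulr0 addr0.
move=> i; rewrite (_ : diff i _ = fun l => c * diff i F l + diff i G l); first exact: IHk.
by apply: functional_extensionality_dep => lam; rewrite /diff; ring.
Qed.

Lemma deg_lt_diff k i F : deg_lt k F -> deg_lt k (diff i F).
Proof. by case: k => [|k] /= Fk; [move=> l; rewrite /diff !Fk subrr | exact/deg_ltS/Fk]. Qed.

Lemma deg_lt_translate k m F : deg_lt k F -> deg_lt k (fun l => F (translate m l)).
Proof.
elim: k F => /= [|k IHk] F Fk; first by move=> l; rewrite Fk.
move=> i; rewrite (_ : diff i _ = fun l => diff i F (translate m l)); first exact/IHk/Fk.
by apply: functional_extensionality_dep => lam; rewrite /diff !translateD addmC.
Qed.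

Lemma deg_lt_shiftact k P F : deg_lt k F -> deg_lt k (shiftact P F).
Proof.
move=> Fk; elim/mpolyind: P => [|c m P _ _ IHP].
  by rewrite (_ : shiftact _ _ = fun=> 0); [exact: deg_lt_zero
    | apply: functional_extensionality_dep => l; rewrite shiftact0].
rewrite (_ : shiftact _ _ = fun l => c * F (translate m l) + shiftact P F l).
  by apply: deg_lt_lin => //; apply: deg_lt_translate.
by apply: functional_extensionality_dep => l; rewrite shiftact_linear shiftactX.
Qed.

Variable N : nat.

(** Modulo this ideal the differences are nilpotent of exponent [N.+1], while the action on
    functions with [deg_lt N.+1] stays faithful. *)
Definition annihilates : {mpoly C[n]} -> bool :=
  fun P => `[< forall F, deg_lt N.+1 F -> forall lam, shiftact P F lam = 0 >].

Fact annihilates_ideal : idealr_closed annihilates.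
Proof.
split.
- by apply/asboolP => F _ lam; rewrite shiftact0.
(* The ideal is proper because nonzero constants have [deg_lt N.+1] whatever [N] is. *)
- apply/asboolP => ann1; have deg1 : deg_lt N.+1 (fun=> 1).
    move=> i; rewrite (_ : diff i _ = fun=> 0); first exact: deg_lt_zero.
    by apply: functional_extensionality_dep => lam; rewrite /diff subrr.
  by have /eqP := ann1 _ deg1 (fun=> 0); rewrite shiftact1 oner_eq0.
- move=> P Q1 Q2 /asboolP Q10 /asboolP Q20; apply/asboolP => F FN lam.
  rewrite shiftactD shiftactM Q20 // addr0.
  rewrite (_ : shiftact Q1 F = fun=> 0).
    by rewrite /shiftact big1 // => m _; rewrite mulr0.
  by apply: functional_extensionality_dep => l; rewrite Q10.
Qed.

HB.instance Definition _ := isIdealr.Build {mpoly C[n]} annihilates annihilates_ideal.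

Definition annihilator : idealr {mpoly C[n]} := annihilates.

Definition opring : comNzRingType := {ideal_quot annihilator}.

Definition op_of : {mpoly C[n]} -> opring := \pi_({ideal_quot annihilator})%qT.

HB.instance Definition _ := GRing.RMorphism.on op_of.

Definition opscal : {rmorphism C -> opring} := op_of \o @mpolyC n C.

(** Outside [deg_lt N.+1] the value depends on the chosen representative, hence the degree
    hypotheses of the algebraic laws below. *)
Definition opact (q : opring) F : lattice_fun := shiftact (repr (q : {ideal_quot annihilator})) F.

Definition opdiff (i : 'I_n) : opring := op_of (diffX i).

Implicit Types (q r : opring).

Lemma op_of_surj q : exists P, q = op_of P.
Proof. by exists (repr (q : {ideal_quot annihilator})); rewrite /op_of reprK. Qed.

Lemma opact_op P F : deg_lt N.+1 F -> opact (op_of P) F = shiftact P F.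
Proof.
move=> FN; apply: functional_extensionality_dep => lam.
rewrite /opact; set Q := repr _; apply/eqP; rewrite -subr_eq0 -shiftactN -shiftactD.
have /asboolP -> // : annihilates (Q - P).
by rewrite -[annihilates _]/(Q - P \in annihilator) Quotient.idealrBE reprK.
Qed.

Lemma opring_eq q r : (forall F, deg_lt N.+1 F -> opact q F = opact r F) -> q = r.
Proof.
have [[P ->] [Q ->]] := (op_of_surj q, op_of_surj r) => PQ.
apply/eqP; rewrite /op_of -Quotient.idealrBE; apply/asboolP => F FN lam.
by rewrite shiftactD shiftactN -!opact_op // PQ // subrr.
Qed.

Lemma deg_lt_opact k q F : deg_lt k F -> deg_lt k (opact q F).
Proof. exact: deg_lt_shiftact. Qed.

Lemma opact_lin q F G c : opact q (fun l => c * F l + G l) = fun l => c * opact q F l + opact q G l.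
Proof. by apply: functional_extensionality_dep => lam; apply: shiftact_lin. Qed.

Lemma opact_zero q : opact q (fun=> 0) = fun=> 0.
Proof.
apply: functional_extensionality_dep => lam.
by rewrite /opact /shiftact big1 // => m _; rewrite mulr0.
Qed.

Section Acting.
Variable F : lattice_fun.
Hypothesis FN : deg_lt N.+1 F.

Lemma opactM q r : opact (q * r) F = opact q (opact r F).
Proof.
have [[P ->] [Q ->]] := (op_of_surj q, op_of_surj r).
rewrite -rmorphM !opact_op //; last by rewrite -opact_op //; exact: deg_lt_opact.
by apply: functional_extensionality_dep => lam; rewrite shiftactM.
Qed.

Lemma opactD q r : opact (q + r) F = fun l => opact q F l + opact r F l.
Proof.
have [[P ->] [Q ->]] := (op_of_surj q, op_of_surj r).
rewrite -rmorphD !opact_op //.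
by apply: functional_extensionality_dep => lam; rewrite shiftactD.
Qed.

Lemma opact1 : opact 1 F = F.
Proof.
rewrite -(rmorph1 op_of) opact_op //.
by apply: functional_extensionality_dep => lam; rewrite shiftact1.
Qed.

Lemma opact0 : opact 0 F = fun=> 0.
Proof.
rewrite -(rmorph0 op_of) opact_op //.
by apply: functional_extensionality_dep => lam; rewrite shiftact0.
Qed.

Lemma opact_scal c : opact (opscal c) F = fun l => c * F l.
Proof.
rewrite -[opscal c]/(op_of c%:MP) opact_op //; apply: functional_extensionality_dep => lam.
by rewrite -[c%:MP]mulr1 mul_mpolyC shiftactZ shiftact1.
Qed.

Lemma opact_diff i : opact (opdiff i) F = diff i F.
Proof. by rewrite opact_op // shiftact_diffX. Qed.

End Acting.

Definition lowers q := forall k F, deg_lt k.+1 F -> (k <= N)%N -> deg_lt k (opact q F).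

Lemma lowers_diff i : lowers (opdiff i).
Proof. by move=> k F Fk kN; rewrite opact_diff; [exact: Fk | exact: deg_lt_le Fk]. Qed.

Lemma lowersX q a k F : lowers q -> deg_lt (a + k) F -> (a + k <= N.+1)%N ->
  deg_lt k (opact (q ^+ a) F).
Proof.
move=> lq; elim: a k => [|a IHa] k Fk akN.
  by rewrite expr0 opact1 //; exact: deg_lt_le Fk.
have FN : deg_lt N.+1 F by exact: deg_lt_le Fk.
rewrite exprS opactM //; apply: lq; last by move: akN; lia.
by apply: IHa; rewrite -addSnnS.
Qed.

(** Each of the [a + b] factors lowers the degree bound by one, so nothing is left of a function
    with [deg_lt N.+1]. *)
Lemma lowers_nil q r a b : lowers q -> lowers r -> (N.+1 <= a + b)%N -> q ^+ a * r ^+ b = 0.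
Proof.
move=> lq lr Nab; apply: opring_eq => F FN; rewrite opact0 // opactM //.
have [Nb|bN] := leqP N.+1 b.
  rewrite (@deg_lt0E (opact (r ^+ b) F)) ?opact_zero //.
  rewrite -(subnKC Nb) exprD mulrC opactM //.
  have : deg_lt 0 (opact (r ^+ N.+1) F) by apply: lowersX; rewrite ?addn0.
  by move/deg_lt0E => ->; rewrite opact_zero.
have : deg_lt (N.+1 - b) (opact (r ^+ b) F) by apply: lowersX; rewrite ?subnKC // ltnW.
move=> rF; apply: deg_lt0E.
have le_a : (N.+1 - b <= a)%N by rewrite leq_subLR addnC.
rewrite -(subnKC le_a) exprD mulrC opactM; last exact: deg_lt_opact.
rewrite (@deg_lt0E (opact (q ^+ (N.+1 - b)) _)) ?opact_zero; first exact: deg_lt_zero.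
by apply: lowersX; rewrite ?addn0 // leq_subr.
Qed.

End ShiftAction.

(** * Congruences in the operator ring *)

Section Divides.
Variable R : comNzRingType.
Implicit Types d x y : R.

Definition divides d x := exists w, x = d * w.

Lemma divides0 d : divides d 0.
Proof. by exists 0; rewrite mulr0. Qed.

Lemma dividesD d x y : divides d x -> divides d y -> divides d (x + y).
Proof. by move=> [w ->] [w' ->]; exists (w + w'); rewrite mulrDr. Qed.

Lemma dividesMl d c x : divides d x -> divides d (c * x).
Proof. by move=> [w ->]; exists (c * w); rewrite mulrCA. Qed.

Lemma dividesMr d c x : divides d x -> divides d (x * c).
Proof. by move=> [w ->]; exists (w * c); rewrite mulrA. Qed.

Lemma divides_sum d (I : Type) (s : seq I) (F : I -> R) :
  (forall i, divides d (F i)) -> divides d (\sum_(i <- s) F i).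
Proof. by move=> dF; elim/big_rec: _ => [|i x _]; [exact: divides0|exact: dividesD]. Qed.

Lemma divides_subM d x x' y y' :
  divides d (x - x') -> divides d (y - y') -> divides d (x * y - x' * y').
Proof.
move=> dx dy; have -> : x * y - x' * y' = (x - x') * y + x' * (y - y') by ring.
by apply: dividesD; [apply: dividesMr | apply: dividesMl].
Qed.

(** An evaluated series is a polynomial in its arguments. This licenses replacing $x_{p'}$ by
    $\iota(x_p)$, or a variable by 0, inside any series. *)
Lemma ev_divides (C : fieldType) (phi : {rmorphism C -> R}) M (u u' v v' d : R) (P : fps2 C) :
  divides d (u - u') -> divides d (v - v') ->
  divides d (ev phi M u v P - ev phi M u' v' P).
Proof.
move=> du dv; rewrite !evE -sumrB; apply: divides_sum => a; rewrite -sumrB.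
apply: divides_sum => b; rewrite -mulrBr; apply: dividesMl.
have dX x x' k : divides d (x - x') -> divides d (x ^+ k - x' ^+ k).
  by rewrite subrXX; apply: dividesMr.
by apply: divides_subM; apply: dX.
Qed.

End Divides.

(* What is used of the ring [opring]; keeping it abstract prevents the
   unifier from unfolding the quotient. *)
Record diff_algebra (C : fieldType) (n M : nat) := DiffAlgebra {
  dalg :> comNzRingType;
  dscal : {rmorphism C -> dalg};
  dact : dalg -> lattice_fun C n -> lattice_fun C n;
  dvar : 'I_n -> dalg;
  deg_lt_dact : forall k q F, deg_lt k F -> deg_lt k (dact q F);
  dact_lin : forall q F G c,
    dact q (fun l => c * F l + G l) = fun l => c * dact q F l + dact q G l;
  dactM : forall F q r, deg_lt M F -> dact (q * r) F = dact q (dact r F);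
  dactD : forall F q r, deg_lt M F -> dact (q + r) F = fun l => dact q F l + dact r F l;
  dact1 : forall F, deg_lt M F -> dact 1 F = F;
  dact_scal : forall F c, deg_lt M F -> dact (dscal c) F = fun l => c * F l;
  dact_var : forall F i, deg_lt M F -> dact (dvar i) F = diff i F;
  dvar_nil : forall i j a b, (M <= a + b)%N -> dvar i ^+ a * dvar j ^+ b = 0;
  dalg_pos : (0 < M)%N
}.

Definition diff_opring (C : fieldType) n N : diff_algebra C n N.+1 :=
  @DiffAlgebra C n N.+1 (opring C n N) (opscal C n N) (@opact C n N) (@opdiff C n N)
    (@deg_lt_opact C n N) (@opact_lin C n N) (fun F q r okF => opactM okF q r) (fun F q r okF =>
        opactD okF q r) (@opact1 C n N)
    (fun F c okF => opact_scal okF c) (fun F i okF => opact_diff okF i)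
    (fun i j a b => lowers_nil (@lowers_diff C n N i) (@lowers_diff C n N j)) isT.

(** * Symmetry and locality of operators *)

Section Lattice.
Variables (C : numFieldType) (n M : nat) (R : diff_algebra C n M).

Local Notation lattice_fun := (lattice_fun C n).
Local Notation phi := (dscal R).
Local Notation act := (@dact _ _ _ R).
Local Notation x := (@dvar _ _ _ R).
Local Notation ok := (deg_lt M).
Local Notation evR := (ev phi M).

Implicit Types (F G : lattice_fun) (q r : R) (lam : 'I_n -> int) (z : 'I_n).

(* Operators preserving a linear relation between functions; used for
   equality up to exchanging two variables and for vanishing on a diagonal. *)
Section Compatible.
Variable Rel : lattice_fun -> lattice_fun -> Prop.
Hypothesis Rel_lin : forall c F G F' G', Rel F G -> Rel F' G' ->
  Rel (fun l => c * F l + F' l) (fun l => c * G l + G' l).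
Hypothesis Rel0 : Rel (fun=> 0) (fun=> 0).

Definition compat q r := forall F G, ok F -> ok G -> Rel F G -> Rel (act q F) (act r G).

Lemma compat1 : compat 1 1.
Proof. by move=> F G okF okG FG; rewrite !dact1. Qed.

Lemma compatM q r q' r' : compat q r -> compat q' r' -> compat (q * q') (r * r').
Proof.
move=> qr qr' F G okF okG FG; rewrite !dactM //.
by apply: qr; [exact: deg_lt_dact | exact: deg_lt_dact | exact: qr'].
Qed.

Lemma compatD q r q' r' : compat q r -> compat q' r' -> compat (q + q') (r + r').
Proof.
move=> qr qr' F G okF okG FG; rewrite !dactD //.
have := Rel_lin 1 (qr F G okF okG FG) (qr' F G okF okG FG).
by congr Rel; apply: functional_extensionality_dep => l; rewrite mul1r.
Qed.

Lemma compat_scal c : compat (phi c) (phi c).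
Proof.
move=> F G okF okG FG; rewrite !dact_scal //; have := Rel_lin c FG Rel0.
by congr Rel; apply: functional_extensionality_dep => l; rewrite addr0.
Qed.

Lemma act0 F : ok F -> act 0 F = fun=> 0.
Proof.
move=> okF; rewrite -(rmorph0 phi) dact_scal //.
by apply: functional_extensionality_dep => l; rewrite mul0r.
Qed.

Lemma actN F q : ok F -> act (- q) F = fun l => - act q F l.
Proof.
move=> okF; have := dactD (- q) q okF; rewrite addNr act0 // => E.
apply: functional_extensionality_dep => l; apply/eqP; rewrite -addr_eq0.
by have /(congr1 (fun f => f l)) := E => <-.
Qed.

Lemma act_zero q : act q (fun=> 0) = fun=> 0.
Proof.
have := dact_lin q (fun=> 0) (fun=> 0) (-1).
rewrite (_ : (fun l => -1 * 0 + 0) = fun=> 0) => [->|].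
  by apply: functional_extensionality_dep => l; rewrite mulN1r addNr.
by apply: functional_extensionality_dep => l; rewrite mulr0 addr0.
Qed.

Lemma compat0 : compat 0 0.
Proof. by move=> F G okF okG FG; rewrite !act0. Qed.

Lemma compatN q r : compat q r -> compat (- q) (- r).
Proof.
move=> qr F G okF okG FG; rewrite !actN //.
have := Rel_lin (-1) (qr F G okF okG FG) Rel0.
by congr Rel; apply: functional_extensionality_dep => l; rewrite mulN1r addr0.
Qed.

Lemma compat_sum k (f g : 'I_k -> R) : (forall i, compat (f i) (g i)) ->
  compat (\sum_i f i) (\sum_i g i).
Proof. by move=> fg; elim/big_rec2: _ => [|i q r _]; [exact: compat0 | exact: compatD]. Qed.

Lemma compat_prod (I : eqType) (s : seq I) (f g : I -> R) :
  (forall i, i \in s -> compat (f i) (g i)) ->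
  compat (\prod_(i <- s) f i) (\prod_(i <- s) g i).
Proof.
move=> fg; rewrite big_seq [\prod_(i <- s) g i]big_seq.
by elim/big_rec2: _ => [|i q r si]; [exact: compat1 | apply: compatM; exact: fg].
Qed.

Lemma compatX k q r : compat q r -> compat (q ^+ k) (r ^+ k).
Proof. by move=> qr; elim: k => [|k IHk]; [exact: compat1 | rewrite !exprS; exact: compatM]. Qed.

Lemma compat_ev u u' v v' P : compat u u' -> compat v v' -> compat (evR u v P) (evR u' v' P).
Proof.
move=> uu' vv'; rewrite !evE; apply: compat_sum => a; apply: compat_sum => b.
by apply: compatM; [exact: compat_scal | apply: compatM; apply: compatX].
Qed.

End Compatible.

Definition exchange z z' F : lattice_fun := fun lam => F (fun i => lam (tperm z z' i)).

Definition vanishing z z' F := forall lam, lam z = lam z' -> F lam = 0.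

(** Acting by the first operator and then exchanging equals exchanging and then acting by the
    second; with both equal, the operator is symmetric in [z] and [z']. *)
Definition swaps z z' := compat (fun F G => exchange z z' F = G).

(** The operator preserves vanishing on the diagonal; the second function of [compat] is a dummy. *)
Definition local z z' q := compat (fun F _ => vanishing z z' F) q q.

Section Exchange.
Variables z z' : 'I_n.

Lemma exchange_lin c F G F' G' :
  exchange z z' F = G -> exchange z z' F' = G' ->
  exchange z z' (fun l => c * F l + F' l) = (fun l => c * G l + G' l).
Proof. by move=> <- <-. Qed.

Lemma vanishing_lin c F (G : lattice_fun) F' (G' : lattice_fun) :
  vanishing z z' F -> vanishing z z' F' ->
  vanishing z z' (fun l => c * F l + F' l).
Proof. by move=> vF vF' lam zz'; rewrite vF // vF' // mulr0 addr0. Qed.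

Lemma exchange_zero : exchange z z' (fun=> 0) = (fun=> 0).
Proof. by []. Qed.

Lemma vanishing_zero : vanishing z z' (fun=> 0).
Proof. by []. Qed.

Definition swaps1 : swaps z z' 1 1 := @compat1 _.
Definition swapsM q r q' r' : swaps z z' q r -> swaps z z' q' r' -> swaps z z' (q * q') (r * r') :=
  @compatM _ q r q' r'.
Definition swapsN q r := @compatN _ exchange_lin exchange_zero q r.
Definition swapsD q r q' r' := @compatD _ exchange_lin q r q' r'.
Definition swaps_ev u u' v v' P := @compat_ev _ exchange_lin exchange_zero u u' v v' P.

Definition local1 : local z z' 1 := @compat1 _.
Definition localM q r : local z z' q -> local z z' r -> local z z' (q * r) := @compatM _ q q r r.
Definition localN q := @compatN _ vanishing_lin vanishing_zero q q.
Definition localD q r := @compatD _ vanishing_lin q q r r.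
Definition local_ev u v P := @compat_ev _ vanishing_lin vanishing_zero u u v v P.

Lemma translate_tperm i (lam : 'I_n -> int) :
  (fun j => translate U_(tperm z z' i) lam (tperm z z' j)) =
  translate U_(i) (fun j => lam (tperm z z' j)).
Proof.
apply: functional_extensionality_dep => j; rewrite /translate !mnm1E.
by rewrite (inj_eq perm_inj).
Qed.

Lemma swaps_diff i : swaps z z' (x i) (x (tperm z z' i)).
Proof.
move=> F G okF okG FG; rewrite !dact_var // -FG.
apply: functional_extensionality_dep => lam; rewrite /exchange /diff.
by rewrite translate_tperm.
Qed.

Lemma local_diff i : i != z -> i != z' -> local z z' (x i).
Proof.
move=> iz iz' F _ okF _ vF; rewrite dact_var // => lam zz'.
by rewrite /diff !vF ?subrr // /translate !mnm1E (negPf iz) (negPf iz') !addr0.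
Qed.

End Exchange.
End Lattice.

(** * Contracted pairs of variables *)

Section Tensor.
Variables (C : numFieldType) (n M : nat) (R : diff_algebra C n M).

Local Notation lattice_fun := (lattice_fun C n).
Local Notation phi := (dscal R).
Local Notation act := (@dact _ _ _ R).
Local Notation x := (@dvar _ _ _ R).
Local Notation ok := (deg_lt M).
Local Notation evR := (ev phi M).

Implicit Types (F G g : lattice_fun) (q r : R) (lam : 'I_n -> int) (z : 'I_n) (I J : seq 'I_n).

Definition setvar z (c : int) lam : 'I_n -> int := fun i => if i == z then c else lam i.

Definition indep z g := forall c lam, g (setvar z c lam) = g lam.

Lemma setvar_translate z c lam : translate U_(z) (setvar z c lam) = setvar z (c + 1) lam.
Proof.
apply: functional_extensionality_dep => i; rewrite /translate /setvar mnm1E eq_sym.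
by case: eqVneq => //= _; rewrite addr0.
Qed.

Lemma setvar_id z lam : setvar z (lam z) lam = lam.
Proof.
by apply: functional_extensionality_dep => i; rewrite /setvar; case: eqP => // ->.
Qed.

Lemma indep_translate z g lam : indep z g -> g (translate U_(z) lam) = g lam.
Proof. by move=> gz; rewrite -{1}(setvar_id z lam) setvar_translate gz. Qed.

Lemma diff_indep z g : indep z g -> diff z g = fun=> 0.
Proof.
move=> gz; apply: functional_extensionality_dep => lam.
by rewrite /diff indep_translate // subrr.
Qed.

Lemma indep_exchange z z' g : indep z g -> indep z' g -> exchange z z' g = g.
Proof.
move=> gz gz'; apply: functional_extensionality_dep => lam; rewrite /exchange.
rewrite -(gz (lam z')) -(gz' (lam z)) -[RHS](gz (lam z')) -[RHS](gz' (lam z)).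
congr g; apply: functional_extensionality_dep => i; rewrite /setvar.
by case: eqVneq => // iz'; case: eqVneq => // iz; rewrite tpermD // eq_sym.
Qed.

(** On [Omega] the function is constant in the variable [z], which can be moved to the value of
    [z']. [Omega] leaves room for working on the diagonal of another pair. *)
Lemma vanish_step (Omega : ('I_n -> int) -> Prop) z z' F :
  z != z' -> (forall c lam, Omega lam -> Omega (setvar z c lam)) ->
  (forall lam, Omega lam -> diff z F lam = 0) ->
  (forall lam, Omega lam -> lam z = lam z' -> F lam = 0) ->
  forall lam, Omega lam -> F lam = 0.
Proof.
move=> zz' Om dF F0 lam Olam.
have step c : F (setvar z (c + 1) lam) = F (setvar z c lam).
  by have /eqP := dF _ (Om c _ Olam); rewrite /diff setvar_translate subr_eq0 => /eqP.
have const c : F (setvar z c lam) = F (setvar z 0 lam).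
  elim/int_rect: c => // k IHk; first by rewrite -addn1 PoszD step.
  by rewrite -IHk -addn1 PoszD opprD -[in RHS](subrK 1 (- k%:Z)) step.
rewrite -(setvar_id z lam) const -(const (lam z')); apply: F0; first exact: Om.
by rewrite /setvar eqxx eq_sym (negPf zz').
Qed.

Definition coords I lam : seq int := [seq lam i | i <- I].

Definition tensor g h I : lattice_fun := fun lam => g lam * GTfun C h (coords I lam).

Lemma tensorE g h I lam : tensor g h I lam = g lam * GTfun C h (coords I lam).
Proof. by []. Qed.

Lemma coords_setvar z c I lam : z \notin I -> coords I (setvar z c lam) = coords I lam.
Proof.
move=> zI; apply/eq_in_map => i iI; rewrite /setvar; case: eqP => // ei.
by rewrite -ei iI in zI.
Qed.

Lemma tensor_indep z g h I : indep z g -> z \notin I -> indep z (tensor g h I).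
Proof. by move=> gz zI c lam; rewrite /tensor gz coords_setvar. Qed.

(** The sign follows the convention of [Dp]. *)
Definition prefix_diff J : R := \prod_(l <- J) - x l.

Lemma prefix_diffE J : prefix_diff J = \prod_(l <- J) - x l.
Proof. by []. Qed.

(** Intermediate stage: the variables of [J] are already differenced, those of [I] not yet. *)
Let mixed g h J I : lattice_fun := fun lam =>
  g lam * pf (pairing C h) ([seq Dp (lam i) | i <- J] ++ [seq Pt (lam i) | i <- I] ++
    rows h (size J + size I)).

Let mixed_diff g h J z I : ok (mixed g h J (z :: I)) -> uniq (J ++ z :: I) -> indep z g ->
  act (- x z) (mixed g h J (z :: I)) = mixed g h (rcons J z) I.
Proof.
move=> okm; rewrite cat_uniq /= negb_or.
move=> /and4P[_ /andP[zJ _] zI _] gz.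
rewrite actN // dact_var //; apply: functional_extensionality_dep => lam.
rewrite /diff /mixed indep_translate // -mulrBr -mulrN; congr (_ * _).
have tr i : i != z -> translate U_(z) lam i = lam i.
  by move=> iz; rewrite /translate mnm1E eq_sym (negPf iz) addr0.
have -> : [seq Dp (translate U_(z) lam i) | i <- J] = [seq Dp (lam i) | i <- J].
  by apply/eq_in_map => i iJ; rewrite tr //; apply: contraNneq zJ => <-.
rewrite [map _ (z :: I)]/= [map _ (z :: I)]/=.
have -> : [seq Pt (translate U_(z) lam i) | i <- I] = [seq Pt (lam i) | i <- I].
  by apply/eq_in_map => i iI; rewrite tr //; apply: contraNneq zI => <-.
rewrite /translate mnm1E eqxx map_rcons cat_rcons size_rcons /= addnS.
by rewrite (pf_multilinear _ _ (pairing_Dp C h (lam z))); ring.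
Qed.

Lemma tensor_prefix_diff g h I z : uniq (rcons I z) ->
  (forall l, l \in I -> indep l g) -> ok (tensor g h.+1 (rcons I z)) ->
  act (prefix_diff I) (tensor g h.+1 (rcons I z)) = tensor g h I.
Proof.
move=> uI gI okT.
have main J J' : I = J ++ J' ->
    act (prefix_diff J) (tensor g h.+1 (rcons I z)) = mixed g h.+1 J (rcons J' z).
  elim/last_ind: J J' => [|J l IHJ] J' EI.
    rewrite /prefix_diff big_nil dact1 // /tensor /mixed EI /=.
    apply: functional_extensionality_dep => lam.
    by rewrite /GTfun /coords -map_comp size_map.
  rewrite /prefix_diff -cats1 big_cat big_seq1 /= mulrC dactM // -/(prefix_diff J).
  have EI' : I = J ++ l :: J' by rewrite EI -cats1 -catA.
  have okJ : ok (mixed g h.+1 J (rcons (l :: J') z)).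
    by rewrite -(IHJ (l :: J')) //; apply: deg_lt_dact.
  rewrite (IHJ (l :: J')) // rcons_cons mixed_diff ?cats1 //.
    by rewrite -rcons_cons -rcons_cat -EI'.
  by apply: gI; rewrite EI' mem_cat mem_head orbT.
rewrite (main I [::]) ?cats0 //; apply: functional_extensionality_dep => lam.
rewrite /mixed /tensor /= addn1; congr (_ * _).
have := GTfun_diff C h (coords I lam) (lam z).
by rewrite /coords -map_comp size_map.
Qed.

Lemma coords_cat I J lam : coords (I ++ J) lam = coords I lam ++ coords J lam.
Proof. exact: map_cat. Qed.

Definition evendiff h z z' : lattice_fun := fun lam => evenker h (lam z' - lam z)%:~R.

Lemma tensor_exchange g h I z z' J lam : uniq (I ++ z :: z' :: J) ->
  indep z g -> indep z' g ->
  tensor g h (I ++ z :: z' :: J) lam + exchange z z' (tensor g h (I ++ z :: z' :: J)) lam =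
  2 * (evendiff h z z' lam * tensor g h (I ++ J) lam).
Proof.
move=> uI gz gz'; rewrite /exchange.
have fixc K : z \notin K -> z' \notin K -> coords K (fun i => lam (tperm z z' i)) = coords K lam.
  move=> zK z'K; apply/eq_in_map => i iK; rewrite tpermD //.
    by apply: contraNneq zK => ->.
  by apply: contraNneq z'K => ->.
move: uI; rewrite cat_uniq /= ?inE !negb_or.
move=> /and5P[_ /and3P[zI z'I _] /andP[zz' zJ] z'J _].
have := GTfun_swap C h (coords I lam) (lam z) (lam z') (coords J lam).
rewrite /tensor /evendiff !coords_cat /= -/(coords J _) !fixc // tpermL tpermR.
have -> : g (fun i => lam (tperm z z' i)) = g lam.
  by rewrite -[LHS]/(exchange z z' g lam) indep_exchange.
by rewrite -mulrDr => ->; ring.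
Qed.

Lemma evendiff0 h z z' : vanishing z z' (evendiff h.+1 z z').
Proof. by move=> lam zz'; rewrite /evendiff zz' subrr evenkerS0. Qed.

Lemma deg_lt_exchange k z z' F : deg_lt k F -> deg_lt k (exchange z z' F).
Proof.
elim: k F => /= [|k IHk] F Fk; first by move=> lam; rewrite /exchange Fk.
move=> i; rewrite (_ : diff i _ = exchange z z' (diff (tperm z z' i) F)); first exact/IHk/Fk.
apply: functional_extensionality_dep => lam.
by rewrite /exchange /diff -translate_tperm tpermK.
Qed.

Section Contraction.
Variables (g : lattice_fun) (h : nat) (I J : seq 'I_n) (z z' : 'I_n).
Hypotheses (uI : uniq (I ++ z :: z' :: J)) (gz : indep z g) (gz' : indep z' g).

Let F := tensor g h (I ++ z :: z' :: J).
Hypothesis okF : ok F.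

(** By the swap relation of the Pfaffian, this is the average of [F] and its exchange. *)
Definition contracted : lattice_fun := fun lam => evendiff h z z' lam * tensor g h (I ++ J) lam.
Local Notation H := contracted.

Lemma contractedE : H = fun l => 2^-1 * F l + (2^-1 * exchange z z' F l + 0).
Proof.
apply: functional_extensionality_dep => lam; rewrite addr0 -mulrDr.
by rewrite tensor_exchange // [RHS]mulrA mulVf ?mul1r // pnatr_eq0.
Qed.

Lemma ok_contracted : ok H.
Proof.
rewrite contractedE; apply: deg_lt_lin => //; apply: deg_lt_lin; last exact: deg_lt_zero.
exact: deg_lt_exchange.
Qed.

(** On the diagonal a symmetric operator gives the same value on [F] and on its exchange, hence on
    their average. *)
Lemma act_diagonal q lam : swaps z z' q q -> lam z = lam z' -> act q F lam = act q H lam.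
Proof.
move=> qq zz'; have okE := deg_lt_exchange z z' okF.
have E := qq F _ okF okE erefl.
have {E} : act q (exchange z z' F) lam = act q F lam.
  rewrite -E /exchange; congr (act q F _).
  apply: functional_extensionality_dep => i.
  by case: tpermP => // ->; rewrite zz'.
rewrite contractedE !dact_lin act_zero addr0 => ->.
by field.
Qed.

(** The divisor is the simultaneous shift of [z] and [z'] minus the identity, and [H] depends on
    these two variables only through their difference. *)
Lemma act_contracted q : divides ((1 + x z) * (1 + x z') - 1) q -> act q H = fun=> 0.
Proof.
move=> [w ->]; have okH := ok_contracted.
have zero : act ((1 + x z) * (1 + x z') - 1) H = fun=> 0.
  have actX i G : ok G -> act (1 + x i) G = fun l => G (translate U_(i) l).
    move=> okG; rewrite dactD // dact1 // dact_var //.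
    by apply: functional_extensionality_dep => l; rewrite /diff addrC subrK.
  rewrite dactD // actN // dact1 // dactM // !actX //; last by apply: deg_lt_translate.
  move: uI; rewrite cat_uniq /= ?inE !negb_or.
  move=> /and5P[_ /and3P[zI z'I _] /andP[zz' zJ] z'J _].
  apply: functional_extensionality_dep => lam; rewrite /H /contracted.
  have tz : indep z (tensor g h (I ++ J)).
    by apply: tensor_indep => //; rewrite mem_cat negb_or zI.
  have tz' : indep z' (tensor g h (I ++ J)).
    by apply: tensor_indep => //; rewrite mem_cat negb_or z'I.
  rewrite (indep_translate _ tz') (indep_translate _ tz).
  rewrite /evendiff /translate !mnm1E !eqxx [z' == z]eq_sym (negPf zz') /=.
  set a := lam z'; set b := lam z.
  have -> : a + 0%:Z + 1%:Z - (b + 1%:Z + 0%:Z) = a - b by ring.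
  by rewrite subrr.
by rewrite mulrC dactM // zero act_zero.
Qed.

End Contraction.

(** The engine of the vanishing proofs. By [vanish_step] it suffices to look at the diagonal of [z],
    [z']. There [F] may be replaced by its contraction and then [q] by [q1]; the contraction
    contains the even kernel of index [h.+1], zero on the diagonal, and [q1] preserves this. *)
Lemma contraction_step (Omega : ('I_n -> int) -> Prop) g h I z z' J q q1 :
  uniq (I ++ z :: z' :: J) -> indep z g -> indep z' g ->
  ok (tensor g h.+1 (I ++ z :: z' :: J)) ->
  (forall c lam, Omega lam -> Omega (setvar z c lam)) ->
  swaps z z' q q -> local z z' q1 ->
  divides ((1 + x z) * (1 + x z') - 1) (q - q1) ->
  (forall lam, Omega lam -> act (x z * q) (tensor g h.+1 (I ++ z :: z' :: J)) lam = 0) ->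
  forall lam, Omega lam -> act q (tensor g h.+1 (I ++ z :: z' :: J)) lam = 0.
Proof.
move=> uI gz gz' okF Om qq q1loc qq1 zF.
have zz' : z != z'.
  by move: uI; rewrite cat_uniq /= ?inE !negb_or => /and5P[_ _ /andP[-> _]].
apply: (vanish_step zz' Om) => lam Olam.
  by rewrite -(dact_var R z (deg_lt_dact q okF)) -dactM // zF.
move=> lzz'; rewrite act_diagonal // -(subrK q1 q).
have okH := ok_contracted uI gz gz' okF.
rewrite dactD // (act_contracted uI gz gz' okF qq1) add0r.
apply: (q1loc _ _ okH okH) => // mu mu0.
by rewrite /contracted evendiff0 // mul0r.
Qed.

(** Abstract form of $e(0)=1$ and $e(y)e(\iota(y))=1$: the second becomes a congruence modulo the
    simultaneous shift of two variables. The other clauses say that [e] treats the variables alike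
    and that [e l] involves no other variable of [I]. *)
Definition odd_family I (e : 'I_n -> R) :=
  [/\ forall l, l \in I -> divides (x l) (e l - 1),
      forall z z', z \in I -> z' \in I -> z != z' ->
        divides ((1 + x z) * (1 + x z') - 1) (e z * e z' - 1),
      forall z z' l, z \in I -> z' \in I -> l \in I ->
        swaps z z' (e l) (e (tperm z z' l)) &
      forall z z' l, z \in I -> z' \in I -> l \in I -> l != z -> l != z' ->
        local z z' (e l)].

Section OddFamily.
Variables (I0 : seq 'I_n) (e : 'I_n -> R).
Hypothesis oe : odd_family I0 e.

Definition oprod (J : seq 'I_n) : R := \prod_(l <- J) e l.

Lemma oprodE J : oprod J = \prod_(l <- J) e l.
Proof. by []. Qed.

Lemma oprod_cat J K : oprod (J ++ K) = oprod J * oprod K.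
Proof. by rewrite /oprod big_cat. Qed.

Lemma oprod_cons z J : oprod (z :: J) = e z * oprod J.
Proof. by rewrite /oprod big_cons. Qed.

Lemma local_oprod z z' J : {subset z :: z' :: J <= I0} -> z \notin J -> z' \notin J ->
  local z z' (oprod J).
Proof.
case: oe => _ _ _ e3 sub zJ z'J.
apply: compat_prod => i iJ; apply: e3; try by apply: sub; rewrite !inE ?eqxx ?iJ ?orbT.
  by apply: contraNneq zJ => <-.
by apply: contraNneq z'J => <-.
Qed.

Lemma swaps_oprod z z' J : {subset z :: z' :: J <= I0} -> z \notin J -> z' \notin J ->
  swaps z z' (oprod J) (oprod J).
Proof.
case: oe => _ _ e2 _ sub zJ z'J; apply: compat_prod => i iJ.
have <- : tperm z z' i = i.
  by rewrite tpermD //; [apply: contraNneq zJ => -> | apply: contraNneq z'J => ->].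
by rewrite {1}tpermD; [|apply: contraNneq zJ => ->|apply: contraNneq z'J => ->] => //;
  apply: e2; apply: sub; rewrite !inE ?eqxx ?iJ ?orbT.
Qed.

Lemma swaps_pair z z' : z \in I0 -> z' \in I0 -> swaps z z' (e z * e z') (e z * e z').
Proof.
case: oe => _ _ e2 _ zI z'I; rewrite {2}[e z * _]mulrC; apply: swapsM.
  by have := e2 z z' z zI z'I zI; rewrite tpermL.
by have := e2 z z' z' zI z'I z'I; rewrite tpermR.
Qed.

Lemma act_oprod_indep J F : ok F -> {subset J <= I0} -> (forall l, l \in J -> act (x l) F =
    fun=> 0) ->
  act (oprod J) F = F.
Proof.
case: oe => e0 _ _ _ okF; elim: J => [|l J IHJ] sub xF.
  by rewrite /oprod big_nil dact1.
rewrite oprod_cons dactM // IHJ; last first.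
- by move=> k kJ; apply: xF; rewrite inE kJ orbT.
- by move=> k kJ; apply: sub; rewrite inE kJ orbT.
have [w ew] := e0 l (sub _ (mem_head _ _)).
rewrite -(subrK 1 (e l)) ew dactD // dact1 // mulrC dactM // xF ?mem_head //.
by rewrite act_zero; apply: functional_extensionality_dep => lam; rewrite add0r.
Qed.

End OddFamily.

End Tensor.

(** * Odd families act trivially *)

Section Vanishing.
Variables (C : numFieldType) (n M : nat) (R : diff_algebra C n M).

Local Notation lattice_fun := (lattice_fun C n).
Local Notation phi := (dscal R).
Local Notation act := (@dact _ _ _ R).
Local Notation x := (@dvar _ _ _ R).
Local Notation ok := (deg_lt M).
Local Notation evR := (ev phi M).
Local Notation prefix_diff := (@prefix_diff C n M R).
Local Notation tensor := (@tensor C n).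

Implicit Types (F G g : lattice_fun) (q r : R) (lam : 'I_n -> int) (z : 'I_n) (I J : seq 'I_n).

Lemma prefix_diff_cat I J : prefix_diff (I ++ J) = prefix_diff I * prefix_diff J.
Proof. by rewrite !prefix_diffE big_cat. Qed.

Lemma prefix_diff1 z : prefix_diff [:: z] = - x z.
Proof. by rewrite !prefix_diffE big_seq1. Qed.

Lemma prefix_diff0 : prefix_diff [::] = 1.
Proof. by rewrite !prefix_diffE big_nil. Qed.

Lemma swaps_prefix_diff z z' J : z \notin J -> z' \notin J ->
  swaps z z' (prefix_diff J) (prefix_diff J).
Proof.
move=> zJ z'J; apply: compat_prod => i iJ; apply: swapsN.
have := @swaps_diff C n M R z z' i; rewrite tpermD //.
  by apply: contraNneq zJ => ->.
by apply: contraNneq z'J => ->.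
Qed.

Lemma local_prefix_diff z z' J : z \notin J -> z' \notin J -> local z z' (prefix_diff J).
Proof.
move=> zJ z'J; apply: compat_prod => i iJ; apply: localN; apply: local_diff.
  by apply: contraNneq zJ => <-.
by apply: contraNneq z'J => <-.
Qed.

Lemma act_var_indep z F : ok F -> indep z F -> act (x z) F = fun=> 0.
Proof. by move=> okF zF; rewrite dact_var // diff_indep. Qed.

(** Once all variables but the last are differenced, the last one no longer occurs. *)
Lemma prefix_diff_full g h I : uniq I -> (forall l, l \in I -> indep l g) ->
  ok (tensor g h.+1 I) -> act (prefix_diff I) (tensor g h.+1 I) = fun=> 0.
Proof.
case/lastP: I => [|I z] uI gI okF.
  rewrite prefix_diff0 dact1 //; apply: functional_extensionality_dep => lam.
  by rewrite !tensorE /= GTfun_nil mulr0.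
have gI' l : l \in I -> indep l g.
  by move=> lI; apply: gI; rewrite mem_rcons inE lI orbT.
have E := tensor_prefix_diff R uI gI' okF.
have okE : ok (tensor g h I) by rewrite -E; apply: deg_lt_dact.
rewrite -cats1 prefix_diff_cat prefix_diff1 mulrC dactM ?cats1 // E actN //.
rewrite act_var_indep //; first by apply: functional_extensionality_dep => l; rewrite oppr0.
apply: tensor_indep; first by apply: gI; rewrite mem_rcons mem_head.
by move: uI; rewrite rcons_uniq => /andP[].
Qed.

Lemma uniq_middle I z z' J : uniq (I ++ z :: z' :: J) ->
  [/\ [/\ z \notin I, z' \notin I, z \notin J & z' \notin J], z != z' &
      uniq (I ++ J)].
Proof.
rewrite !cat_uniq /= ?inE !negb_or.
move=> /and5P[uI /and3P[zI z'I hJ] /andP[zz' zJ] z'J uJ].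
by split; [split | | rewrite uI hJ].
Qed.

Section OddTrivial.
Variables (I0 : seq 'I_n) (e : 'I_n -> R).
Hypothesis oe : odd_family I0 e.

(** Induction on [h], then downwards on the length of the differenced prefix [I1]. The full prefix
    kills everything; the prefix lacking one variable leads to [h]; a shorter one follows by
    contracting the next two variables, whose factors cancel modulo their simultaneous shift. *)
Theorem odd_family_trivial g h I : uniq I -> {subset I <= I0} ->
  (forall l, l \in I -> indep l g) -> ok (tensor g h I) ->
  act (oprod e I) (tensor g h I) = tensor g h I.
Proof.
elim: h I => [|h IHh] I uI sub gI okF.
  apply: (act_oprod_indep oe) => // l lI; rewrite act_var_indep //.
  move=> c lam; rewrite !tensorE !GTfun0; congr (_ * _); exact: gI.
set F := tensor g h.+1 I in okF *.
suff main I2 I1 : I = I1 ++ I2 -> act ((oprod e I - 1) * prefix_diff I1) F = fun=> 0.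
  have := main I [::] erefl; rewrite prefix_diff0 mulr1 dactD // actN // dact1 // => E.
  apply: functional_extensionality_dep => lam; apply/eqP; rewrite -subr_eq0.
  by have /(congr1 (fun f => f lam)) := E => /= ->.
elim: I2 I1 => [|z [|z' I3] IH] I1 EI.
- rewrite cats0 in EI; rewrite dactM // -EI prefix_diff_full ?act_zero //.
- have uz : uniq (rcons I1 z) by rewrite -cats1 -EI.
  have EF : act (prefix_diff I1) F = tensor g h I1.
    rewrite /F EI cats1; apply: tensor_prefix_diff => //.
      by move=> l lI; apply: gI; rewrite EI mem_cat lI.
    by rewrite -cats1 -EI.
  have ok1 : ok (tensor g h I1) by rewrite -EF; apply: deg_lt_dact.
  have [uz1 uI1] : z \notin I1 /\ uniq I1 by move: uz; rewrite rcons_uniq => /andP.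
  rewrite dactM // EF dactD // actN // dact1 // EI oprod_cat mulrC dactM // IHh //.
  + rewrite (act_oprod_indep oe) //.
    * by apply: functional_extensionality_dep => lam; rewrite subrr.
    * by move=> k kz; apply: sub; rewrite EI mem_cat kz orbT.
    * move=> l; rewrite inE => /eqP ->; apply: act_var_indep => //.
      by apply: tensor_indep => //; apply: gI; rewrite EI mem_cat mem_head orbT.
  + by move=> l lI; apply: sub; rewrite EI mem_cat lI.
  + by move=> l lI; apply: gI; rewrite EI mem_cat lI.
- apply: functional_extensionality_dep => lam.
  have uI' : uniq (I1 ++ z :: z' :: I3) by rewrite -EI.
  have [[zI1 z'I1 zI3 z'I3] zz' u13] := uniq_middle uI'.
  have zI : z \in I by rewrite EI mem_cat mem_head orbT.
  have z'I : z' \in I by rewrite EI mem_cat !inE eqxx !orbT.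
  have s13 : {subset z :: z' :: I1 ++ I3 <= I0}.
    move=> k; rewrite !inE mem_cat => /or3P[/eqP->|/eqP->|/orP[]kI]; apply: sub => //;
    by rewrite EI mem_cat !inE kI ?orbT.
  have zI13 : z \notin I1 ++ I3 by rewrite mem_cat negb_or zI1.
  have z'I13 : z' \notin I1 ++ I3 by rewrite mem_cat negb_or z'I1.
  have EO : oprod e I = e z * e z' * oprod e (I1 ++ I3).
    by rewrite EI !oprod_cat !oprod_cons; ring.
  rewrite /F EI; apply: (@contraction_step _ _ _ R (fun=> True) _ _ _ _ _ _ _
      ((oprod e (I1 ++ I3) - 1) * prefix_diff I1)) => //.
  + exact: gI.
  + exact: gI.
  + by rewrite -EI.
  + rewrite -EI EO; apply: swapsM; last exact: swaps_prefix_diff.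
    apply: swapsD; last by apply: swapsN; apply: swaps1.
    apply: swapsM; first by apply: (swaps_pair oe); apply: sub.
    exact: (swaps_oprod oe).
  + apply: localM; last exact: local_prefix_diff.
    apply: localD; last by apply: localN; apply: local1.
    exact: (local_oprod oe).
  + rewrite -EI EO.
    have -> : (e z * e z' * oprod e (I1 ++ I3) - 1) * prefix_diff I1 -
       (oprod e (I1 ++ I3) - 1) * prefix_diff I1 =
       (e z * e z' - 1) * (oprod e (I1 ++ I3) * prefix_diff I1) by ring.
    apply: dividesMr; case: oe => _ e1 _ _; apply: e1 => //; exact: sub.
  + move=> mu _; rewrite -EI.
    have := IH (I1 ++ [:: z]); rewrite -catA => /(_ EI).
    rewrite prefix_diff_cat prefix_diff1.
    have -> : (oprod e I - 1) * (prefix_diff I1 * - x z) =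
      - (x z * ((oprod e I - 1) * prefix_diff I1)) by ring.
    rewrite actN // => /(congr1 (fun f => - f mu)) /=.
    by rewrite opprK oppr0.
Qed.

End OddTrivial.
End Vanishing.

(** * Defects and the lowering of the even kernel *)

Section Defect.
Variables (C : numFieldType) (n M : nat) (R : diff_algebra C n M).

Local Notation lattice_fun := (lattice_fun C n).
Local Notation phi := (dscal R).
Local Notation act := (@dact _ _ _ R).
Local Notation x := (@dvar _ _ _ R).
Local Notation ok := (deg_lt M).
Local Notation evR := (ev phi M).
Local Notation iotaR := (ev_iota phi M).
Local Notation prefix_diff := (@prefix_diff C n M R).
Local Notation tensor := (@tensor C n).

Implicit Types (F G g : lattice_fun) (q r : R) (lam : 'I_n -> int) (z : 'I_n) (I J : seq 'I_n).

Let M0 : (0 < M)%N := dalg_pos R.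

Lemma nilpair_var i j : nilpair M (x i) (x j).
Proof. by move=> a b; apply: dvar_nil. Qed.

Lemma var_nil i : x i ^+ M = 0.
Proof. exact: nilpairl (nilpair_var i i). Qed.

(** On functions of [lam j - lam i], the operator [x j] thus acts as $\iota(x_i)$. *)
Lemma divides_iota i j : divides ((1 + x i) * (1 + x j) - 1) (x j - iotaR (x i)).
Proof.
exists (1 + iotaR (x i)); rewrite mulrBl mul1r mulrAC (ev_iotaE phi (var_nil i)) mul1r.
by ring.
Qed.

Lemma swaps_iota z z' u u' : swaps z z' u u' -> swaps z z' (iotaR u) (iotaR u').
Proof. by move=> uu'; apply: swaps_ev. Qed.

Lemma local_iota z z' u : local z z' u -> local z z' (iotaR u).
Proof. by move=> uu'; apply: local_ev. Qed.

Lemma odd_familyP I0 (f : R -> R) :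
  f 0 = 1 ->
  (forall y y' d, divides d (y - y') -> divides d (f y - f y')) ->
  (forall l, f (x l) * f (iotaR (x l)) = 1) ->
  (forall z z' y y', z \in I0 -> z' \in I0 -> swaps z z' y y' -> swaps z z' (f y) (f y')) ->
  (forall z z' y, z \in I0 -> z' \in I0 -> local z z' y -> local z z' (f y)) ->
  odd_family I0 (fun l => f (x l)).
Proof.
move=> f0 fd fi fs fl; split.
- move=> l _; rewrite -f0; apply: fd; rewrite subr0.
  by exists 1; rewrite mulr1.
- move=> z z' _ _ _; rewrite -[X in divides _ (_ - X)](fi z) -mulrBr; apply: dividesMl.
  by apply: fd; apply: divides_iota.
- by move=> z z' l zI z'I lI; apply: fs => //; apply: swaps_diff.
- by move=> z z' l zI z'I lI lz lz'; apply: fl => //; apply: local_diff.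
Qed.

Variables (p p' : 'I_n) (A : fps2 C).
Hypotheses (hA : hidden A) (pp' : p != p').

Local Notation u := (x p).
Local Notation pair m := (@evendiff C n m p p').

Lemma swaps_var_out z z' : p != z -> p != z' -> swaps z z' u u.
Proof.
move=> pz pz'; have := @swaps_diff C n M R z z' p.
by rewrite tpermD // eq_sym.
Qed.

Lemma odd_family_defect I0 : p \notin I0 ->
  odd_family I0 (fun l => odd_defect phi M u (x l)).
Proof.
move=> pI; have out z : z \in I0 -> p != z by move=> zI; apply: contraNneq pI => ->.
apply: (odd_familyP (f := odd_defect phi M u)).
- exact: (odd_defect0 phi M0 (var_nil p)).
- move=> y y' d dy; have d0 (v : R) : divides d (v - v) by rewrite subrr; exact: divides0.
  by apply: divides_subM; apply: divides_subM; apply: ev_divides.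
- by move=> l; apply: odd_defect_iota; apply: nilpair_var.
- move=> z z' y y' /out pz /out pz' yy'; have uu := swaps_var_out pz pz'.
  have iuu := swaps_iota uu.
  by apply: swapsM; apply: swapsM; apply: swaps_ev.
- move=> z z' y /out pz /out pz' yy; have uu := local_diff R pz pz'.
  have iuu := local_iota uu.
  by apply: localM; apply: localM; apply: local_ev.
Qed.

Lemma odd_family_part I0 : p \notin I0 ->
  odd_family I0 (fun l => odd_part phi M A u (x l)).
Proof.
move=> pI; have out z : z \in I0 -> p != z by move=> zI; apply: contraNneq pI => ->.
apply: (odd_familyP (f := odd_part phi M A u)).
- exact: (odd_part0 phi hA M0 (var_nil p)).
- move=> y y' d dy; have d0 (v : R) : divides d (v - v) by rewrite subrr; exact: divides0.
  by apply: divides_subM; apply: ev_divides.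
- by move=> l; apply: odd_part_iota => //; apply: nilpair_var.
- move=> z z' y y' /out pz /out pz' yy'; have uu := swaps_var_out pz pz'.
  have iuu := swaps_iota uu.
  by apply: swapsM; apply: swaps_ev.
- move=> z z' y /out pz /out pz' yy; have uu := local_diff R pz pz'.
  have iuu := local_iota uu.
  by apply: localM; apply: local_ev.
Qed.

Lemma indep_pair m l : l != p -> l != p' -> indep l (pair m).
Proof.
by move=> lp lp' c lam; rewrite /evendiff /setvar ![_ == l]eq_sym (negPf lp) (negPf lp').
Qed.

Lemma act_shift2 z z' F : ok F ->
  (forall lam, F (translate U_(z') (translate U_(z) lam)) = F lam) ->
  act ((1 + x z) * (1 + x z') - 1) F = fun=> 0.
Proof.
move=> okF Fzz'.
have actX i G : ok G -> act (1 + x i) G = fun l => G (translate U_(i) l).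
  move=> okG; rewrite dactD // dact1 // dact_var //.
  by apply: functional_extensionality_dep => l; rewrite /diff addrC subrK.
rewrite dactD // actN // dact1 // dactM // !actX //; last by apply: deg_lt_translate.
by apply: functional_extensionality_dep => lam; rewrite Fzz' subrr.
Qed.

Section Pair.
Variables (h : nat) (I : seq 'I_n).
Hypotheses (pI : p \notin I) (p'I : p' \notin I).

Lemma coords_translate_out z lam : z \notin I -> coords I (translate U_(z) lam) = coords I lam.
Proof.
move=> zI; apply/eq_in_map => i iI; rewrite /translate mnm1E.
by case: eqP => [zi|_]; [rewrite zi iI in zI | rewrite addr0].
Qed.

Lemma pair_shift m lam :
  tensor (pair m) h I (translate U_(p') (translate U_(p) lam)) = tensor (pair m) h I lam.
Proof.
rewrite !tensorE !coords_translate_out //; congr (evenker _ _ * _).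
rewrite /translate !mnm1E !eqxx [p' == p]eq_sym (negPf pp').
by congr (_%:~R); ring.
Qed.

Lemma act_pair_congr m q : divides ((1 + u) * (1 + x p') - 1) q ->
  ok (tensor (pair m) h I) -> act q (tensor (pair m) h I) = fun=> 0.
Proof.
move=> [w ->] okF; rewrite mulrC dactM // act_shift2 ?act_zero //.
exact: pair_shift.
Qed.

(** By [ev_iota_add] the operator equals $-u\,\iota(u)$, which acts here as $-x_px_{p'}$; on a
    function of the difference this is, up to sign, the second difference of [evenker_diff2]. *)
Lemma act_pair_trace m : ok (tensor (pair m.+1) h I) ->
  act (u + iotaR u) (tensor (pair m.+1) h I) = fun l => - tensor (pair m) h I l.
Proof.
move=> okF; rewrite -[u + _]opprK -(ev_iota_add phi (var_nil p)) actN //.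
have -> : act (u * iotaR u) (tensor (pair m.+1) h I) = act (u * x p') (tensor (pair m.+1) h I).
  have K : act (u * (x p' - iotaR u)) (tensor (pair m.+1) h I) = fun=> 0.
    by apply: act_pair_congr => //; apply: dividesMl; apply: divides_iota.
  have -> : u * iotaR u = u * x p' + - (u * (x p' - iotaR u)) by ring.
  rewrite dactD // actN // K.
  by apply: functional_extensionality_dep => l; rewrite oppr0 addr0.
rewrite dactM // !dact_var //; last exact: deg_lt_diff.
apply: functional_extensionality_dep => lam; congr (- _).
rewrite /diff pair_shift !tensorE !coords_translate_out // /evendiff.
rewrite -[evenker m _]evenker_diff2 /translate !mnm1E !eqxx [p' == p]eq_sym (negPf pp') /=.
set a := lam p'; set b := lam p.
have -> : (a + 1%:Z - (b + 0%:Z))%:~R = (a - b)%:~R + 1 :> C.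
  by rewrite -[1 in RHS]/(1%:~R) -intrD; congr (_%:~R); ring.
have -> : (a + 0%:Z - (b + 1%:Z))%:~R = (a - b)%:~R - 1 :> C.
  by rewrite -[1 in RHS]/(1%:~R) -intrB; congr (_%:~R); ring.
by ring.
Qed.

End Pair.

End Defect.

(** [J1] ends before the pair [z], [z'], between its two members, or after it. *)
Lemma cat_prefix_cases (T : Type) (I1 I3 J1 J2 : seq T) (z z' : T) :
  I1 ++ z :: z' :: I3 = J1 ++ J2 ->
  [\/ exists K, I1 = J1 ++ K, J1 = I1 ++ [:: z] |
      exists2 K, J1 = I1 ++ z :: z' :: K & I3 = K ++ J2].
Proof.
elim: I1 J1 => [|a I1 IH] [|b J1] /=.
- by move=> _; apply: Or31; exists [::].
- case=> <-; case: J1 => [_|c J1 [<- ->]]; first exact: Or32.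
  by apply: Or33; exists J1.
- by move=> _; apply: Or31; exists (a :: I1).
- case=> <- /IH[[K ->]|->|[K -> ->]]; [apply: Or31|apply: Or32|apply: Or33] => //.
    by exists K.
  by exists K.
Qed.

Section DefectVanishing.
Variables (C : numFieldType) (n M : nat) (R : diff_algebra C n M).

Local Notation lattice_fun := (lattice_fun C n).
Local Notation phi := (dscal R).
Local Notation act := (@dact _ _ _ R).
Local Notation x := (@dvar _ _ _ R).
Local Notation ok := (deg_lt M).
Local Notation evR := (ev phi M).
Local Notation iotaR := (ev_iota phi M).
Local Notation prefix_diff := (@prefix_diff C n M R).
Local Notation tensor := (@tensor C n).

Implicit Types (F G g : lattice_fun) (q r : R) (lam : 'I_n -> int) (z : 'I_n) (I J : seq 'I_n).

Variables (p p' : 'I_n).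
Hypothesis pp' : p != p'.

Local Notation u := (x p).
Local Notation pair m := (@evendiff C n m p p').
Local Notation vanishes := (@vanishing C n p p').

Definition defect (l : 'I_n) : R := odd_defect phi M u (x l).
Local Notation oprod := (@oprod C n M R defect).

Lemma notin_neq z I : z \in I -> forall k, k \notin I -> z != k.
Proof. by move=> zI k kI; apply: contraNneq kI => <-. Qed.

Lemma indep_pair_in m I : p \notin I -> p' \notin I -> forall l, l \in I -> indep l (pair m).
Proof. by move=> pI p'I l lI; apply: indep_pair; apply: notin_neq lI _ _. Qed.

Lemma diagonal_setvar z I : z \in I -> p \notin I -> p' \notin I ->
  forall c lam, lam p = lam p' -> setvar z c lam p = setvar z c lam p'.
Proof.
move=> zI pI p'I c lam; have zp := notin_neq zI pI; have zp' := notin_neq zI p'I.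
by rewrite /setvar ![_ == z]eq_sym (negPf zp) (negPf zp').
Qed.

Lemma vanishes_act q F : local p p' q -> ok F -> vanishes F -> vanishes (act q F).
Proof. by move=> lq okF vF; apply: (lq F F). Qed.

Lemma vanishes_zero F : F = (fun=> 0) -> vanishes F.
Proof. by move=> ->. Qed.

(* The induction on [h] needs the initial segments [I1] and [J1] to be
   independent. *)
Definition defect_kills h := forall m I I1 I2 J1 J2,
  I = I1 ++ I2 -> I = J1 ++ J2 -> uniq I -> p \notin I -> p' \notin I ->
  (h < m)%N -> ok (tensor (pair m) h I) ->
  vanishes (act (oprod J1 * prefix_diff I1) (tensor (pair m) h I)).

(** When the defects sit inside the differenced prefix, [h < m] is enough for GT of index [h.+1],
    one less than [defect_kills h.+1] demands. *)
Definition defect_kills_inner h := forall m I J1 J2 I2,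
  I = (J1 ++ J2) ++ I2 -> uniq I -> p \notin I -> p' \notin I ->
  (h < m)%N -> ok (tensor (pair m) h.+1 I) ->
  vanishes (act (oprod J1 * prefix_diff (J1 ++ J2)) (tensor (pair m) h.+1 I)).

Section Step.
Variables (h m : nat) (I I1 I3 : seq 'I_n) (z z' : 'I_n).
Hypotheses (EI : I = I1 ++ z :: z' :: I3) (uI : uniq I) (pI : p \notin I) (p'I : p' \notin I).
Hypothesis okF : ok (tensor (pair m) h.+1 I).

Lemma defect_step J1 q1 :
  swaps z z' (oprod J1) (oprod J1) -> local z z' q1 ->
  divides ((1 + x z) * (1 + x z') - 1) (oprod J1 - q1) ->
  vanishes (act (oprod J1 * prefix_diff (I1 ++ [:: z])) (tensor (pair m) h.+1 I)) ->
  vanishes (act (oprod J1 * prefix_diff I1) (tensor (pair m) h.+1 I)).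
Proof.
move=> sJ lq1 dJ vz; have uI' : uniq (I1 ++ z :: z' :: I3) by rewrite -EI.
have [[zI1 z'I1 _ _] zz' _] := uniq_middle uI'.
have zI : z \in I by rewrite EI mem_cat mem_head orbT.
have z'I : z' \in I by rewrite EI mem_cat !inE eqxx !orbT.
have gI := indep_pair_in m pI p'I.
move=> lam; move: lam; rewrite EI.
apply: (@contraction_step _ _ _ R (fun lam => lam p = lam p') _ _ _ _ _ _ _
    (q1 * prefix_diff I1)) => //.
- exact: gI.
- exact: gI.
- by rewrite -EI.
- exact: diagonal_setvar zI pI p'I.
- by apply: swapsM => //; apply: swaps_prefix_diff.
- by apply: localM => //; apply: local_prefix_diff.
- by rewrite -mulrBl; apply: dividesMr.
- move=> lam lpp'; rewrite -EI; have := vz lam lpp'.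
  rewrite prefix_diff_cat prefix_diff1.
  have -> : oprod J1 * (prefix_diff I1 * - x z) = - (x z * (oprod J1 * prefix_diff I1)) by ring.
  by rewrite actN // => /eqP; rewrite oppr_eq0 => /eqP.
Qed.

Lemma defect_step_in J1 K : I1 = J1 ++ K ->
  vanishes (act (oprod J1 * prefix_diff (I1 ++ [:: z])) (tensor (pair m) h.+1 I)) ->
  vanishes (act (oprod J1 * prefix_diff I1) (tensor (pair m) h.+1 I)).
Proof.
move=> EI1; have uI' : uniq (I1 ++ z :: z' :: I3) by rewrite -EI.
have [[zI1 z'I1 _ _] _ _] := uniq_middle uI'.
have sub : {subset J1 <= I1} by move=> k kJ; rewrite EI1 mem_cat kJ.
have zJ : z \notin J1 by apply: contra zI1; apply: sub.
have z'J : z' \notin J1 by apply: contra z'I1; apply: sub.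
have oe := odd_family_defect R pI.
have s : {subset z :: z' :: J1 <= I}.
  move=> k; rewrite !inE EI mem_cat !inE => /or3P[->|->|/sub->]; rewrite ?orbT //.
apply: (@defect_step _ (oprod J1)).
- exact: (swaps_oprod oe).
- exact: (local_oprod oe).
- by rewrite subrr; exact: divides0.
Qed.

Lemma defect_step_over K J2 : I3 = K ++ J2 ->
  vanishes (act (oprod (I1 ++ z :: z' :: K) * prefix_diff (I1 ++ [:: z])) (tensor (pair m) h.+1
      I)) ->
  vanishes (act (oprod (I1 ++ z :: z' :: K) * prefix_diff I1) (tensor (pair m) h.+1 I)).
Proof.
move=> EI3; have uI' : uniq (I1 ++ z :: z' :: I3) by rewrite -EI.
have [[zI1 z'I1 zI3 z'I3] zz' _] := uniq_middle uI'.
have zI : z \in I by rewrite EI mem_cat mem_head orbT.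
have z'I : z' \in I by rewrite EI mem_cat !inE eqxx !orbT.
have oe := odd_family_defect R pI.
have s : {subset z :: z' :: I1 ++ K <= I}.
  move=> k; rewrite !inE EI EI3 !mem_cat !inE !mem_cat.
  by move=> /or3P[->|->|/orP[->|->]]; rewrite ?orbT.
have zK : z \notin I1 ++ K.
  by rewrite mem_cat negb_or zI1; apply: contra zI3; rewrite EI3 mem_cat => ->.
have z'K : z' \notin I1 ++ K.
  by rewrite mem_cat negb_or z'I1; apply: contra z'I3; rewrite EI3 mem_cat => ->.
have EO : oprod (I1 ++ z :: z' :: K) = defect z * defect z' * oprod (I1 ++ K).
  by rewrite !oprod_cat !oprod_cons; ring.
apply: (@defect_step _ (oprod (I1 ++ K))).
- rewrite EO; apply: swapsM; last exact: (swaps_oprod oe).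
  exact: (swaps_pair oe).
- exact: (local_oprod oe).
- have -> : oprod (I1 ++ z :: z' :: K) - oprod (I1 ++ K) =
      (defect z * defect z' - 1) * oprod (I1 ++ K) by rewrite EO; ring.
  apply: dividesMr.
  by case: oe => _ e1 _ _; apply: e1.
Qed.

End Step.

(** As long as two variables are undifferenced, they lie outside [J1] and can be contracted without
    touching the defects. With a single one left, differencing leads from [h.+1] to [h], with an
    empty prefix. *)
Lemma defect_kills_innerP h : defect_kills h -> defect_kills_inner h.
Proof.
move=> Sh m I J1 J2 I2; elim: I2 J2 => [|z [|z' I3] IH] J2 EI uI pI p'I hm okF.
- rewrite cats0 in EI; apply: vanishes_zero; rewrite dactM // -EI prefix_diff_full ?act_zero //.
  exact: indep_pair_in.
- have EF : act (prefix_diff (J1 ++ J2)) (tensor (pair m) h.+1 I) = tensor (pair m) h (J1 ++ J2).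
    rewrite EI cats1; apply: tensor_prefix_diff; rewrite -?cats1 -?EI //.
    move=> l lJ; apply: (indep_pair_in m pI p'I); by rewrite EI mem_cat lJ.
  rewrite dactM // EF.
  have := Sh m (J1 ++ J2) [::] (J1 ++ J2) J1 J2 erefl erefl.
  rewrite prefix_diff0 mulr1; apply=> //.
  + by move: uI; rewrite EI cat_uniq => /and3P[].
  + by move: pI; rewrite EI mem_cat negb_or => /andP[].
  + by move: p'I; rewrite EI mem_cat negb_or => /andP[].
  + by rewrite -EF; apply: deg_lt_dact.
- apply: (defect_step_in EI uI pI p'I okF erefl).
  by rewrite -catA; apply: IH => //; rewrite EI -!catA.
Qed.

(** This is [odd_defect_rec] solved for the defect, with $u+\iota(u)$ traded for a step from [m.+1]
    to [m]. Both correction terms carry [x z], that is, one more differenced variable. *)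
Lemma act_defect_rec z m h I q : z \in I -> p \notin I -> p' \notin I ->
  ok (tensor (pair m.+1) h I) ->
  let c := - (1 + iotaR (x z)) ^+ 2 in
  act (defect z * q) (tensor (pair m.+1) h I) = fun lam =>
    act q (tensor (pair m.+1) h I) lam +
    (act ((1 + x z) * (x z * q)) (tensor (pair m) h I) lam -
     act (c * (x z * (defect z * q))) (tensor (pair m) h I) lam).
Proof.
move=> zI pI p'I okF c.
set F := tensor (pair m.+1) h I in okF *; set G := tensor (pair m) h I.
have tF : act (u + iotaR u) F = fun l => - G l by apply: act_pair_trace.
have okG : ok G.
  have -> : G = fun l => (-1) * act (u + iotaR u) F l + 0.
    by apply: functional_extensionality_dep => l; rewrite tF addr0 mulN1r opprK.
  by apply: deg_lt_lin; [apply: deg_lt_dact | apply: deg_lt_zero].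
have actt r : act (r * (u + iotaR u)) F = fun l => - act r G l.
  rewrite dactM // tF (_ : (fun l => - G l) = fun l => (-1) * G l + 0).
    rewrite dact_lin act_zero; apply: functional_extensionality_dep => l.
    by rewrite addr0 mulN1r.
  by apply: functional_extensionality_dep => l; rewrite addr0 mulN1r.
have E := odd_defect_rec phi (nilpair_var R p z); rewrite -/(defect z) in E.
(* Hence $\iota(y)(1+\iota(y))=-y(1+\iota(y))^2$ for $y$ the operator [x z]: the factor [x z] comes
   out and [c] remains. *)
have iz : iotaR (x z) = - (x z * (1 + iotaR (x z))).
  by rewrite mulrDr mulr1 (ev_iota_add phi (var_nil R z)); ring.
have {}E : defect z * q = q + (- ((1 + x z) * (x z * q)) +
    c * (x z * (defect z * q))) * (u + iotaR u).
  transitivity ((defect z * (1 - (u + iotaR u) * (iotaR (x z) * (1 + iotaR (x z))))) * q +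
     iotaR (x z) * (1 + iotaR (x z)) * (defect z * q) * (u + iotaR u)); first by ring.
  rewrite E /c; move: (iotaR (x z)) iz => w iz; rewrite [X in _ + X * (1 + w) * _ * _]iz.
  by ring.
rewrite {1}E dactD // actt; apply: functional_extensionality_dep => lam; congr (_ + _).
by rewrite dactD // actN // opprD opprK.
Qed.

Theorem defect_killsP h : defect_kills h.
Proof.
elim: h => [|h IHh] m I I1 I2 J1 J2 EI EJ uI pI p'I hm okF.
  (* For [h = 0] the Pfaffian is constant, so the defects act trivially, and the even kernel of
     positive index vanishes on the diagonal. *)
  case: m hm okF => // m _ okF; have oe := odd_family_defect R pI.
  have gI := indep_pair_in m.+1 pI p'I.
  have xF l : l \in I -> act (x l) (tensor (pair m.+1) 0 I) = fun=> 0.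
    move=> lI; apply: act_var_indep => // c lam.
    by rewrite !tensorE !GTfun0; congr (_ * _); exact: gI.
  have vF : vanishes (tensor (pair m.+1) 0 I).
    by move=> lam lpp'; rewrite !tensorE evendiff0 // mul0r.
  have J1I : {subset J1 <= I} by move=> k kJ; rewrite EJ mem_cat kJ.
  case: I1 EI => [|k I1] EI.
    by rewrite prefix_diff0 mulr1 (act_oprod_indep oe) // => l /J1I; exact: xF.
  apply: vanishes_zero.
  rewrite -cat1s prefix_diff_cat prefix_diff1 [- _ * _]mulrC dactM // dactM // actN // xF.
    by rewrite (_ : (fun=> - 0) = fun=> 0) ?oppr0 ?act_zero.
  by rewrite EI mem_head.
have Sin := defect_kills_innerP IHh; have oe := odd_family_defect R pI.
elim: I2 I1 J1 J2 EI EJ => [|z [|z' I3] IH] I1 J1 J2 EI EJ.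
- rewrite cats0 in EI; apply: vanishes_zero; rewrite dactM // -EI prefix_diff_full ?act_zero //.
  exact: indep_pair_in.
- have EF : act (prefix_diff I1) (tensor (pair m) h.+1 I) = tensor (pair m) h I1.
    rewrite EI cats1; apply: tensor_prefix_diff; rewrite -?cats1 -?EI //.
    by move=> l lJ; apply: (indep_pair_in m pI p'I); rewrite EI mem_cat lJ.
  have ok1 : ok (tensor (pair m) h I1) by rewrite -EF; apply: deg_lt_dact.
  have uI1 : uniq I1 by move: uI; rewrite EI cat_uniq => /and3P[].
  have pI1 : p \notin I1 by move: pI; rewrite EI mem_cat negb_or => /andP[].
  have p'I1 : p' \notin I1 by move: p'I; rewrite EI mem_cat negb_or => /andP[].
  have use K1 K2 : I1 = K1 ++ K2 -> vanishes (act (oprod K1) (tensor (pair m) h I1)).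
    move=> EK; have := IHh m I1 [::] I1 K1 K2 erefl EK.
    by rewrite prefix_diff0 mulr1; apply=> //; apply: ltnW.
  rewrite dactM // EF; case/lastP: J2 EJ => [|J2 y] EJ.
    (* Here [J1] is all of [I]; the defect of the last variable [z] acts trivially since [z] no
       longer occurs. *)
    rewrite cats0 in EJ; rewrite -EJ EI oprod_cat dactM // [act (oprod [:: z])
        _](act_oprod_indep oe) //.
    + by apply: (use I1 [::]); rewrite cats0.
    + by move=> k kz; rewrite EI mem_cat kz orbT.
    + move=> l; rewrite inE => /eqP ->; apply: act_var_indep => //.
      apply: tensor_indep; first by apply: (indep_pair_in m pI p'I); rewrite EI mem_cat mem_head
          orbT.
      by move: uI; rewrite EI cats1 rcons_uniq => /andP[].
  apply: (use J1 J2); move: EJ; rewrite EI cats1 -rcons_cat => /rcons_inj [].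
  by [].
- have {}IH K1 K2 : I = K1 ++ K2 ->
      vanishes (act (oprod K1 * prefix_diff (I1 ++ [:: z])) (tensor (pair m) h.+1 I)).
    by move=> EK; apply: IH EK; rewrite EI -catA.
  have in_case K1 K2 : I1 = K1 ++ K2 ->
      vanishes (act (oprod K1 * prefix_diff I1) (tensor (pair m) h.+1 I)).
    move=> EK; apply: (defect_step_in EI uI pI p'I okF EK).
    by apply: (IH K1 (K2 ++ z :: z' :: I3)); rewrite EI EK -catA.
  have zI : z \in I by rewrite EI mem_cat mem_head orbT.
  case: (cat_prefix_cases (etrans (esym EI) EJ)) => [[K EK]|EJ1|[K EJ1 EI3]].
  + exact: in_case EK.
  (* Only [z] of the pair carries a defect, so the pair cannot be contracted. [act_defect_rec]
     removes this defect; its correction terms have a lower [m] and a longer prefix, which puts them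
     within reach of [Sin]. *)
  + case: m hm okF {IH EJ} in_case => // m hm okF in_case.
    have okG : ok (tensor (pair m) h.+1 I).
      have tF := act_pair_trace R pp' pI p'I okF.
      have -> : tensor (pair m) h.+1 I =
          fun l => (-1) * act (u + iotaR u) (tensor (pair m.+1) h.+1 I) l + 0.
        by apply: functional_extensionality_dep => l; rewrite tF addr0 mulN1r opprK.
      by apply: deg_lt_lin; [apply: deg_lt_dact | apply: deg_lt_zero].
    have zp := notin_neq zI pI; have zp' := notin_neq zI p'I.
    have lz : local p p' (x z) by apply: local_diff.
    have -> : oprod J1 * prefix_diff I1 = defect z * (oprod I1 * prefix_diff I1).
      by rewrite EJ1 oprod_cat oprod_cons !oprodE big_nil; ring.
    rewrite act_defect_rec // => lam lpp'.
    rewrite (in_case I1 [::]) ?cats0 // add0r.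
    rewrite dactM // [act (_ * (x z * (defect z * _))) _]dactM //.
    have -> : x z * (oprod I1 * prefix_diff I1) = - (oprod I1 * prefix_diff (I1 ++ [:: z])).
      by rewrite prefix_diff_cat prefix_diff1; ring.
    have -> : x z * (defect z * (oprod I1 * prefix_diff I1)) =
       - (oprod (I1 ++ [:: z]) * prefix_diff ((I1 ++ [:: z]) ++ [::])).
      by rewrite cats0 prefix_diff_cat prefix_diff1 oprod_cat oprod_cons !oprodE big_nil; ring.
    have vN q : vanishes (act q (tensor (pair m) h.+1 I)) ->
        vanishes (act (- q) (tensor (pair m) h.+1 I)).
      by move=> vq mu mupp'; rewrite actN // vq // oppr0.
    rewrite !vanishes_act ?subr0 //; try exact: deg_lt_dact.
    * apply: localN; rewrite expr2; apply: localM; apply: localD; try exact: local1;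
      exact: local_iota.
    * apply: vN; apply: (Sin _ _ _ _ (z' :: I3)) => //.
      by rewrite EI cats0 -catA.
    * apply: localD => //; exact: local1.
    * apply: vN; apply: (Sin _ _ _ _ (z' :: I3)) => //.
      by rewrite EI -catA.
  + rewrite EJ1; apply: (defect_step_over EI uI pI p'I okF EI3).
    by rewrite -EJ1; apply: IH EJ.
Qed.

Lemma defect_inner h : defect_kills_inner h.
Proof. exact: defect_kills_innerP (@defect_killsP h). Qed.

End DefectVanishing.

(** * The product of the operators on the diagonal *)

Section Merge.
Variables (C : numFieldType) (n M : nat) (R : diff_algebra C n M).

Local Notation lattice_fun := (lattice_fun C n).
Local Notation phi := (dscal R).
Local Notation act := (@dact _ _ _ R).
Local Notation x := (@dvar _ _ _ R).
Local Notation ok := (deg_lt M).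
Local Notation evR := (ev phi M).
Local Notation iotaR := (ev_iota phi M).
Local Notation prefix_diff := (@prefix_diff C n M R).
Local Notation tensor := (@tensor C n).

Implicit Types (F G g : lattice_fun) (q r : R) (lam : 'I_n -> int) (z : 'I_n) (I J : seq 'I_n).

Variable A : fps2 C.
Hypothesis hA : hidden A.

Let M0 : (0 < M)%N := dalg_pos R.
Let one : lattice_fun := fun=> 1.

Definition factor (i j : 'I_n) : R := evR (x i) (x j) (ratio_series A).

Fixpoint bethe I : R := if I is i :: I' then (\prod_(j <- I') factor i j) * bethe I' else 1.

Lemma bethe_pair I p p' J : bethe (I ++ p :: p' :: J) =
  factor p p' * (\prod_(l <- I) (factor l p * factor l p')) *
  (\prod_(l <- J) (factor p l * factor p' l)) * bethe (I ++ J).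
Proof.
elim: I => [|i I IHI] /=.
  by rewrite big_nil big_cons big_split /=; ring.
by rewrite IHI !big_cat !big_cons /=; ring.
Qed.

Lemma bethe_rcons I z : bethe (rcons I z) = bethe I * \prod_(l <- I) factor l z.
Proof.
elim: I => [|i I IHI] /=; first by rewrite !big_nil.
by rewrite IHI big_rcons /= big_cons; ring.
Qed.

Lemma local_factor z z' i j : i != z -> i != z' -> j != z -> j != z' ->
  local z z' (factor i j).
Proof. by move=> iz iz' jz jz'; apply: local_ev; apply: local_diff. Qed.

Lemma local_bethe z z' I : z \notin I -> z' \notin I -> local z z' (bethe I).
Proof.
elim: I => [|i I IHI] /=; first by move=> _ _; exact: local1.
rewrite !inE !negb_or => /andP[zi zI] /andP[z'i z'I]; apply: localM; last exact: IHI.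
apply: compat_prod => j jI; apply: local_factor; rewrite 1?eq_sym //.
  by apply: contraNneq zI => ->.
by apply: contraNneq z'I => ->.
Qed.

Lemma swaps_factor z z' i j :
  swaps z z' (factor i j) (factor (tperm z z' i) (tperm z z' j)).
Proof. by apply: swaps_ev; apply: swaps_diff. Qed.

Lemma swaps_bethe z z' I : z \notin I -> z' \notin I -> swaps z z' (bethe I) (bethe I).
Proof.
elim: I => [|i I IHI] /=; first by move=> _ _; exact: swaps1.
rewrite !inE !negb_or => /andP[zi zI] /andP[z'i z'I]; apply: swapsM; last exact: IHI.
apply: compat_prod => j jI; have := @swaps_factor z z' i j.
rewrite !tpermD //.
  by apply: contraNneq zI => ->.
by apply: contraNneq z'I => ->.
Qed.

Lemma divides_prod (d : R) (T : Type) (s : seq T) (f g : T -> R) :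
  (forall i, divides d (f i - g i)) ->
  divides d (\prod_(i <- s) f i - \prod_(i <- s) g i).
Proof.
move=> fg; elim: s => [|i s IHs]; first by rewrite !big_nil subrr; exact: divides0.
by rewrite !big_cons; apply: divides_subM.
Qed.

Lemma indep_one z : indep z one.
Proof. by []. Qed.

(** Modulo the simultaneous shift, [v] becomes $\iota(u)$: then [A] becomes 1, a variable on the
    right gives [odd_part], one on the left [odd_part] times [defect]. The odd parts of both sides
    together form an odd family, and [defect_inner] deals with the rest. *)
Theorem bethe_merge h I p p' J : let K := I ++ p :: p' :: J in
  uniq K -> ok (tensor one h.+1 K) ->
  vanishing p p' (act (evR (x p) (x p') (strict_series C) * prefix_diff I * bethe K)
                      (tensor one h.+1 K)).
Proof.
move=> K uK okK; have [[pI p'I pJ p'J] pp' uIJ] := uniq_middle uK.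
set u := x p; set v := x p'; set us := iotaR u; set d := (1 + u) * (1 + v) - 1.
have uv : nilpair M u v by exact: nilpair_var.
pose IJ := I ++ J.
have pIJ : p \notin IJ by rewrite mem_cat negb_or pI.
have p'IJ : p' \notin IJ by rewrite mem_cat negb_or p'I.
pose before l : R := factor l p * factor l p'.
pose after l : R := factor p l * factor p' l.
pose q : R := evR u v A * (\prod_(l <- I) before l) * (\prod_(l <- J) after l) *
   bethe IJ * prefix_diff I.
(* [strict_series] cancels the denominator of [factor p p'], and the symmetric [A] remains. *)
have -> : evR u v (strict_series C) * prefix_diff I * bethe K = q.
  rewrite bethe_pair /q -/IJ /before /after {1}/factor (ev_ratio phi A uv).
  have := ev_strictV phi uv; rewrite -/u -/v.
  move: (evR u v (strict_series C)) (evR u v (strict_series C)^-1) => s si ssi.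
  set a := evR u v A; set b := \prod_(l <- I) _; set c := \prod_(l <- J) _.
  transitivity (s * si * (a * b * c * bethe IJ * prefix_diff I)); first by ring.
  by rewrite ssi mul1r.
have sq : swaps p p' q q.
  apply: swapsM; last exact: swaps_prefix_diff.
  apply: swapsM; last exact: swaps_bethe.
  apply: swapsM.
    apply: swapsM.
      rewrite {2}(ev_hidden_sym phi hA uv).
      have su : swaps p p' u v by have := @swaps_diff C n M R p p' p; rewrite tpermL.
      have sv : swaps p p' v u by have := @swaps_diff C n M R p p' p'; rewrite tpermR.
      exact: swaps_ev.
    apply: compat_prod => l lI; rewrite {2}/before mulrC.
    have lp : p != l by apply: contraNneq pI => ->.
    have lp' : p' != l by apply: contraNneq p'I => ->.
    have := @swaps_factor p p' l p; have := @swaps_factor p p' l p'.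
    by rewrite tpermL tpermR tpermD // => s1 s2; apply: swapsM.
  apply: compat_prod => l lJ; rewrite {2}/after mulrC.
  have lp : p != l by apply: contraNneq pJ => ->.
  have lp' : p' != l by apply: contraNneq p'J => ->.
  have := @swaps_factor p p' p l; have := @swaps_factor p p' p' l.
  by rewrite tpermL tpermR tpermD // => s1 s2; apply: swapsM.
move=> lam lpp'; rewrite (act_diagonal uK (indep_one p) (indep_one p') okK sq lpp').
set H := contracted _ _ _ _ _ _.
have EH : H = tensor (evendiff C h.+1 p p') h.+1 IJ.
  apply: functional_extensionality_dep => mu.
  by rewrite /H /contracted !tensorE /one mul1r.
have okH : ok H by apply: ok_contracted.
pose q' : R := 1 * (\prod_(l <- I) (evR (x l) u (ratio_series A) * evR (x l) us (ratio_series A))) *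
   (\prod_(l <- J) odd_part phi M A u (x l)) * bethe IJ * prefix_diff I.
have dd (y : R) : divides d (y - y) by rewrite subrr; exact: divides0.
have dv : divides d (v - us) by exact: divides_iota.
have dqq' : divides d (q - q').
  apply: divides_subM => //; apply: divides_subM => //; apply: divides_subM.
    apply: divides_subM.
      rewrite -(ev_hidden_iota phi hA (var_nil R p)); exact: ev_divides.
    by apply: divides_prod => l; apply: divides_subM => //; apply: ev_divides.
  by apply: divides_prod => l; apply: divides_subM => //; apply: ev_divides.
have -> : act q H = act q' H.
  have -> : q = q' + (q - q') by ring.
  rewrite dactD // [act (q - q') H]act_contracted //.
  by apply: functional_extensionality_dep => mu; rewrite addr0.
have gIJ := indep_pair_in C h.+1 pIJ p'IJ.
have -> : q' = bethe IJ * (oprod (defect R p) I * prefix_diff I) *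
    oprod (fun l => odd_part phi M A u (x l)) IJ.
  rewrite oprod_cat /q' (eq_bigr (fun l => odd_part phi M A u (x l) * defect R p l)).
    by rewrite big_split /oprod /=; ring.
  by move=> l _; apply: odd_partE => //; apply: nilpair_var.
rewrite dactM // EH (odd_family_trivial (odd_family_part R hA pIJ)) // -?EH // EH.
rewrite dactM -?EH // EH.
apply: vanishes_act lpp'.
- exact: local_bethe.
- by apply: deg_lt_dact; rewrite -EH.
(* The index [m = h.+1] just meets the bound of the inner version, whose prefix may coincide with
   the list of defects. *)
- have := @defect_inner _ _ _ R _ _ pp' h h.+1 IJ I [::] J.
  by rewrite cats0; apply=> //; rewrite -EH.
Qed.

(** Differencing removes [z] from the function, so [x z] acts as 0 and the factors involving [z]
    become $B(x_l,0)$, an odd family. *)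
Lemma bethe_prefix_diff h I z : uniq (rcons I z) -> ok (tensor one h.+1 (rcons I z)) ->
  act (prefix_diff I * bethe (rcons I z)) (tensor one h.+1 (rcons I z)) =
  act (bethe I) (tensor one h I).
Proof.
move=> uI okF; have [zI uI'] : z \notin I /\ uniq I by move: uI; rewrite rcons_uniq => /andP.
have EF := tensor_prefix_diff R uI (fun l _ => @indep_one l) okF.
have okE : ok (tensor one h I) by rewrite -EF; apply: deg_lt_dact.
rewrite mulrC dactM // EF bethe_rcons dactM //; congr (act _ _).
pose e l : R := evR (x l) 0 (ratio_series A).
have oe : odd_family I e.
  apply: (odd_familyP (f := fun y => evR y 0 (ratio_series A))).
  - exact: (ev_ratio00 phi hA M0).
  - move=> y y' d dy; apply: ev_divides => //; rewrite subrr; exact: divides0.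
  - by move=> l; apply: (ev_ratio0_iota phi hA M0 (var_nil R l)).
  - by move=> z1 z2 y y' _ _ yy'; apply: swaps_ev => //; apply: compat0.
  - by move=> z1 z2 y _ _ yy'; apply: local_ev => //; apply: compat0.
have [w Ew] : divides (x z) (\prod_(l <- I) factor l z - oprod e I).
  apply: divides_prod => l; apply: ev_divides; first by rewrite subrr; exact: divides0.
  by rewrite subr0; exists 1; rewrite mulr1.
have -> : \prod_(l <- I) factor l z = oprod e I + w * x z.
  by rewrite [w * _]mulrC -Ew; ring.
rewrite dactD // (odd_family_trivial oe) //.
rewrite dactM // act_var_indep //; last exact: tensor_indep.
rewrite act_zero; apply: functional_extensionality_dep => l; exact: addr0.
Qed.

End Merge.

(** * Interlacing rows *)

Definition int_range (a b : int) : seq int :=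
  if a <= b then [seq a + i%:Z | i <- iota 0 `|b - a|%N.+1] else [::].

Lemma mem_int_range a b l : (l \in int_range a b) = (a <= l <= b).
Proof.
rewrite /int_range; case: ifP => [ab|/negbT]; last first.
  rewrite -ltNge => ba; apply/esym/negbTE/negP => /andP[al lb].
  by move: ba; rewrite ltNge (le_trans al lb).
apply/mapP/andP => [[d]|[al lb]].
  by rewrite mem_iota /= add0n ltnS => db ->; lia.
by exists `|l - a|%N; [rewrite mem_iota /= add0n ltnS|]; lia.
Qed.

Lemma int_range_uniq a b : uniq (int_range a b).
Proof.
rewrite /int_range; case: ifP => // _; rewrite map_inj_uniq ?iota_uniq // => i j.
by move/addrI => [].
Qed.

(* Rows interlacing with the row [a :: s]; they are strictly increasing when
   [strict] holds, as long as [a :: s] is. *)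
Fixpoint interlacing_rec (strict : bool) (a : int) (s : seq int) : seq (seq int) :=
  if s is c :: s' then
    [seq l :: r | l <- int_range a c, r <- interlacing_rec strict (c + (strict && (l == c))%:Z) s']
  else [:: [::]].

Definition interlacing strict (k : seq int) : seq (seq int) :=
  if k is a :: s then interlacing_rec strict a s else [::].

Definition row_order (strict : bool) : rel int := if strict then <%O else <=%O.

Lemma mem_interlacing_rec strict a s r :
  reflect [/\ size r = size s, sorted (row_order strict) r &
             forall t, (t < size s)%N -> nth 0 (a :: s) t <= nth 0 r t <= nth 0 s t]
          (r \in interlacing_rec strict a s).
Proof.
elim: s a r => [|c s IHs] a r /=.
  by rewrite inE; apply: (iffP eqP) => [-> | [/eqP]] //; rewrite size_eq0 => /eqP.
apply: (iffP allpairsPdep) => [[l [q [+ /IHs[szq sq bd] ->]]]|[]].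
  rewrite mem_int_range => /andP[al lc]; split=> /=; first by rewrite szq.
  - case: q szq sq bd => //= q0 q szq sq bd; rewrite sq andbT.
    case: s szq bd {IHs} => //= d s _ /(_ 0 isT) /= /andP[+ _].
    by rewrite /row_order; case: strict {sq} => /=; [case: eqP|]; lia.
  - move=> [_|t] /=; first by rewrite al lc.
    rewrite ltnS => ts; have := bd t ts; case: t ts => //= _.
    by case/andP=> + ->; rewrite andbT; apply: le_trans; rewrite lerDl; case: (_ && _).
case: r => // l q /= [szq] sq bd; exists l, q; split=> //.
  by rewrite mem_int_range; apply: (bd 0).
apply/IHs; split=> // [|t ts]; first exact: path_sorted sq.
have := bd t.+1 ts; case: t ts => //= s0; have := bd 0 isT; move=> /= /andP[_ lc] /andP[c0 ->].
rewrite andbT; case: q szq sq c0 {bd IHs} => [|q0 q] /=; first by case: s s0.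
by move=> _ /andP[+ _]; rewrite /row_order; case: strict => /=; [case: eqP|]; lia.
Qed.

Lemma interlacing_rec_uniq strict a s : uniq (interlacing_rec strict a s).
Proof.
elim: s a => //= c s IHs a; apply: allpairs_uniq_dep => [|l _|]; first exact: int_range_uniq.
  exact: IHs.
by move=> [l r] [l' r'] _ _ /= [-> ->].
Qed.

Section InterlacingSum.
Variables (C : zmodType) (strict : bool).
Implicit Types (N F : seq int -> C).

(* [N] is a potential whose successive differences give [F], with no
   contribution where two neighbouring variables meet. *)
Fixpoint potential N F (q : nat) : Prop :=
  if q is q'.+1 then
    (forall l, potential (fun s => N (l :: s) - N (l + 1 :: s)) (fun r => F (l :: r)) q') /\
    (forall c s, size s = q' ->
       if strict then N [:: c, c & s] + N [:: c + 1, c + 1 & s] = N [:: c, c + 1 & s]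
       else N [:: c + 1, c & s] = 0)
  else forall c, N [:: c] = F [::].

(** The sum over the first entry [l] telescopes for [l < c]; the merge condition absorbs the term
    [l = c], after which a strict row continues from [c + 1]. Since this raised bound may reach the
    next entry, only [a <= c] is assumed. *)
Theorem sum_interlacing N F a s : potential N F (size s) ->
  sorted (row_order strict) s -> (if s is c :: _ then a <= c else true) ->
  \sum_(r <- interlacing_rec strict a s) F r = N (a :: s).
Proof.
elim: s a N F => [|c s IHs] a N F /=; first by move=> NF _ _; rewrite big_seq1 NF.
move=> [NF merge] cs ac.
have ss : sorted (row_order strict) s by apply: path_sorted cs.
have step l : \sum_(r <- interlacing_rec strict (c + (strict && (l == c))%:Z) s) F (l :: r) =
    N [:: l, c + (strict && (l == c))%:Z & s] - N [:: l + 1, c + (strict && (l == c))%:Z & s].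
  apply: (IHs _ (fun t => N (l :: t) - N (l + 1 :: t)) (fun r => F (l :: r))) => //.
  case: s cs {IHs NF merge ss} => //= d s /andP[cd _]; move: cd; rewrite /row_order.
  by case: strict => /=; case: (l == c) => //=; lia.
rewrite big_allpairs_dep /=; under eq_bigr => l _ do rewrite step.
rewrite /int_range ac big_map; set m := `|c - a|%N.
have cE : c = a + m%:Z by rewrite /m; lia.
rewrite -[iota _ _]/(index_iota 0 m.+1).
have lastE : (a + m%:Z == c) = true by rewrite cE eqxx.
rewrite big_nat_recr //= lastE -cE.
have -> : \sum_(0 <= i < m) (N [:: a + i%:Z, c + (strict && (a + i%:Z == c))%:Z & s] -
   N [:: a + i%:Z + 1, c + (strict && (a + i%:Z == c))%:Z & s]) = N [:: a, c & s] - N [:: c, c & s].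
  have tele := @telescope_sumr C 0 m (fun i => - N [:: a + i%:Z, c & s]) (leq0n _).
  rewrite cE addr0 -cE opprK addrC in tele; rewrite -tele.
  apply: eq_big_nat => i /andP[_ im].
  have -> : (a + i%:Z == c) = false by apply/eqP; rewrite cE; lia.
  by rewrite andbF addr0 opprK addrC -addn1 PoszD addrA.
rewrite andbT; case: (strict) merge => /= merge.
  have := merge c s erefl => E.
  by rewrite -E addrK subrK.
by rewrite addr0 merge // subr0 subrK.
Qed.

End InterlacingSum.

Fixpoint count_rows (strict : bool) h (k : seq int) : nat :=
  if h is h'.+1 then (\sum_(l <- interlacing strict k) count_rows strict h' l)%N else 1%N.

(** * Both counts as values of difference operators *)

Section CountFormula.
Variables (C : numFieldType) (n M : nat) (R : diff_algebra C n M).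

Local Notation lattice_fun := (lattice_fun C n).
Local Notation phi := (dscal R).
Local Notation act := (@dact _ _ _ R).
Local Notation x := (@dvar _ _ _ R).
Local Notation ok := (deg_lt M).
Local Notation evR := (ev phi M).
Local Notation prefix_diff := (@prefix_diff C n M R).
Local Notation tensor := (@tensor C n).

Implicit Types (F G g : lattice_fun) (q r : R) (lam : 'I_n -> int) (z : 'I_n) (I J : seq 'I_n).

Variable A : fps2 C.

Definition GTlattice h I : lattice_fun := tensor (fun=> 1) h I.

Lemma indep_cst z : indep z (fun=> 1 : C).
Proof. by []. Qed.

Definition ords m : seq 'I_n := take m (enum 'I_n).

Lemma size_ords m : (m <= n)%N -> size (ords m) = m.
Proof. by move=> mn; rewrite size_takel // size_enum_ord. Qed.

Lemma ords_uniq m : uniq (ords m).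
Proof. exact/take_uniq/enum_uniq. Qed.

Lemma ordsS m (mn : (m < n)%N) : ords m.+1 = rcons (ords m) (Ordinal mn).
Proof.
rewrite /ords (take_nth (Ordinal mn)) ?size_enum_ord //; congr rcons.
by apply: val_inj; rewrite /= nth_enum_ord.
Qed.

Lemma ords_split j m (mn : (m <= n)%N) (jm : (j.+1 < m)%N) (jn : (j < n)%N) (j1n : (j.+1 < n)%N) :
  exists J, ords m = ords j ++ Ordinal jn :: Ordinal j1n :: J.
Proof.
exists (drop j.+2 (ords m)).
have nthE (i : nat) (lt_in : (i < n)%N) : (i < m)%N -> nth (Ordinal lt_in) (ords m) i = Ordinal
    lt_in.
  by move=> im; apply: val_inj; rewrite /= nth_take // nth_enum_ord.
rewrite -{1}(cat_take_drop j (ords m)) take_takel; last by lia.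
congr (_ ++ _); rewrite (drop_nth (Ordinal jn)) ?size_ords ?nthE //; try lia.
congr (_ :: _); rewrite (drop_nth (Ordinal j1n)) ?size_ords ?nthE //.
Qed.

(** For a short [k] the missing entries default to 0; the functions [wave_fun] attaches to the first
    [m] variables do not see them when [k] has length [m]. *)
Definition strict_coords (k : seq int) : 'I_n -> int := fun i => nth 0 k i + (nat_of_ord i)%:Z.

Lemma strict_coords_succ l s c t j (jn : (j < n)%N) : size l = j -> c = s + 1 ->
  strict_coords (l ++ c :: t) = translate U_(Ordinal jn) (strict_coords (l ++ s :: t)).
Proof.
move=> lj ->; apply: functional_extensionality_dep => i.
rewrite /strict_coords /translate mnm1E !nth_cat lj.
have [ij|ij|ij] := ltngtP i j.
- by rewrite -val_eqE /= gtn_eqF ?addr0.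
- rewrite -val_eqE /= ltn_eqF // addr0.
  by have -> : (i - j = (i - j).-1.+1)%N by rewrite prednK // subn_gt0.
- by rewrite ij subnn /= -val_eqE /= ij eqxx addrAC.
Qed.

Lemma diff0_indep z F : (forall lam, diff z F lam = 0) -> indep z F.
Proof.
move=> dF c lam.
have step a : F (setvar z (a + 1) lam) = F (setvar z a lam).
  by have /eqP := dF (setvar z a lam); rewrite /diff setvar_translate subr_eq0 => /eqP.
have const a : F (setvar z a lam) = F (setvar z 0 lam).
  elim/int_rect: a => // k IHk; first by rewrite -addn1 PoszD step.
  by rewrite -IHk -addn1 PoszD opprD -[in RHS](subrK 1 (- k%:Z)) step.
by rewrite const -(const (lam z)) setvar_id.
Qed.

(** [q] may itself involve [z], but it commutes with [x z], so the difference in [z] stays zero. *)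
Lemma act_indep q z F : ok F -> indep z F -> indep z (act q F).
Proof.
move=> okF zF; apply: diff0_indep => lam.
rewrite -(dact_var R z (deg_lt_dact q okF)) -dactM // mulrC dactM // act_var_indep //.
by rewrite act_zero.
Qed.

Definition wave (strict : bool) I : R := if strict then bethe R A I else 1.

Definition wave_fun strict h m (k : seq int) : C :=
  act (wave strict (ords m)) (GTlattice h (ords m)) (strict_coords k).

(** Entries [c + 1, c] lie on the diagonal in the shifted coordinates. In the strict case
    [bethe_merge] is multiplied by the shift [1 + x p]: $(1+x_p)s(x_p,x_{p'})=1+x_p+x_px_{p'}$, and
    its expansion at entries [c, c] is the relation. *)
Lemma wave_merge (strict : bool) h m j : (strict -> hidden A) -> (m <= n)%N -> (j.+1 < m)%N ->
    ok (GTlattice h.+1 (ords m)) ->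
  let W ls := act (prefix_diff (ords j) * wave strict (ords m)) (GTlattice h.+1 (ords m))
    (strict_coords ls) in
  forall ls c s, size ls = j ->
    if strict then W (ls ++ [:: c, c & s]) + W (ls ++ [:: c + 1, c + 1 & s]) =
                   W (ls ++ [:: c, c + 1 & s])
    else W (ls ++ [:: c + 1, c & s]) = 0.
Proof.
move=> hA mn jm okT W ls c s lsj.
have jn : (j < n)%N by apply: leq_trans mn; apply: ltnW.
have j1n : (j.+1 < n)%N by apply: leq_trans mn.
have [J EJ] := ords_split mn jm jn j1n.
set p := Ordinal jn in EJ; set p' := Ordinal j1n in EJ.
have uI : uniq (ords j ++ p :: p' :: J) by rewrite -EJ ords_uniq.
have [[pI p'I _ _] pp' _] := uniq_middle uI.
have diag a t : strict_coords (ls ++ [:: a + 1, a & t]) p = strict_coords (ls ++ [:: a + 1, a &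
    t]) p'.
  rewrite /strict_coords !nth_cat lsj /= ltnn subnn ltnNge leqnSn /= subSn // subnn /=.
  by rewrite -[in RHS]addn1 PoszD; ring.
rewrite /W {W} /wave; case: strict hA => hA.
- set q := prefix_diff (ords j) * bethe R A (ords m); set T := GTlattice _ _ in okT *.
  have := bethe_merge R (hA isT) uI; rewrite -EJ => /(_ h okT).
  set st := evR _ _ _; rewrite -mulrA -/q -/T => vZ.
  have okq : ok (act q T) by apply: deg_lt_dact.
  have pp'nil := nilpair_var R p p'.
  have E : act (1 + x p) (act (st * q) T) = act (1 + x p + x p * x p') (act q T).
    rewrite -!dactM // mulrA; congr (act (_ * q) T).
    rewrite /st ev_strict // mulrCA [(1 + x p) * _]ev_iotaE ?mulr1 //; exact: var_nil.
  have := congr1 (fun f => f (strict_coords (ls ++ [:: c, c & s]))) E.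
  rewrite dactD; last exact: deg_lt_dact.
  rewrite dact1; last exact: deg_lt_dact.
  rewrite dact_var; last exact: deg_lt_dact.
  have okq' : ok (diff p' (act q T)) by apply: deg_lt_diff.
  rewrite (dactD _ _ okq) (dactD _ _ okq) (dact1 R okq) (dactM _ _ okq).
  rewrite (dact_var R p' okq) (dact_var R p okq) (dact_var R p okq').
  rewrite /diff /= [_ + (_ - _)]addrC subrK.
  rewrite -(strict_coords_succ [:: c & s] jn lsj (erefl (c + 1))) vZ ?diag //.
  have E2 : size (ls ++ [:: c]) = j.+1 by rewrite size_cat lsj addn1.
  have E2' : size (ls ++ [:: c + 1]) = j.+1 by rewrite size_cat lsj addn1.
  have := strict_coords_succ s j1n E2 (erefl (c + 1)); rewrite -!catA /= => <-.
  have := strict_coords_succ s j1n E2' (erefl (c + 1)); rewrite -!catA /= => <-.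
  set w1 := act q T _; set w2 := act q T _; set w3 := act q T _; set w4 := act q T _.
  move=> E0; apply/eqP; rewrite -subr_eq0; apply/eqP; rewrite [RHS]E0; ring.
- rewrite mulr1; have okT' : ok (GTlattice h.+1 (ords j ++ p :: p' :: J)) by rewrite -EJ.
  have sq : swaps p p' (prefix_diff (ords j)) (prefix_diff (ords j)) by apply: swaps_prefix_diff.
  rewrite EJ (act_diagonal uI (indep_cst p) (indep_cst p') okT' sq) ?diag //.
  have okH := ok_contracted uI (indep_cst p) (indep_cst p') okT'.
  apply: (local_prefix_diff R pI p'I okH okH) => [mu mu0|]; last exact: diag.
  by rewrite /contracted evendiff0 // mul0r.
Qed.

Lemma deg_lt_GTlattice h m : (m < n)%N -> ok (GTlattice h.+1 (ords m.+1)) ->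
  ok (GTlattice h (ords m)).
Proof.
move=> mn okT; have uI := ords_uniq m.+1; rewrite (ordsS mn) in okT uI.
rewrite /GTlattice -(tensor_prefix_diff R uI (fun l _ => indep_cst l) okT).
exact: deg_lt_dact.
Qed.

(** At stage [j] the first [j] variables are differenced and [ls] holds their entries; the sign in
    [prefix_diff] is that of the differences in [potential]. *)
Lemma wave_potential (strict : bool) h m : (strict -> hidden A) -> (m < n)%N -> ok (GTlattice
    h.+1 (ords m.+1)) ->
  potential strict (wave_fun strict h.+1 m.+1) (wave_fun strict h m) m.
Proof.
move=> hA mn okT.
pose W j ls := act (prefix_diff (ords j) * wave strict (ords m.+1)) (GTlattice h.+1 (ords m.+1))
  (strict_coords ls).
have W0 : wave_fun strict h.+1 m.+1 = W 0%N.
  apply: functional_extensionality_dep => k.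
  by rewrite /W /ords take0 prefix_diff0 mul1r.
suff main (q : nat) : forall j (ls : seq int), (j + q)%N = m -> size ls = j ->
    potential strict (fun s => W j (ls ++ s)) (fun r : seq int => wave_fun strict h m (ls ++ r)) q.
  by have := main m 0%N [::] erefl erefl; rewrite W0.
elim: q => [|q IHq] j ls jq lsj /=.
  move=> c; rewrite addn0 in jq; rewrite /W jq cats0.
  have E : act (prefix_diff (ords m) * wave strict (ords m.+1)) (GTlattice h.+1 (ords m.+1)) =
      act (wave strict (ords m)) (GTlattice h (ords m)).
    have uI := ords_uniq m.+1; move: okT uI; rewrite (ordsS mn) => okT uI.
    rewrite /wave; clear W W0; case: strict hA => hA; first exact: (bethe_prefix_diff R (hA isT)
        uI okT).
    have EF := tensor_prefix_diff R uI (fun l _ => indep_cst l) okT.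
    by rewrite mulr1 EF dact1 // /GTlattice -EF; apply: deg_lt_dact.
  rewrite E /wave_fun; set z := Ordinal mn.
  have uz := ords_uniq m.+1; rewrite (ordsS mn) rcons_uniq in uz.
  case/andP: uz => zI _.
  have okE : ok (GTlattice h (ords m)) by apply: deg_lt_GTlattice okT.
  have zT : indep z (act (wave strict (ords m)) (GTlattice h (ords m))).
    by apply: act_indep => //; apply: tensor_indep.
  (* The result is independent of the last variable, so its entry [c] can be restored at will. *)
  rewrite -(zT (c + m%:Z) (strict_coords ls)); congr (act _ _ _).
  apply: functional_extensionality_dep => i; rewrite /setvar /strict_coords.
  rewrite nth_cat lsj jq -val_eqE /=; have [im|im|im] := ltngtP i m; rewrite ?gtn_eqF //.
    rewrite nth_default ?[nth 0 ls _]nth_default //=; first by rewrite lsj jq ltnW.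
    by rewrite /= subn_gt0.
  by rewrite im subnn.
split.
  move=> l; have := IHq j.+1 (rcons ls l); rewrite size_rcons lsj addSnnS => /(_ jq erefl).
  have jn : (j < n)%N by apply: leq_ltn_trans mn; rewrite -jq leq_addr.
  congr potential; apply: functional_extensionality_dep => s; rewrite cat_rcons //.
  rewrite /W (ordsS jn) -cats1 prefix_diff_cat prefix_diff1.
  have -> : prefix_diff (ords j) * - x (Ordinal jn) * wave strict (ords m.+1) =
     - (x (Ordinal jn) * (prefix_diff (ords j) * wave strict (ords m.+1))) by ring.
  rewrite actN // dactM // dact_var; last exact: deg_lt_dact.
  by rewrite /diff opprB -(strict_coords_succ s jn lsj (erefl (l + 1))).
move=> c s _; apply: wave_merge => //; rewrite -jq; lia.
Qed.

Theorem count_rows_wave (strict : bool) h m k : (strict -> hidden A) -> (h <= m)%N -> (m <= n)%N ->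
  ok (GTlattice h (ords m)) -> size k = m -> sorted (row_order strict) k ->
  (count_rows strict h k)%:R = wave_fun strict h m k.
Proof.
move=> hA; elim: h m k => [|h IHh] m k hm mn okT szk sk /=.
  have E : GTlattice 0 (ords m) = fun=> 1.
    by apply: functional_extensionality_dep => lam; rewrite /GTlattice !tensorE GTfun0 mulr1.
  have okT1 : ok ((fun=> 1) : lattice_fun) by move: okT; rewrite E.
  rewrite /wave_fun E /wave; case: strict hA {sk} => hA; last by rewrite dact1.
  have x0 i w : act (w * x i) (fun=> 1) = fun=> 0.
    by rewrite dactM // act_var_indep // act_zero.
  (* As $B(0,0)=1$, each factor is 1 plus multiples of differences, which kill constants. *)
  suff -> : act (bethe R A (ords m)) (fun=> 1) = (fun=> 1) by [].
  elim: (ords m) => [|i I IHI] /=; first by rewrite dact1.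
  rewrite dactM // IHI; elim: I {IHI} => [|j I IHI]; first by rewrite big_nil dact1.
  rewrite big_cons dactM // IHI.
  have [w Ew] : divides (x i) (evR (x i) (x j) (ratio_series A) - evR 0 (x j) (ratio_series A)).
    by apply: ev_divides; [rewrite subr0; exists 1; rewrite mulr1 | rewrite subrr; exact: divides0].
  have [w' Ew'] : divides (x j) (evR 0 (x j) (ratio_series A) - evR 0 0 (ratio_series A)).
    by apply: ev_divides; [rewrite subrr; exact: divides0 | rewrite subr0; exists 1; rewrite mulr1].
  have -> : factor R A i j = 1 + (w * x i + w' * x j).
    rewrite [w * _]mulrC [w' * _]mulrC -Ew -Ew' (ev_ratio00 phi (hA isT) (dalg_pos R)) /factor.
    by ring.
  by rewrite dactD // dactD // !x0 dact1 //; apply: functional_extensionality_dep => l; rewrite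
      !addr0.
case: m hm mn okT szk => // m hm mn okT szk.
case: k szk sk => // a s [szs] sk; subst m.
have okm : ok (GTlattice h (ords (size s))) by apply: deg_lt_GTlattice okT.
have ss : sorted (row_order strict) s by apply: path_sorted sk.
have as_ : is_true (if s is c :: _ then a <= c else true).
  by case: s sk {hm mn okT okm ss} => //= c s /andP[+ _]; rewrite /row_order; case: (strict) =>
      // /ltW.
have pot := wave_potential hA mn okT.
rewrite -[RHS](sum_interlacing pot ss as_) natr_sum big_seq [RHS]big_seq.
by apply: eq_bigr => l /mem_interlacing_rec[szl sl _]; apply: IHh; rewrite ?szl // ltnW.
Qed.

End CountFormula.

(** * Trapezoids *)

Fixpoint trapezoids strict h (k : seq int) : seq array :=
  if h is h'.+1 then
    [seq rcons a k | r <- interlacing strict k, a <- trapezoids strict h' r]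
  else [:: [:: k]].

Definition trapezoid strict h n (a : array) :=
  GT_trapezoid h n a /\ forall s, (s <= h)%N -> sorted (row_order strict) (trow a s).

Lemma trow_rcons a k s : trow (rcons a k) s =
  if (s < size a)%N then trow a s else if s == size a then k else [::].
Proof. exact: nth_rcons. Qed.

Lemma size_trapezoids strict h k : size (trapezoids strict h k) = count_rows strict h k.
Proof.
elim: h k => //= h IHh k; rewrite size_allpairs_dep sumnE big_map.
by apply: eq_bigr => r _; rewrite IHh.
Qed.

Lemma trapezoidS strict h n a k : (h < n)%N -> size k = n -> size a = h.+1 ->
  trapezoid strict h.+1 n (rcons a k) <->
  [/\ trapezoid strict h n.-1 a, sorted (row_order strict) k &
      forall t, (t < n.-1)%N -> nth 0 k t <= nth 0 (trow a h) t <= nth 0 k t.+1].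
Proof.
case: n => // n hn szk sza.
have last_row : trow (rcons a k) h.+1 = k by rewrite trow_rcons sza ltnn eqxx.
have row s : (s <= h)%N -> trow (rcons a k) s = trow a s.
  by move=> sh; rewrite trow_rcons sza ltnS sh.
split=> [[[_ szr bd] srt]|[[[_ szr bd] srt] sk kbd]].
  split; last first.
  - move=> t tn; have := bd h.+1 t; rewrite ltnSn /= => /(_ isT).
    by rewrite /entry last_row /= row //; apply; lia.
  - by have := srt h.+1; rewrite last_row; apply.
  - split=> [|s sh]; last by have := srt s; rewrite row //; apply; apply: leqW.
    split=> // [s sh|s t /andP[s0 sh] ts].
      by have := szr s; rewrite row // subSS /=; apply; apply: leqW.
    have := bd s t; rewrite /entry !row //; last by apply: leq_trans sh; apply: leq_pred.
    by rewrite subSS s0 (leqW sh); apply.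
split=> [|s]; last first.
  by rewrite leq_eqVlt => /predU1P[->|]; rewrite ?last_row // ltnS => sh; rewrite row // srt.
split=> [|s|s t /andP[s0]]; first by rewrite size_rcons sza.
  rewrite subSS leq_eqVlt => /predU1P[->|]; first by rewrite last_row szk; lia.
  by rewrite ltnS => sh; rewrite row // szr.
rewrite leq_eqVlt subSS /entry => /predU1P[-> | ]; last rewrite ltnS => sh.
  by rewrite last_row /= row // => th; apply: kbd => /=; lia.
rewrite !row //; last by apply: leq_trans sh; apply: leq_pred.
by move=> ts; apply: bd => //; rewrite s0.
Qed.

Lemma mem_trapezoids strict h k a : (h <= size k)%N -> sorted (row_order strict) k ->
  (a \in trapezoids strict h k) <-> trapezoid strict h (size k) a /\ bottom_row h a = k.
Proof.
elim: h k a => [|h IHh] k a hk sk; rewrite [X in a \in X]/=.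
  rewrite inE; split=> [/eqP-> |[[[sza _ _] _]]].
    split=> //; split=> [|[]] //; split=> // [[|s]|s t] //=; last by lia.
    by rewrite addn0 subn0.
  by case: a sza => // r [] // _; rewrite /bottom_row /trow /= => ->.
case: k hk sk => // c k hk sk; rewrite /interlacing.
split=> [/allpairsPdep[r [a' [/mem_interlacing_rec[szr sr bd] + ->]]]|].
  rewrite IHh ?szr // => -[tr br]; have sza : size a' = h.+1 by case: tr => -[].
  split; last by rewrite /bottom_row trow_rcons sza ltnn eqxx.
  apply/trapezoidS => //=; split=> // t tk.
  by have := bd t tk; rewrite /bottom_row in br; rewrite br.
move=> [tr br]; have sza : size a = h.+2 by case: tr => -[].
case/lastP: a => [|a k'] in sza tr br *; first by [].
rewrite size_rcons in sza; case: sza => sza.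
have kE : k' = c :: k by rewrite -br /bottom_row trow_rcons sza ltnn eqxx.
subst k'; have [ta _ bd] := (trapezoidS strict hk (erefl _) sza).1 tr.
have [[_ szr _] sr] := ta.
have szl : size (trow a h) = size k by rewrite szr //= subnK.
apply/allpairsPdep; exists (trow a h), a; split=> //.
  by apply/mem_interlacing_rec; split=> //; exact: sr.
apply/IHh; rewrite ?szl //; first exact: sr.
Qed.

Lemma trapezoids_uniq strict h k : (h <= size k)%N -> sorted (row_order strict) k ->
  uniq (trapezoids strict h k).
Proof.
elim: h k => [|h IHh] k //= hk sk; case: k hk sk => // c k hk sk; rewrite /interlacing.
have sub r : r \in interlacing_rec strict c k -> (h <= size r)%N /\ sorted (row_order strict) r.
  by case/mem_interlacing_rec=> -> -> _.
apply: allpairs_uniq_dep => [|r rk|]; first exact: interlacing_rec_uniq.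
  by apply: IHh; case: (sub r rk).
move=> [r a] [r' a'] /allpairsPdep[x [y [xk yx]]] [-> ->].
move=> /allpairsPdep[x' [y' [xk' yx']]] [-> ->] /= /rcons_inj[yy']; subst y'.
have [h1 s1] := sub _ xk; have [h2 s2] := sub _ xk'.
have [_ <-] := (mem_trapezoids y h1 s1).1 yx.
by have [_ <-] := (mem_trapezoids y h2 s2).1 yx'.
Qed.

Local Open Scope classical_set_scope.

Lemma card_trapezoids strict h k (T : set array) : (h <= size k)%N ->
  sorted (row_order strict) k ->
  (forall a, T a <-> trapezoid strict h (size k) a /\ bottom_row h a = k) ->
  #|` fset_set T| = count_rows strict h k.
Proof.
move=> hk sk TE.
have -> : T = [set` [fset a in trapezoids strict h k]%fset].
  by apply/seteqP; split=> a /=; rewrite TE -(mem_trapezoids _ hk sk) in_fset.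
rewrite set_fsetK -size_trapezoids; apply/eqP.
by rewrite card_fseq undup_id // trapezoids_uniq.
Qed.

Lemma MT_count_rows h n (k : n.-tuple int) : (h <= n)%N ->
  sorted (fun x y : int => x < y) k -> MT h k = count_rows true h k.
Proof.
move=> hn sk; apply: (@card_trapezoids true); rewrite ?size_tuple //.
Qed.

(** Two neighbours in a row above the bottom are separated by an entry of the row below, which
    forces weak monotonicity. The bottom row has it by hypothesis. *)
Lemma GT_trapezoid_rows h n a : GT_trapezoid h n a -> (h <= n)%N ->
  sorted (row_order false) (bottom_row h a) -> trapezoid false h n a.
Proof.
move=> tr hn sb; split=> // s; rewrite leq_eqVlt => /predU1P[-> // | sh].
have [_ szr bd] := tr; apply/(sortedP 0) => t; rewrite szr ?(ltnW sh) // => ts.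
have ts1 : (t.+1 < n - h + s.+1)%N by rewrite addnS; apply: leqW.
have /andP[_ le1] := bd s.+1 t sh ts1; apply: le_trans le1 _.
by have /andP[+ _] := bd s.+1 t.+1 sh (ltac:(by rewrite addnS ltnS)).
Qed.

Lemma num_GT_count_rows h n (k : n.-tuple int) : (h <= n)%N ->
  sorted (fun x y : int => x <= y) k -> num_GT h k = count_rows false h k.
Proof.
move=> hn sk; apply: (@card_trapezoids false); rewrite ?size_tuple //.
move=> a; split=> [[tr br]|[[tr _] br]] //; split=> //.
by apply: GT_trapezoid_rows => //; rewrite br.
Qed.

(** * Polynomials *)

Section PolynomialFunctions.
Variables (C : numFieldType) (n : nat).
Local Notation lattice_fun := (lattice_fun C n).
Implicit Types (f g : {mpoly C[n]}) (lam : 'I_n -> int) (i j : 'I_n) (A : fps2 C).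

(* The coordinates are [lam i = k i + i], where the [k i] are the variables of
   [f]. *)
Definition mpoly_fun f : lattice_fun := fun lam => f.@[fun i => (lam i - (nat_of_ord i)%:Z)%:~R].

Lemma mpoly_fun_Eop i f lam : mpoly_fun (Eop i f) lam = mpoly_fun f (translate U_(i) lam).
Proof.
rewrite /mpoly_fun /Eop /shift comp_mpoly_meval; apply: meval_eq => j.
rewrite tnth_mktuple mevalD mevalXU mevalC /translate mnm1E eq_sym.
by rewrite addrAC !intrD pmulrn; reflexivity.
Qed.

Lemma mpoly_fun_Delta i f : mpoly_fun (Delta i f) = diff i (mpoly_fun f).
Proof.
apply: functional_extensionality_dep => lam.
by rewrite /diff -mpoly_fun_Eop /mpoly_fun mevalB.
Qed.

Lemma deg_lt_mpoly_fun k f : (msize f <= k)%N -> deg_lt k (mpoly_fun f).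
Proof.
elim: k f => [|k IHk] f /=.
  by rewrite leqn0 mmeasure_poly_eq0 => /eqP-> lam; rewrite /mpoly_fun meval0.
by move=> fk i; rewrite -mpoly_fun_Delta; apply: IHk; apply: leq_trans (msize_Delta i f) _;
    case: (msize f) fk.
Qed.

Lemma msizeD_le m f g : (msize f <= m)%N -> (msize g <= m)%N -> (msize (f + g) <= m)%N.
Proof. by move=> fm gm; apply: leq_trans (mmeasureD_le _ _ _) _; rewrite geq_max fm. Qed.

Lemma msize_scale m c f : (msize f <= m)%N -> (msize (c *: f) <= m)%N.
Proof. exact/leq_trans/msizeZ_le. Qed.

Lemma msize_iter m (op : {mpoly C[n]} -> {mpoly C[n]}) k f :
  (forall g, (msize g <= m)%N -> (msize (op g) <= m)%N) ->
  (msize f <= m)%N -> (msize (iter k op f) <= m)%N.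
Proof. by move=> opm fm; elim: k => //= k; apply: opm. Qed.

Lemma msize_Delta_le m i f : (msize f <= m)%N -> (msize (Delta i f) <= m)%N.
Proof. by move/(leq_trans (leq_pred _)); apply: leq_trans (msize_Delta i f). Qed.

Lemma sum_ord_widen (V : nmodType) (F : nat -> V) m k : (m <= k)%N ->
  (forall a, (m <= a)%N -> F a = 0) -> \sum_(a < m) F a = \sum_(a < k) F a.
Proof.
move=> mk F0; rewrite (big_ord_widen k F mk) [RHS](bigID (fun a : 'I_k => (a < m)%N)) /=.
by rewrite [X in _ + X]big1 ?addr0 // => a; rewrite -leqNgt; apply: F0.
Qed.

Lemma fps_opE A i j f m : (msize f <= m)%N ->
  fps_op A i j f = \sum_(a < m) \sum_(b < m) A a b *: iter a (Delta i) (iter b (Delta j) f).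
Proof.
move=> fm; rewrite /fps_op.
pose F a b := A a b *: iter a (Delta i) (iter b (Delta j) f).
rewrite (sum_ord_widen (F := fun a => \sum_(b < msize f) F a b) fm) => [|a fa].
  apply: eq_bigr => a _; apply: (sum_ord_widen (F := F a) fm) => b fb.
  by rewrite /F (iter_Delta_eq0 j fb) (@iter_Delta_eq0 C n i 0) ?scaler0 ?msize0.
apply: big1 => b _; rewrite /F iter_Delta_eq0 ?scaler0 //.
by apply: leq_trans fa; apply: msize_iter => //; exact: msize_Delta_le.
Qed.

Variables (M : nat) (R : diff_algebra C n M).
Local Notation act := (@dact _ _ _ R).
Local Notation x := (@dvar _ _ _ R).
Local Notation ok := (deg_lt M).
Local Notation evR := (ev (dscal R) M).

(** The bound on [msize (op f)] makes the relation stable under composition. *)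
Definition represents (op : {mpoly C[n]} -> {mpoly C[n]}) (q : R) :=
  forall f, (msize f <= M)%N -> (msize (op f) <= M)%N /\ mpoly_fun (op f) = act q (mpoly_fun f).

Lemma representsM op op' q q' : represents op q -> represents op' q' ->
  represents (op \o op') (q * q').
Proof.
move=> rq rq' f fM /=; have [sf ef] := rq' f fM; have [sf' ef'] := rq _ sf.
by split=> //; rewrite ef' ef dactM //; apply: deg_lt_mpoly_fun.
Qed.

Lemma represents_id : represents idfun 1.
Proof. by move=> f fM; split=> //; rewrite dact1 //; apply: deg_lt_mpoly_fun. Qed.

Lemma represents_iter op q m : represents op q -> represents (iter m op) (q ^+ m).
Proof.
move=> rq; elim: m => [|m IHm]; first exact: represents_id.
by rewrite exprS; apply: representsM IHm.
Qed.

Lemma represents_lin c op op' q q' : represents op q -> represents op' q' ->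
  represents (fun f => c *: op f + op' f) (dscal R c * q + q').
Proof.
move=> rq rq' f fM; have [sf ef] := rq f fM; have [sf' ef'] := rq' f fM.
have okf := deg_lt_mpoly_fun fM.
split; first by rewrite msizeD_le // msize_scale.
rewrite dactD // dactM // dact_scal; last exact: deg_lt_dact.
rewrite -ef -ef'; apply: functional_extensionality_dep => lam.
by rewrite /mpoly_fun mevalD mevalZ.
Qed.

Lemma represents0 : represents (fun=> 0) 0.
Proof.
move=> f fM; rewrite msize0 act0; last exact: deg_lt_mpoly_fun.
by split=> //; apply: functional_extensionality_dep => lam; rewrite /mpoly_fun meval0.
Qed.

Lemma represents_sum (I : Type) (s : seq I) (c : I -> C) op (q : I -> R) :
  (forall t : I, represents (op t) (q t)) ->
  represents (fun f => \sum_(t <- s) c t *: op t f) (\sum_(t <- s) dscal R (c t) * q t).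
Proof.
move=> rq; elim: s => [|i s IHs].
  by move=> f fM; rewrite !big_nil; apply: represents0.
by move=> f fM; rewrite !big_cons; apply: (represents_lin (c i) (rq i) IHs).
Qed.

Lemma represents_Delta i : represents (Delta i) (x i).
Proof.
move=> f fM; split; first exact: msize_Delta_le.
by rewrite mpoly_fun_Delta dact_var //; apply: deg_lt_mpoly_fun.
Qed.

Lemma represents_Eop i : represents (Eop i) (1 + x i).
Proof.
have := represents_lin 1 represents_id (represents_Delta i).
rewrite rmorph1 mul1r => rE f fM; have := rE f fM.
by rewrite scale1r /= /Delta addrC subrK.
Qed.

Lemma represents_fps_op A i j : represents (fps_op A i j) (evR (x i) (x j) A).
Proof.
rewrite evE => f fM; rewrite (fps_opE _ _ _ fM); move: f fM.
have rs a : represents (fun f => \sum_(b < M) A a b *: iter a (Delta i) (iter b (Delta j) f))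
    (\sum_(b < M) dscal R (A a b) * (x i ^+ a * x j ^+ b)).
  by apply: represents_sum => b; apply: representsM; apply/represents_iter/represents_Delta.
have := represents_sum (index_enum 'I_M) (fun=> 1) (fun a : 'I_M => rs a).
under eq_bigr do rewrite rmorph1 mul1r.
move=> rE f fM; have := rE f fM.
by rewrite (eq_bigr (fun a : 'I_M => \sum_(b < M) A a b *: iter a (Delta i) (iter b (Delta j) f)))
  // => a _; rewrite scale1r.
Qed.

(** The sum in [StrictInv] is a geometric series in [w], nilpotent as a multiple of [x i]. It
    inverts the value of [strict_series], and inverses are unique. *)
Lemma represents_StrictInv i j :
  represents (StrictInv i j) (evR (x i) (x j) (strict_series C)^-1).
Proof.
have pij : nilpair M (x i) (x j) by move=> a b; apply: dvar_nil.
set w := (1 + x j) * x i.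
have -> : evR (x i) (x j) (strict_series C)^-1 =
    (1 + x i) * \sum_(m < M) dscal R ((-1) ^+ m) * w ^+ m.
  set s := evR _ _ _; set t := _ * _.
  have st : evR (x i) (x j) (strict_series C) * t = 1.
    rewrite ev_strict // /t; set S := \sum_(m < _) _.
    have wS : (1 + w) * S = 1.
      have -> : S = \sum_(m < M) (- w) ^+ m.
        by apply: eq_bigr => m _; rewrite rmorphXn rmorphN1 -exprMn mulN1r.
      have := subrX1 (- w) M; rewrite exprNn exprMn (nilpairl pij) !mulr0 sub0r => E.
      by apply: oppr_inj; rewrite E; ring.
    have xi := ev_iotaE (dscal R) (nilpairl pij).
    transitivity ((1 + x i) * (1 + ev_iota (dscal R) M (x i)) * ((1 + w) * S)).
      by rewrite /w; ring.
    by rewrite wS mulr1.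
  have := ev_strictV (dscal R) pij; rewrite -/s => ss.
  by rewrite -[s]mul1r -st mulrAC ss mul1r.
move=> f fM; rewrite (StrictInvE _ _ fM); move: f fM.
apply: (representsM (represents_Eop i)).
apply: represents_sum => m; apply/represents_iter.
exact: representsM (represents_Eop j) (represents_Delta i).
Qed.

Lemma bethe_enum A :
  \prod_(p : 'I_n * 'I_n | (p.1 < p.2)%N) factor R A p.1 p.2 = bethe R A (enum 'I_n).
Proof.
have bethe_pairwise I : pairwise (fun i j : 'I_n => (i < j)%N) I ->
    bethe R A I = \prod_(i <- I) \prod_(j <- I | (i < j)%N) factor R A i j.
  elim: I => [|i I IHI] /=; first by rewrite big_nil.
  case/andP=> /allP iI pI; rewrite big_cons big_cons ltnn IHI //; congr (_ * _).
    by rewrite [LHS]big_seq [RHS]big_seq_cond; apply: eq_bigl => j; case: (boolP (j \in I)) =>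
        //= /iI ->.
  rewrite [LHS]big_seq [RHS]big_seq; apply: eq_bigr => j jI; rewrite big_cons ltnNge ltnW //.
  exact: iI.
rewrite bethe_pairwise; last first.
  rewrite -(pairwise_map (val : 'I_n -> nat) ltn) val_enum_ord.
  by rewrite -(sorted_pairwise ltn_trans) iota_ltn_sorted.
rewrite big_enum /= -(pair_big_dep xpredT (fun i j : 'I_n => (i < j)%N) (factor R A)) /=.
by apply: eq_bigr => i _; rewrite big_enum_cond.
Qed.

Lemma represents_hidden_operator A : represents (hidden_operator A) (bethe R A (enum 'I_n)).
Proof.
rewrite -bethe_enum /hidden_operator.
elim/big_rec2: _ => [|p q op _ rop]; first exact: represents_id.
apply: representsM rop; rewrite /factor ev_ratio; last exact: nilpair_var.
rewrite mulrC; apply: representsM; [exact: represents_StrictInv | exact: represents_fps_op].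
Qed.

End PolynomialFunctions.

(** * Identification of the Gelfand-Tsetlin polynomial *)

Section GelfandTsetlinPolynomial.
Variables (C : numFieldType) (n : nat).
Local Notation lattice_fun := (lattice_fun C n).
Implicit Types (F G : lattice_fun) (lam : 'I_n -> int) (f : {mpoly C[n]}).

Definition polynomial F := exists f, forall lam, F lam = mpoly_fun f lam.

Lemma polynomial_cst c : polynomial (fun=> c).
Proof. by exists c%:MP => lam; rewrite /mpoly_fun mevalC. Qed.

Lemma polynomialM F G : polynomial F -> polynomial G -> polynomial (fun lam => F lam * G lam).
Proof. by move=> [f E] [g E']; exists (f * g) => lam; rewrite /mpoly_fun mevalM E E'. Qed.

Lemma polynomialB F G : polynomial F -> polynomial G -> polynomial (fun lam => F lam - G lam).
Proof. by move=> [f E] [g E']; exists (f - g) => lam; rewrite /mpoly_fun mevalB E E'. Qed.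

Lemma polynomial_coord i : polynomial (fun lam => (lam i)%:~R).
Proof.
exists ('X_i + (i%:R)%:MP) => lam.
by rewrite /mpoly_fun mevalD mevalXU mevalC intrB -pmulrn subrK.
Qed.

Lemma polynomial_prod m (F : 'I_m -> lattice_fun) : (forall j, polynomial (F j)) ->
  polynomial (fun lam => \prod_(j < m) F j lam).
Proof.
elim: m F => [|m IHm] F pF.
  by case: (polynomial_cst 1) => f E; exists f => lam; rewrite big_ord0 -(E lam).
have := polynomialM (IHm _ (fun j => pF (widen_ord (leqnSn m) j))) (pF ord_max).
by case=> f E; exists f => lam; rewrite big_ord_recr -(E lam).
Qed.

Lemma polynomial_evenker h F : polynomial F -> polynomial (fun lam => evenker h (F lam)).
Proof.
move=> pF; apply: polynomialM; last exact: polynomial_cst.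
apply: polynomial_prod => j; apply: polynomialB; first exact: polynomial_cst.
exact: polynomialM.
Qed.

Lemma polynomial_rowker r F : polynomial F -> polynomial (fun lam => rowker r (F lam)).
Proof.
move=> pF; apply: polynomialM; last exact: polynomial_cst.
by apply: polynomial_prod => j; apply: polynomialB => //; apply: polynomial_cst.
Qed.

Lemma polynomial_contr (T : Type) (a : ('I_n -> int) -> T -> C) Psi s :
  (forall t, polynomial (fun lam => a lam t)) -> (forall s, polynomial (fun lam => Psi lam s)) ->
  polynomial (fun lam => contr (a lam) (Psi lam) s).
Proof.
move=> pa; elim: s Psi => [|t s IHs] Psi pPsi /=; first exact: polynomial_cst.
apply: polynomialB; first exact: polynomialM.
by apply: (IHs (fun lam s => Psi lam (t :: s))) => s'.
Qed.

Lemma polynomial_pf (T : Type) (w : ('I_n -> int) -> T -> T -> C) s :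
  (forall t u, polynomial (fun lam => w lam t u)) -> polynomial (fun lam => pf (w lam) s).
Proof.
move=> pw; rewrite /pf; move: (size s) => m; elim: m s => [|m IHm] [|t s] /=; try exact:
    polynomial_cst.
by apply: polynomial_contr.
Qed.

Lemma polynomial_GTlattice h I : polynomial (GTlattice C h I).
Proof.
pose s := [seq inl i | i <- I] ++ [seq inr r | r <- iota 0 (num_rows h (size I))] : seq ('I_n +
    nat).
pose g lam (z : 'I_n + nat) := match z with inl i => Pt (lam i) | inr r => Row r end.
suff [f E] : polynomial (fun lam => pf (fun y z => pairing C h (g lam y) (g lam z)) s).
  exists f => lam; rewrite /GTlattice !tensorE mul1r -E -pf_map /GTfun /coords size_map.
  by rewrite /s map_cat -!map_comp.
apply: polynomial_pf => -[i|r] [j|q] /=; try exact: polynomial_cst.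
  have [f E] := polynomial_evenker h (polynomialB (polynomial_coord j) (polynomial_coord i)).
  by exists f => lam; rewrite intrB E.
exact: polynomial_rowker (polynomial_coord i).
Qed.

Lemma meval_line (u v : 'I_n -> C) f : exists q : {poly C}, forall t,
  q.[t] = f.@[fun i => u i + v i * t].
Proof.
elim/mpolyind: f => [|c m f _ _ [q qE]]; first by exists 0 => t; rewrite horner0 meval0.
have [q' qE'] : exists q' : {poly C}, forall t, q'.[t] = ('X_[m]).@[fun i => u i + v i * t].
  exists (\prod_(i < n) ((u i)%:P + (v i)%:P * 'X) ^+ m i) => t.
  rewrite mevalX horner_prod; apply: eq_bigr => i _.
  by rewrite horner_exp hornerD hornerM !hornerC hornerX.
by exists (c *: q' + q) => t; rewrite hornerD hornerZ mevalD mevalZ qE qE'.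
Qed.

(* Moving in the direction (0, 1, ..., n - 1), one ends up with weakly
   increasing tuples. *)
Lemma eval_int_eq0 f : (forall k : n.-tuple int, sorted (fun x y => x <= y) k -> eval_int f k =
    0) ->
  forall k : n.-tuple int, eval_int f k = 0.
Proof.
move=> f0 k; pose kt (t : nat) := [tuple tnth k i + (i * t)%N%:Z | i < n].
have [q qE] := meval_line (fun i => (tnth k i)%:~R) (fun i => i%:R) f.
have ktE t : q.[t%:R] = eval_int f (kt t).
  rewrite qE; apply: meval_eq => i; rewrite tnth_mktuple intrD -natrM.
  by rewrite -pmulrn.
(* Two entries of [k] differ by at most $2B$, so adding $t\ge 2B$ per position makes the tuple
   weakly increasing. *)
pose B := (\sum_(i < n) `|tnth k i|)%N.
have kB i : (`|tnth k i| <= B)%N by rewrite /B (bigD1 i) //= leq_addr.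
have srt t : (B.*2 <= t)%N -> sorted (fun x y : int => x <= y) (kt t).
  move=> Bt; apply/(sortedP 0) => i; rewrite size_tuple => i1n.
  have i0n : (i < n)%N by apply: ltnW.
  rewrite -(tnth_nth 0 (kt t) (Ordinal i0n)) -(tnth_nth 0 (kt t) (Ordinal i1n)) !tnth_mktuple /=.
  have := kB (Ordinal i0n); have := kB (Ordinal i1n).
  rewrite mulSn; lia.
have q0 : q = 0.
  apply/eqP; apply: contraT => qn0.
  (* A nonzero [q] has fewer than [size q] roots. *)
  pose rs : seq C := [seq i%:R | i <- iota B.*2 (size q)].
  have : (size rs < size q)%N.
    apply: max_poly_roots => //.
      apply/allP => _ /mapP[t + ->]; rewrite mem_iota => /andP[Bt _].
      by rewrite /root ktE f0 // srt.
    by rewrite map_inj_uniq ?iota_uniq // => i j /eqP; rewrite eqr_nat => /eqP.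
  by rewrite size_map size_iota ltnn.
have := ktE 0%N; rewrite q0 horner0 => ->; congr eval_int.
by apply: eq_from_tnth => i; rewrite tnth_mktuple muln0 addr0.
Qed.

Lemma eval_int_mpoly_fun f (k : n.-tuple int) : eval_int f k = mpoly_fun f (strict_coords k).
Proof.
by apply: meval_eq => i; rewrite /strict_coords addrK -tnth_nth.
Qed.

(** The Pfaffian is polynomial and has the required values by the weak form of the counting theorem,
    so [xget] finds a polynomial with these values; [eval_int_eq0] shows that it is the same one. *)
Lemma GT_polyE h : (h <= n)%N -> mpoly_fun (GT_poly C h n) = GTlattice C h (ords n n).
Proof.
move=> hn; have [f fE] := polynomial_GTlattice h (ords n n).
have GTf : GTlattice C h (ords n n) = mpoly_fun f by exact: functional_extensionality_dep.
have fM : (msize f <= (msize f).+1)%N by [].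
have okT : deg_lt (msize f).+1 (GTlattice C h (ords n n)) by rewrite GTf; exact: deg_lt_mpoly_fun.
have cf : counts_GT h f.
  move=> k sk; rewrite eval_int_mpoly_fun num_GT_count_rows //.
  pose R := diff_opring C n (msize f).
  rewrite (@count_rows_wave C n _ R 0 false h n) ?size_tuple //.
  by rewrite /wave_fun /wave dact1 // GTf.
have cg : counts_GT h (GT_poly C h n) by exact: xgetPex (ex_intro _ f cf).
rewrite GTf; apply: functional_extensionality_dep => lam.
pose k := [tuple lam i - (nat_of_ord i)%:Z | i < n].
have E g : mpoly_fun g lam = eval_int g k.
  by apply: meval_eq => i; rewrite tnth_mktuple.
rewrite !E; apply/eqP; rewrite -subr_eq0 -mevalB; apply/eqP/eval_int_eq0 => k' sk.
by rewrite /eval_int mevalB; have := cf k' sk; have := cg k' sk; rewrite /eval_int => -> ->;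
    rewrite subrr.
Qed.

End GelfandTsetlinPolynomial.

Theorem theorem5 (R : realType) (h n : nat) (hn : (h <= n)%N)
    (A : fps2 R[i]) (hA : hidden A)
    (k : n.-tuple int) (hk : sorted (fun x y : int => x < y) k) :
  (MT h k)%:R = eval_int (hidden_operator A (GT_poly R[i] h n)) k.
Proof.
set p := GT_poly _ h n.
(* The nilpotency exponent comes from the size of $GT_h$ itself, so truncating the series loses
   nothing. *)
pose S := diff_opring R[i] n (msize p).
have okT : deg_lt (msize p).+1 (GTlattice R[i] h (ords n n)).
  by rewrite -GT_polyE //; apply: deg_lt_mpoly_fun.
rewrite MT_count_rows // (@count_rows_wave R[i] n _ S A true h n) ?size_tuple //.
have [_] := represents_hidden_operator S A (leqnSn (msize p)).
rewrite eval_int_mpoly_fun => ->.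
rewrite /wave_fun /wave /ords take_oversize ?size_enum_ord //.
by rewrite GT_polyE // /ords take_oversize ?size_enum_ord.
Qed.
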